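(* In the bounded-domain setup assume (E1) and $$\Delta_4:=\sup_D\big(|V(x,t)|+|\nabla V(x,t)|\big)+\sup_{\Gamma\times[0,\infty)}|g(x,t)|<\infty.$$ Then there is $C>0$ independent of $\sigma_0,g,V$ such that any solution $\sigma\in C(\overline D)\cap C^{2,1}_{x,t}(D)$ of the IBVP (Σ) satisfies $\sup_{x\in U}|\sigma(x,t)|\le C\big[e^{-\eta_1t}\sup_U|\sigma_0|+\Delta_4\big]$ for all $t>0$, where $\eta_1=\ln(1+\eta_0)/(qR^2)$. Moreover $\limsup_{t\to\infty}\sup_{x\in U}|\sigma(x,t)|\le C\Delta_5$, where $\Delta_5=\limsup_{t\to\infty}\big[\sup_{x\in U}(|V(x,t)|+|\nabla V(x,t)|)+\sup_{x\in\Gamma}|g(x,t)|\big]$.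
   Context: Setup. Fix $n\ge2$. For $i=1,2$: $g_i(s)=a^{(i)}_0+\sum_{j=1}^{N_i}a^{(i)}_js^{\alpha^{(i)}_j}$ ($s\ge0$), $a^{(i)}_0>0$, $a^{(i)}_j\ge0$, real $0<\alpha^{(i)}_1<\dots$; $G_i(u)=g_i(|u|)u$ ($u\in\mathbb R$). $f_1,f_2\in C([0,1])\cap C^1((0,1))$, $f_1(0)=0=f_2(1)$, $f_1'>0>f_2'$ on $(0,1)$; $p_c'\in C^1((0,1))$, $p_c'>0$; $F_i=1/(p_c'f_i)$. Fix $r_0>0$, $c_1,c_2$ with $c_1^2+c_2^2>0$, $s_0\in(0,1)$, and let $\hat S$ be the $C^1$ solution of $\hat S'=G_2(c_2r^{1-n})F_2(\hat S)-G_1(c_1r^{1-n})F_1(\hat S)$, $\hat S(r_0)=s_0$, $0<\hat S<1$, on its maximal interval $[r_0,R_{\max})$. For $r_0\le|x|<R_{\max}$: $S_*(x)=\hat S(|x|)$, $u_i^*(x)=c_i|x|^{-n}x$. For $u\in\mathbb R^n$: $\mathbf G_i(u)=g_i(|u|)u$, Jacobian $\mathbf G_i'(u)=g_i(|u|)I_n+g_i'(|u|)uu^T/|u|$ ($=g_i(0)I_n$ at $u=0$). $B(x)=F_1(S_* )\mathbf G_1'(u_1^* )+F_2(S_* )\mathbf G_2'(u_2^* )$ (symmetric positive definite), $A=B^{-1}$, $b(x)=F_2'(S_* )\mathbf G_2(u_2^* )-F_1'(S_* )\mathbf G_1(u_1^* )$. $C^{2,1}_{x,t}$: continuous with continuous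 $x$-derivatives up to order 2 and $t$-derivative of order 1; $C^m_x$ similarly for $x$-derivatives up to order $m$. Bounded-domain setup: fix $R\in(r_0,R_{\max})$ with $0<\underline s\le\hat S(r)\le\bar s<1$ on $[r_0,R]$; $U$ open bounded, $U\subset B_R\setminus\overline{B_{r_0}}$, $\Gamma=\partial U$, $D=U\times(0,\infty)$. Constants: $d_0=\min\{g_1(0),g_2(0)\}$, $d_1=\sum_i g_i(|c_i|r_0^{1-n})$, $d_2=\sum_i g_i(|c_i|r_0^{1-n})|c_i|r_0^{1-n}$, $d_3=\sum_i g_i'(|c_i|r_0^{1-n})|c_i|r_0^{1-n}$ (terms with $c_i=0$ read as $0$), $d_4=d_1+d_3$; $\mu_1=\sum_i\max_{[\underline s,\bar s]}F_i$, $\mu_2=\sum_i\min_{[\underline s,\bar s]}F_i$, $\mu_3=\sum_i\max_{[\underline s,\bar s]}|F_i'|$; $C_0=d_4\mu_1$, $C_1=d_0\mu_2$, $C_2=d_2\mu_3$; $\kappa_0=C_0/(2C_1)$, $s_R=\kappa_0(n+C_2R)$, $q=\kappa_0C_0/(2s_R)$, $\eta_0=(r_0/R)^{2s_R}$. Given the total velocity $V:\overline D\to\mathbb R^n$, set $c(x,t)=F_1(S_*(x))\mathbf G_1'(u_1^*(x))V(x,t)$. IBVP (Σ): $\sigma_t=\nabla\cdot[A(\nabla\sigma-\sigma b)]+\nabla\cdot(Ac)$ in $D$, $\sigma=g$ on $\Gamma\times(0,\infty)$, $\sigma(x,0)=\sigma_0(x)$ in $U$, where $\sigma_0\in C(\overline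 U)$, $g\in C(\Gamma\times[0,\infty))$, $\sigma_0=g(\cdot,0)$ on $\Gamma$. Condition (E1): $F_1,F_2\in C^7((0,1))$, $V\in C^6_x(\overline D)$, $V_t\in C^3_x(\overline D)$ (under (E1), (Σ) has a unique classical solution). *)

(* Defs.v *)
From Stdlib Require Import Reals Lra List.
Open Scope R_scope.

Fixpoint fsum (m : nat) (f : nat -> R) : R :=
  match m with O => 0 | S k => fsum k f + f k end.

(* s^a for s >= 0 and a > 0 (0^a := 0) *)
Definition rpow (s a : R) : R := if Rle_dec s 0 then 0 else Rpower s a.

Definition kdelta (k l : nat) : R := if Nat.eq_dec k l then 1 else 0.

Definition is_max_on (F : R -> R) (a b m : R) : Prop :=
  (exists s, a <= s <= b /\ F s = m) /\ (forall s, a <= s <= b -> F s <= m).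
Definition is_min_on (F : R -> R) (a b m : R) : Prop :=
  (exists s, a <= s <= b /\ F s = m) /\ (forall s, a <= s <= b -> m <= F s).

Definition is_limsup_infty (h : R -> R) (L : R) : Prop :=
  (forall eps, 0 < eps -> exists T, forall t, T <= t -> h t <= L + eps) /\
  (forall eps, 0 < eps -> forall T, exists t, T <= t /\ L - eps <= h t).

Definition cont_closed (f : R -> R) (a b : R) : Prop :=
  forall x, a <= x <= b -> limit1_in f (fun y => a <= y <= b) (f x) x.

Definition Ck_open (k : nat) (f : R -> R) (a b : R) : Prop :=
  exists Df : nat -> R -> R,
    Df O = f /\
    (forall j x, (j < k)%nat -> a < x < b -> derivable_pt_lim (Df j) x (Df (S j) x)) /\
    (forall x, a < x < b -> continuity_pt (Df k) x).

Record gdata := mkg { ga0 : R; gN : nat; ga : nat -> R; galpha : nat -> R }.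

Definition gvalid (d : gdata) : Prop :=
  0 < ga0 d /\
  (forall j, (1 <= j <= gN d)%nat -> 0 <= ga d j) /\
  ((1 <= gN d)%nat -> 0 < galpha d 1) /\
  (forall j, (1 <= j)%nat -> (j < gN d)%nat -> galpha d j < galpha d (S j)).

Definition gfun (d : gdata) (s : R) : R :=
  ga0 d + fsum (gN d) (fun j => ga d (S j) * rpow s (galpha d (S j))).

(* g'(s) for s > 0 *)
Definition gder (d : gdata) (s : R) : R :=
  fsum (gN d) (fun j => ga d (S j) * galpha d (S j) * rpow s (galpha d (S j) - 1)).

Definition Gs (d : gdata) (u : R) : R := gfun d (Rabs u) * u.

Definition pt := nat -> R.
Definition is_pt (n : nat) (x : pt) : Prop := forall k, (n <= k)%nat -> x k = 0.

Definition vnorm (n : nat) (x : pt) : R := sqrt (fsum n (fun k => x k ^ 2)).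
Definition vdist (n : nat) (x y : pt) : R := vnorm n (fun k => x k - y k).

Definition Gv (n : nat) (d : gdata) (u : pt) : pt := fun k => gfun d (vnorm n u) * u k.

Definition Gjac (n : nat) (d : gdata) (u : pt) (k l : nat) : R :=
  if Req_EM_T (vnorm n u) 0 then gfun d 0 * kdelta k l
  else gfun d (vnorm n u) * kdelta k l
       + gder d (vnorm n u) * u k * u l / vnorm n u.

Definition Rn_open (n : nat) (U : pt -> Prop) : Prop :=
  forall x, U x -> is_pt n x /\
    exists e, 0 < e /\ forall y, is_pt n y -> vdist n x y < e -> U y.
Definition Rn_bounded (n : nat) (U : pt -> Prop) : Prop :=
  exists M, forall x, U x -> vnorm n x <= M.
Definition Rn_closure (n : nat) (U : pt -> Prop) (x : pt) : Prop :=
  is_pt n x /\ forall e, 0 < e -> exists y, U y /\ vdist n x y < e.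
Definition Rn_boundary (n : nat) (U : pt -> Prop) (x : pt) : Prop :=
  Rn_closure n U x /\ ~ U x.

Definition cont_on_sp (n : nat) (S : pt -> Prop) (f : pt -> R) : Prop :=
  forall x, S x -> forall e, 0 < e -> exists d, 0 < d /\
    forall y, S y -> vdist n x y < d -> Rabs (f y - f x) < e.

Definition cont_on_st (n : nat) (S : pt -> R -> Prop) (f : pt -> R -> R) : Prop :=
  forall x t, S x t -> forall e, 0 < e -> exists d, 0 < d /\
    forall y s, S y s -> sqrt (vdist n x y ^ 2 + (t - s) ^ 2) < d ->
      Rabs (f y s - f x t) < e.

Definition upd (x : pt) (k : nat) (h : R) : pt :=
  fun j => if Nat.eq_dec j k then x j + h else x j.
Definition pd (f : pt -> R) (x : pt) (k : nat) (l : R) : Prop :=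
  derivable_pt_lim (fun h => f (upd x k h)) 0 l.

(* f in C^m_x(Dc) with Dom the (open in x) interior: Df l = d_{l_1} ... d_{l_p} f
   (list l of coordinate indices), the derivatives exist in Dom and extend
   continuously to Dc *)
Definition Cmx (n m : nat) (Dom Dc : pt -> R -> Prop) (f : pt -> R -> R)
  (Df : list nat -> pt -> R -> R) : Prop :=
  Df nil = f /\
  (forall l k x t, (length l < m)%nat -> (k < n)%nat -> Dom x t ->
      pd (fun y => Df l y t) x k (Df (k :: l) x t)) /\
  (forall l, (length l <= m)%nat -> (forall k, In k l -> (k < n)%nat) ->
      cont_on_st n Dc (Df l)).

Definition Fcoef (pc f : R -> R) (s : R) : R := / (pc s * f s).

Definition ustar (n : nat) (c : R) (x : pt) : pt := fun k => c * / (vnorm n x ^ n) * x k.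

Definition Bmat (n : nat) (gd1 gd2 : gdata) (F1 F2 Shat : R -> R) (c1 c2 : R)
  (x : pt) (k l : nat) : R :=
  F1 (Shat (vnorm n x)) * Gjac n gd1 (ustar n c1 x) k l
  + F2 (Shat (vnorm n x)) * Gjac n gd2 (ustar n c2 x) k l.

Definition bvec (n : nat) (gd1 gd2 : gdata) (dF1 dF2 Shat : R -> R) (c1 c2 : R)
  (x : pt) (k : nat) : R :=
  dF2 (Shat (vnorm n x)) * Gv n gd2 (ustar n c2 x) k
  - dF1 (Shat (vnorm n x)) * Gv n gd1 (ustar n c1 x) k.

Definition cvec (n : nat) (gd1 : gdata) (F1 Shat : R -> R) (c1 : R)
  (V : pt -> R -> pt) (x : pt) (t : R) (k : nat) : R :=
  F1 (Shat (vnorm n x)) * fsum n (fun l => Gjac n gd1 (ustar n c1 x) k l * V x t l).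

Definition rr0 (n : nat) (r0 : R) : R := rpow r0 (1 - INR n).

Definition d0c (gd1 gd2 : gdata) : R := Rmin (gfun gd1 0) (gfun gd2 0).
Definition d1c n gd1 gd2 c1 c2 r0 : R :=
  gfun gd1 (Rabs c1 * rr0 n r0) + gfun gd2 (Rabs c2 * rr0 n r0).
Definition d2c n gd1 gd2 c1 c2 r0 : R :=
  gfun gd1 (Rabs c1 * rr0 n r0) * (Rabs c1 * rr0 n r0)
  + gfun gd2 (Rabs c2 * rr0 n r0) * (Rabs c2 * rr0 n r0).
Definition d3term n (gd : gdata) c r0 : R :=
  if Req_EM_T c 0 then 0 else gder gd (Rabs c * rr0 n r0) * (Rabs c * rr0 n r0).
Definition d3c n gd1 gd2 c1 c2 r0 : R := d3term n gd1 c1 r0 + d3term n gd2 c2 r0.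
Definition d4c n gd1 gd2 c1 c2 r0 : R := d1c n gd1 gd2 c1 c2 r0 + d3c n gd1 gd2 c1 c2 r0.

Definition eta1c (n : nat) (gd1 gd2 : gdata) (c1 c2 r0 RR mu1 mu2 mu3 : R) : R :=
  let C0 := d4c n gd1 gd2 c1 c2 r0 * mu1 in
  let C1 := d0c gd1 gd2 * mu2 in
  let C2 := d2c n gd1 gd2 c1 c2 r0 * mu3 in
  let kappa0 := C0 / (2 * C1) in
  let sR := kappa0 * (INR n + C2 * RR) in
  let q := kappa0 * C0 / (2 * sR) in
  let eta0 := Rpower (r0 / RR) (2 * sR) in
  ln (1 + eta0) / (q * RR ^ 2).

(* Main.v *)
(** The drift is a radial gradient, b = grad Lam(|x|), so w = exp(-Lam) sigma solves a parabolic
    equation without zero-order term, whose source is bounded by a multiple of |V| + |grad V|.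
    The matrix A has x as an eigenvector, with eigenvalue aR(|x|).  For
    psi(r) = eta1 (r - r0) exp(C2 (r - r0)) the function phi with phi(r0) = 1 and phi' = - psi / aR
    satisfies div(exp(Lam) A grad phi) <= - eta1 exp(Lam), and the explicit value of eta1 is just
    small enough for phi to stay positive on [r0, R].  Hence
    (H exp(-eta1 (t - T0)) + M) phi(|x|) is a supersolution for suitable constants H and M, and the
    maximum principle bounds both w and - w by it; T0 = 0 gives the first estimate, and a large T0
    the second one. *)
Require Import Defs.
From Stdlib Require Import Reals Lra Lia List FunctionalExtensionality ClassicalEpsilon.
From Coquelicot Require Import Coquelicot.
Open Scope R_scope.

(** * Finite sums, Euclidean norm, extreme values *)

(** The divergence of sigma A b contains a zero-order term without a sign, so no maximum principle
    holds for sigma itself; the weight exp(-Lam) removes that term, since grad sigma - sigma b =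
    exp(Lam) grad w. The eigenvalues of A are only as smooth as [Shat] allows, and this dictates
    phi' = - psi / aR: the flux A grad phi is then - psi(r) x / r, the eigenvalue cancels, and the
    weighted divergence is - exp(Lam) (psi' + (n - 1) psi / r + Lam' psi). Since |Lam'| <= C2, the
    exponential in psi pays for Lam' psi. The supersolution property also uses phi <= 1: the time
    derivative costs eta1 H exp(-eta1 (t - T0)) phi, while the elliptic part yields the same without
    the factor phi. Positivity of phi is where the explicit rate enters: 1 / aR <= C0, so phi drops
    by at most C0 eta1 exp(C2 (R - r0)) (R - r0)^2 / 2 on [r0, R], and eta0 = (r0 / R)^(2 s_R) is
    small enough to keep this below 1. *)

Lemma fsum_ext (n : nat) (f g : nat -> R) :
  (forall k, (k < n)%nat -> f k = g k) -> fsum n f = fsum n g.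
Proof.
  induction n as [|n IH]; simpl; intros H; [reflexivity|].
  rewrite IH by (intros; apply H; lia). rewrite (H n) by lia. reflexivity.
Qed.

Lemma fsum_plus (n : nat) (f g : nat -> R) :
  fsum n (fun k => f k + g k) = fsum n f + fsum n g.
Proof. induction n as [|n IH]; simpl; [|rewrite IH]; ring. Qed.

Lemma fsum_scal (n : nat) (a : R) (f : nat -> R) :
  fsum n (fun k => a * f k) = a * fsum n f.
Proof. induction n as [|n IH]; simpl; [|rewrite IH]; ring. Qed.

Lemma fsum_le (n : nat) (f g : nat -> R) :
  (forall k, (k < n)%nat -> f k <= g k) -> fsum n f <= fsum n g.
Proof.
  induction n as [|n IH]; simpl; intros H; [lra|].
  apply Rplus_le_compat; [apply IH; intros|]; apply H; lia.
Qed.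

Lemma fsum_nonneg (n : nat) (f : nat -> R) :
  (forall k, (k < n)%nat -> 0 <= f k) -> 0 <= fsum n f.
Proof.
  induction n as [|n IH]; simpl; intros H; [lra|].
  apply Rplus_le_le_0_compat; [apply IH; intros|]; apply H; lia.
Qed.

Lemma fsum_term_le (n : nat) (f : nat -> R) (k : nat) :
  (forall j, (j < n)%nat -> 0 <= f j) -> (k < n)%nat -> f k <= fsum n f.
Proof.
  induction n as [|n IH]; simpl; intros H Hk; [lia|].
  destruct (Nat.eq_dec k n) as [->|Hn].
  - pose proof (fsum_nonneg n f ltac:(intros; apply H; lia)). lra.
  - specialize (IH ltac:(intros; apply H; lia) ltac:(lia)).
    specialize (H n ltac:(lia)). lra.
Qed.

Lemma fsum_exchange (n m : nat) (f : nat -> nat -> R) :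
  fsum n (fun i => fsum m (fun j => f i j)) = fsum m (fun j => fsum n (fun i => f i j)).
Proof.
  induction n as [|n IH]; simpl.
  - induction m as [|m IHm]; simpl; [|rewrite <- IHm]; ring.
  - rewrite IH, fsum_plus. reflexivity.
Qed.

Lemma fsum_Rabs (n : nat) (f : nat -> R) : Rabs (fsum n f) <= fsum n (fun k => Rabs (f k)).
Proof.
  induction n as [|n IH]; simpl; [rewrite Rabs_R0; lra|].
  eapply Rle_trans; [apply Rabs_triang|]. lra.
Qed.

Lemma kdelta_sym (k l : nat) : kdelta k l = kdelta l k.
Proof. unfold kdelta. destruct (Nat.eq_dec k l), (Nat.eq_dec l k); congruence. Qed.

Lemma fsum_kdelta (n k : nat) (f : nat -> R) :
  (k < n)%nat -> fsum n (fun j => kdelta k j * f j) = f k.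
Proof.
  intros Hk. assert (H : forall m, (m <= k)%nat -> fsum m (fun j => kdelta k j * f j) = 0).
  { induction m as [|m IH]; simpl; intros Hm; [reflexivity|].
    rewrite IH by lia. unfold kdelta. destruct (Nat.eq_dec k m); [lia|ring]. }
  induction n as [|n IH]; [lia|]. simpl.
  destruct (Nat.eq_dec k n) as [->|Hn].
  - rewrite H by lia. unfold kdelta. destruct (Nat.eq_dec n n); [ring|lia].
  - rewrite IH by lia. unfold kdelta at 1. destruct (Nat.eq_dec k n); [lia|ring].
Qed.

Lemma fsum_sqr_nonneg (n : nat) (x : pt) : 0 <= fsum n (fun k => x k ^ 2).
Proof. apply fsum_nonneg; intros; apply pow2_ge_0. Qed.

Lemma vnorm_nonneg (n : nat) (x : pt) : 0 <= vnorm n x.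
Proof. apply sqrt_pos. Qed.

Lemma vnorm_sqr (n : nat) (x : pt) : vnorm n x ^ 2 = fsum n (fun k => x k ^ 2).
Proof. unfold vnorm. rewrite <- Rsqr_pow2. apply Rsqr_sqrt, fsum_sqr_nonneg. Qed.

Lemma vnorm_sqr_mul (n : nat) (x : pt) : fsum n (fun k => x k * x k) = vnorm n x ^ 2.
Proof. rewrite vnorm_sqr. apply fsum_ext; intros; ring. Qed.

Lemma vnorm_ext (n : nat) (x y : pt) :
  (forall k, (k < n)%nat -> x k = y k) -> vnorm n x = vnorm n y.
Proof. intros H. unfold vnorm. f_equal. apply fsum_ext. intros; rewrite H; auto. Qed.

Lemma coord_le_vnorm (n : nat) (x : pt) (k : nat) : (k < n)%nat -> Rabs (x k) <= vnorm n x.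
Proof.
  intros Hk. apply Rsqr_incr_0; [|apply Rabs_pos|apply vnorm_nonneg].
  rewrite <- Rsqr_abs, !Rsqr_pow2, vnorm_sqr.
  apply (fsum_term_le n (fun k => x k ^ 2)); auto. intros; apply pow2_ge_0.
Qed.

Lemma vnorm_le (n : nat) (x : pt) (a : R) :
  0 <= a -> fsum n (fun k => x k ^ 2) <= a ^ 2 -> vnorm n x <= a.
Proof.
  intros Ha H. apply Rsqr_incr_0; [|apply vnorm_nonneg|assumption].
  rewrite !Rsqr_pow2, vnorm_sqr. assumption.
Qed.

Lemma vnorm_le_sum (n : nat) (x : pt) (a : R) :
  (forall k, (k < n)%nat -> Rabs (x k) <= a) -> 0 <= a -> vnorm n x <= INR n * a.
Proof.
  intros H Ha. apply vnorm_le; [apply Rmult_le_pos; [apply pos_INR|assumption]|].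
  induction n as [|n IH]; [simpl; lra|]. cbn [fsum]. rewrite S_INR.
  specialize (IH ltac:(intros; apply H; lia)). specialize (H n ltac:(lia)).
  assert (x n ^ 2 <= a ^ 2).
  { rewrite <- (pow2_abs (x n)). apply pow_incr. split; [apply Rabs_pos|assumption]. }
  pose proof (pos_INR n). nra.
Qed.

Lemma cauchy_schwarz (n : nat) (x y : pt) :
  Rabs (fsum n (fun k => x k * y k)) <= vnorm n x * vnorm n y.
Proof.
  assert (H : (fsum n (fun k => x k * y k)) ^ 2 <= (vnorm n x * vnorm n y) ^ 2).
  { rewrite Rpow_mult_distr, !vnorm_sqr.
    set (X := fsum n (fun k => x k ^ 2)). set (Y := fsum n (fun k => y k ^ 2)).
    set (s := fsum n (fun k => x k * y k)).
    assert (HX : 0 <= X) by apply fsum_sqr_nonneg.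
    assert (HY : 0 <= Y) by apply fsum_sqr_nonneg.
    assert (E : forall a b, 0 <= a ^ 2 * X + (2 * a * b) * s + b ^ 2 * Y).
    { intros a b. unfold X, Y, s. rewrite <- !fsum_scal, <- !fsum_plus.
      apply fsum_nonneg. intros k _.
      replace (_ + _) with ((a * x k + b * y k) ^ 2) by ring. apply pow2_ge_0. }
    (* At (a, b) = (Y, -s) the form equals Y (X Y - s^2). If Y = 0, the choice (s, -(X + 1)) gives -
       s^2 (X + 2), which forces s = 0. *)
    pose proof (E Y (- s)) as E1.
    destruct (Rle_lt_or_eq_dec _ _ HY) as [Hp|H0].
    - apply Rmult_le_reg_l with Y; [assumption|]. nra.
    - rewrite <- H0 in *. pose proof (E s (- (X + 1))). nra. }
  apply Rsqr_incr_0; [|apply Rabs_pos|apply Rmult_le_pos; apply vnorm_nonneg].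
  rewrite <- Rsqr_abs, !Rsqr_pow2. assumption.
Qed.

Lemma vnorm_triang (n : nat) (x y : pt) : vnorm n (fun k => x k + y k) <= vnorm n x + vnorm n y.
Proof.
  apply vnorm_le; [pose proof (vnorm_nonneg n x); pose proof (vnorm_nonneg n y); lra|].
  replace (fsum n (fun k => (x k + y k) ^ 2))
    with (fsum n (fun k => x k ^ 2) + 2 * fsum n (fun k => x k * y k) + fsum n (fun k => y k ^ 2)).
  - rewrite <- !vnorm_sqr. pose proof (cauchy_schwarz n x y) as H.
    pose proof (Rle_abs (fsum n (fun k => x k * y k))). nra.
  - rewrite <- fsum_scal, <- !fsum_plus. apply fsum_ext; intros; ring.
Qed.

Lemma vdist_sym (n : nat) (x y : pt) : vdist n x y = vdist n y x.
Proof. unfold vdist, vnorm. f_equal. apply fsum_ext; intros; ring. Qed.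

Lemma vdist_refl (n : nat) (x : pt) : vdist n x x = 0.
Proof.
  apply Rle_antisym; [|apply vnorm_nonneg]. apply vnorm_le; [lra|].
  rewrite (fsum_ext n _ (fun k => 0 * 0)) by (intros; ring). rewrite fsum_scal. lra.
Qed.

Lemma vdist_triang (n : nat) (x y z : pt) : vdist n x z <= vdist n x y + vdist n y z.
Proof.
  unfold vdist. eapply Rle_trans; [|apply vnorm_triang].
  right. apply vnorm_ext. intros; ring.
Qed.

Lemma vnorm_vdist (n : nat) (x y : pt) : Rabs (vnorm n x - vnorm n y) <= vdist n x y.
Proof.
  assert (H : forall a b, vnorm n a <= vnorm n b + vdist n a b).
  { intros a b. unfold vdist. eapply Rle_trans; [|apply vnorm_triang].
    right. apply vnorm_ext. intros; ring. }
  pose proof (H x y). pose proof (H y x) as H2. rewrite (vdist_sym n y x) in H2.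
  apply Rabs_le. lra.
Qed.

(** Bridge to [compactness_list], which covers boxes of nested pairs [Tn n R]; the round trip from a
    point and back is the identity only for points that vanish from index n on. *)
Fixpoint pt_of_Tn (n : nat) : Compactness.Tn n R -> pt :=
  match n with
  | O => fun _ _ => 0
  | S m => fun v k => match k with O => fst v | S j => pt_of_Tn m (snd v) j end
  end.

Fixpoint Tn_of_pt (n : nat) (x : pt) : Compactness.Tn n R :=
  match n with
  | O => tt
  | S m => (x O, Tn_of_pt m (fun k => x (S k)))
  end.

Lemma pt_of_Tn_of_pt (n : nat) (x : pt) : is_pt n x -> pt_of_Tn n (Tn_of_pt n x) = x.
Proof.
  revert x. induction n as [|n IH]; intros x Hx; apply functional_extensionality; intros k; simpl.
  - rewrite Hx; [reflexivity|lia].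
  - destruct k; [reflexivity|]. rewrite (IH (fun k => x (S k))); [reflexivity|].
    intros j Hj. apply Hx. lia.
Qed.

Lemma is_pt_of_Tn (n : nat) (v : Compactness.Tn n R) : is_pt n (pt_of_Tn n v).
Proof.
  induction n as [|n IH]; intros k Hk; simpl; [reflexivity|].
  destruct k; [lia|]. apply IH. lia.
Qed.

Lemma bounded_Tn_of_pt (n : nat) (M : R) (x : pt) :
  (forall k, (k < n)%nat -> Rabs (x k) <= M) ->
  bounded_n n (Tn_of_pt n (fun _ => - M)) (Tn_of_pt n (fun _ => M)) (Tn_of_pt n x).
Proof.
  revert x. induction n as [|n IH]; intros x H; simpl; [trivial|]. split.
  - apply Rabs_le_between, H. lia.
  - apply IH. intros; apply H; lia.
Qed.

Lemma close_Tn_coord (n : nat) (d : R) (u v : Compactness.Tn n R) (k : nat) :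
  close_n n d u v -> (k < n)%nat -> Rabs (pt_of_Tn n u k - pt_of_Tn n v k) < d.
Proof.
  revert k. induction n as [|n IH]; intros k H Hk; [lia|].
  destruct u as [u1 u2], v as [v1 v2]. destruct H as [H1 H2]. simpl.
  destruct k; [assumption|]. apply IH; [assumption|lia].
Qed.

Lemma close_Tn_vdist (n : nat) (d : R) (u v : Compactness.Tn n R) :
  0 < d -> close_n n (d / (INR n + 1)) u v -> vdist n (pt_of_Tn n v) (pt_of_Tn n u) < d.
Proof.
  intros Hd H. pose proof (pos_INR n).
  assert (Hq : 0 < d / (INR n + 1)) by (apply Rdiv_lt_0_compat; lra).
  apply Rle_lt_trans with (INR n * (d / (INR n + 1))).
  - rewrite vdist_sym. apply vnorm_le_sum; [|lra].
    intros k Hk. apply Rlt_le. apply close_Tn_coord with (k := k) in H; assumption.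
  - replace d with ((INR n + 1) * (d / (INR n + 1))) at 2 by (field; lra). nra.
Qed.

Lemma list_argmax (A : Type) (h : A -> R) (l : list A) :
  l <> nil -> exists a, In a l /\ forall b, In b l -> h b <= h a.
Proof.
  induction l as [|a l IH]; intros H; [congruence|].
  destruct l as [|b l].
  - exists a. split; [now left|]. intros b [->|[]]. lra.
  - destruct IH as (m & Hm & Hmax); [discriminate|].
    destruct (Rle_dec (h m) (h a)) as [Hle|Hgt].
    + exists a. split; [now left|]. intros c [->|Hc]; [lra|]. specialize (Hmax c Hc). lra.
    + exists m. split; [now right|]. intros c [->|Hc]; [lra|]. auto.
Qed.

Lemma extreme_value (n : nat) (U : pt -> Prop) (a b : R) (f : pt -> R -> R) :
  Rn_bounded n U -> (exists x, Rn_closure n U x) -> a <= b ->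
  cont_on_st n (fun x t => Rn_closure n U x /\ a <= t <= b) f ->
  exists x t, Rn_closure n U x /\ a <= t <= b /\
    forall y s, Rn_closure n U y -> a <= s <= b -> f y s <= f x t.
Proof.
  intros [M HM] [x0 Hx0] Hab Hf.
  apply NNPP. intros Hno.
  set (K := fun x t => Rn_closure n U x /\ a <= t <= b) in *.
  (* A point where [f] is smaller than at some other point of [K] is covered by a
     neighbourhood with the same property; finitely many of these would bound [f]
     below its own value at one of their witnesses. *)
  assert (Hbig : forall x t, K x t -> exists y s, K y s /\ f x t < f y s).
  { intros x t [Hx Ht]. apply NNPP. intros Hn. apply Hno. exists x, t.
    split; [assumption|]. split; [assumption|]. intros y s Hy Hs.
    apply Rnot_lt_le. intros Hlt. apply Hn. exists y, s. split; [split|]; assumption. }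
  assert (Hcov : forall v : Compactness.Tn (S n) R, exists d : posreal, exists q : pt * R,
     K (fst q) (snd q) /\
     forall w : Compactness.Tn (S n) R, close_n (S n) d w v ->
        K (pt_of_Tn n (snd w)) (fst w) ->
        f (pt_of_Tn n (snd w)) (fst w) < f (fst q) (snd q)).
  { intros [t v]. set (x := pt_of_Tn n v).
    assert (Hx : is_pt n x) by apply is_pt_of_Tn.
    pose proof (pos_INR n) as Hn.
    destruct (classic (K x t)) as [HK|HK].
    - destruct (Hbig x t HK) as (y & s & Hys & Hlt).
      destruct (Hf x t HK (f y s - f x t) ltac:(lra)) as (d & Hd & Hclose).
      assert (Hp : 0 < (d / 2) / (INR n + 1)) by (apply Rdiv_lt_0_compat; lra).
      exists (mkposreal _ Hp), (y, s). split; [assumption|].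
      intros [s' v'] [Hc1 Hc2] HKw. simpl in *.
      specialize (Hclose (pt_of_Tn n v') s' HKw).
      apply close_Tn_vdist in Hc2; [|lra].
      assert (Hq : d / 2 / (INR n + 1) <= d / 2).
      { apply Rmult_le_reg_r with (INR n + 1); [lra|].
        replace (d / 2 / (INR n + 1) * (INR n + 1)) with (d / 2) by (field; lra). nra. }
      assert (Hs : sqrt (vdist n x (pt_of_Tn n v') ^ 2 + (t - s') ^ 2) < d).
      { rewrite <- (sqrt_pow2 d) by lra. apply sqrt_lt_1_alt.
        assert (H0 : 0 <= vdist n x (pt_of_Tn n v')) by apply vnorm_nonneg.
        assert (H1 : vdist n x (pt_of_Tn n v') < d / 2) by exact Hc2.
        assert (H2 : Rabs (t - s') <= d / 2) by (rewrite Rabs_minus_sym; lra).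
        rewrite <- (pow2_abs (t - s')). pose proof (Rabs_pos (t - s')) as H3.
        clear - H0 H1 H2 H3. split; nra. }
      specialize (Hclose Hs). apply Rabs_def2 in Hclose. lra.
    (* A point outside K has a neighbourhood that misses K: either x is at positive distance from U,
       or t lies outside [a, b]. The witness [q] is then arbitrary, as the covering condition is
       vacuous. *)
    - assert (Hout : exists d : posreal, forall w : Compactness.Tn (S n) R,
         close_n (S n) d w (t, v) -> ~ K (pt_of_Tn n (snd w)) (fst w)).
      { destruct (classic (a <= t <= b)) as [Ht|Ht].
        - assert (HU : ~ Rn_closure n U x) by (intros HU; apply HK; split; assumption).
          assert (He : exists e, 0 < e /\ forall y, U y -> e <= vdist n x y).
          { apply NNPP. intros Hne. apply HU. split; [assumption|]. intros e He.
            apply NNPP. intros Hne2. apply Hne. exists e. split; [assumption|].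
            intros y Hy. apply Rnot_lt_le. intros Hl. apply Hne2. exists y. tauto. }
          destruct He as (e & He & Hfar).
          assert (Hp : 0 < (e / 2) / (INR n + 1)) by (apply Rdiv_lt_0_compat; lra).
          exists (mkposreal _ Hp). intros [s w] [_ Hc] [[_ Hw] _]. simpl in Hc, Hw.
          apply close_Tn_vdist in Hc; [|lra].
          destruct (Hw (e / 2) ltac:(lra)) as (y & Hy & Hyd).
          specialize (Hfar y Hy). pose proof (vdist_triang n x (pt_of_Tn n w) y).
          fold x in Hc. lra.
        - assert (Hd : exists d : posreal, forall s, Rabs (s - t) < d -> ~ (a <= s <= b)).
          { destruct (Rlt_dec t a) as [Hl|Hl].
            - exists (mkposreal (a - t) ltac:(lra)). simpl. intros s Hs.
              apply Rabs_def2 in Hs. lra.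
            - assert (b < t) by lra. exists (mkposreal (t - b) ltac:(lra)). simpl.
              intros s Hs. apply Rabs_def2 in Hs. lra. }
          destruct Hd as [d Hd]. exists d. intros [s w] [Hc _] [_ Hk].
          exact (Hd s Hc Hk). }
      destruct Hout as [d Hd]. exists d, (x0, a). split; [split; [assumption|simpl; lra]|].
      intros w Hc Hk. exfalso. exact (Hd w Hc Hk). }
  destruct (choice _ Hcov) as [delta Hdelta].
  destruct (choice _ Hdelta) as [q Hq]. clear Hdelta.
  (* The head component is time. Closure points lie within 1 of U, so their coordinates are at most
     M + 1 in absolute value. *)
  apply (compactness_list (S n) (a, Tn_of_pt n (fun _ => - (M + 1)))
           (b, Tn_of_pt n (fun _ => M + 1)) delta).
  intros (l & Hl).
  assert (Hin : forall x t, K x t -> exists p, In p l /\ f x t < f (fst (q p)) (snd (q p))).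
  { intros x t [Hx Ht]. destruct (Hl (t, Tn_of_pt n x)) as (p & Hp & _ & Hclose).
    - split; [assumption|]. apply bounded_Tn_of_pt. intros k Hk.
      destruct Hx as [_ Hx]. destruct (Hx 1 ltac:(lra)) as (y & Hy & Hyd).
      specialize (HM y Hy). pose proof (coord_le_vnorm n x k Hk).
      pose proof (vnorm_vdist n x y) as Hv. apply Rabs_le_between in Hv. lra.
    - exists p. split; [assumption|].
      destruct (Hq p) as [_ Hqp]. specialize (Hqp _ Hclose). simpl in Hqp.
      rewrite pt_of_Tn_of_pt in Hqp by apply Hx. apply Hqp. split; assumption. }
  destruct (Hin x0 a ltac:(split; [assumption|lra])) as (p0 & Hp0 & _).
  destruct (list_argmax _ (fun p => f (fst (q p)) (snd (q p))) l) as (p & Hp & Hmax).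
  { intros ->. contradiction. }
  destruct (Hq p) as [HKp _]. destruct (Hin _ _ HKp) as (p' & Hp' & Hlt).
  specialize (Hmax p' Hp'). simpl in Hmax. lra.
Qed.

(** * Directional derivatives *)

Lemma dpl_plus (f g : R -> R) (x a b : R) :
  derivable_pt_lim f x a -> derivable_pt_lim g x b ->
  derivable_pt_lim (fun y => f y + g y) x (a + b).
Proof. exact (derivable_pt_lim_plus f g x a b). Qed.

Lemma dpl_mult (f g : R -> R) (x a b : R) :
  derivable_pt_lim f x a -> derivable_pt_lim g x b ->
  derivable_pt_lim (fun y => f y * g y) x (a * g x + f x * b).
Proof. exact (derivable_pt_lim_mult f g x a b). Qed.

Lemma dpl_const (c x : R) : derivable_pt_lim (fun _ => c) x 0.
Proof. exact (derivable_pt_lim_const c x). Qed.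

Lemma dpl_comp (f g : R -> R) (x a b : R) :
  derivable_pt_lim f x a -> derivable_pt_lim g (f x) b ->
  derivable_pt_lim (fun y => g (f y)) x (b * a).
Proof. exact (derivable_pt_lim_comp f g x a b). Qed.

Lemma dpl_eq (f : R -> R) (x a b : R) :
  derivable_pt_lim f x a -> a = b -> derivable_pt_lim f x b.
Proof. now intros H <-. Qed.

Lemma dpl_inv (f : R -> R) (x a : R) :
  derivable_pt_lim f x a -> f x <> 0 ->
  derivable_pt_lim (fun y => / f y) x (- a / f x ^ 2).
Proof.
  intros H H0. apply is_derive_Reals, is_derive_inv; [now apply is_derive_Reals|assumption].
Qed.

Lemma dpl_ext_loc (f g : R -> R) (x l d : R) :
  0 < d -> (forall y, Rabs (y - x) < d -> f y = g y) ->
  derivable_pt_lim f x l -> derivable_pt_lim g x l.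
Proof.
  intros Hd H Hf. apply is_derive_Reals. apply is_derive_Reals in Hf.
  apply is_derive_ext_loc with f; [|assumption].
  exists (mkposreal d Hd). intros y Hy. apply H. exact Hy.
Qed.

Lemma dpl_shift (f : R -> R) (s l : R) :
  derivable_pt_lim (fun h => f (s + h)) 0 l <-> derivable_pt_lim f s l.
Proof.
  assert (E : forall h, 0 + h = h) by (intros; ring).
  split; intros H eps Heps; destruct (H eps Heps) as [d Hd]; exists d; intros h Hh0 Hh;
    specialize (Hd h Hh0 Hh); rewrite ?E, ?Rplus_0_r in *; assumption.
Qed.

Lemma dpl_fsum (n : nat) (f : nat -> R -> R) (x : R) (l : nat -> R) :
  (forall k, (k < n)%nat -> derivable_pt_lim (f k) x (l k)) ->
  derivable_pt_lim (fun y => fsum n (fun k => f k y)) x (fsum n l).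
Proof.
  induction n as [|n IH]; simpl; intros H; [apply dpl_const|].
  apply dpl_plus; [apply IH; intros|]; apply H; lia.
Qed.

Lemma dpl_continuous (f : R -> R) (x l : R) : derivable_pt_lim f x l -> continuity_pt f x.
Proof. intros H. apply derivable_continuous_pt. exists l. exact H. Qed.

Lemma dpl_max (f : R -> R) (x l d : R) :
  0 < d -> derivable_pt_lim f x l -> (forall y, Rabs (y - x) < d -> f y <= f x) -> l = 0.
Proof.
  intros Hd Hf Hmax.
  apply (deriv_maximum f (x - d) (x + d) x (exist _ l Hf)); try lra.
  intros y Hy1 Hy2. apply Hmax. apply Rabs_def1; lra.
Qed.

(** One-sided on purpose: in the comparison argument the maximum may sit at the final time. *)
Lemma dpl_max_left (f : R -> R) (a x l : R) :
  a < x -> derivable_pt_lim f x l -> (forall y, a <= y <= x -> f y <= f x) -> 0 <= l.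
Proof.
  intros Hax Hf Hmax. apply Rnot_lt_le. intros Hl.
  destruct (Hf (- l) ltac:(lra)) as [d Hd]. pose proof (cond_pos d).
  set (h := Rmin (d / 2) (x - a)).
  assert (0 < h <= d / 2 /\ h <= x - a).
  { unfold h. pose proof (Rmin_l (d / 2) (x - a)). pose proof (Rmin_r (d / 2) (x - a)).
    split; [split|]; auto. apply Rmin_pos; lra. }
  specialize (Hd (- h) ltac:(lra) ltac:(rewrite Rabs_Ropp, Rabs_right; lra)).
  specialize (Hmax (x + - h) ltac:(lra)). apply Rabs_def2 in Hd.
  assert (0 <= (f (x + - h) - f x) / - h); [|lra].
  replace ((f (x + - h) - f x) / - h) with ((f x - f (x + - h)) * / h) by (field; lra).
  apply Rmult_le_pos; [lra|]. apply Rlt_le, Rinv_0_lt_compat. lra.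
Qed.

(* If [f' = E q] with [E > 0], the sign of [q] decides the second order condition, and no
   derivative of [E] is needed. *)
Lemma dpl_max_second (f E q : R -> R) (d l : R) :
  0 < d -> (forall h, Rabs h < d -> derivable_pt_lim f h (E h * q h)) ->
  (forall h, Rabs h < d -> 0 < E h) -> q 0 = 0 -> derivable_pt_lim q 0 l ->
  (forall h, Rabs h < d -> f h <= f 0) -> l <= 0.
Proof.
  intros Hd Hf HE Hq0 Hq Hmax. apply Rnot_lt_le. intros Hl.
  destruct (Hq l Hl) as [d' Hd']. pose proof (cond_pos d').
  set (h := Rmin (d / 2) (d' / 2)).
  assert (0 < h /\ h <= d / 2 /\ h <= d' / 2) as (Hh0 & Hh1 & Hh2).
  { unfold h. split; [apply Rmin_pos; lra|]. split; [apply Rmin_l|apply Rmin_r]. }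
  destruct (MVT_cor2 f (fun h => E h * q h) 0 h Hh0) as (c & Hc & Hc0).
  { intros c Hc. apply Hf. rewrite Rabs_right; lra. }
  assert (Hca : Rabs c < d) by (rewrite Rabs_right; lra).
  specialize (Hd' c ltac:(lra) ltac:(rewrite Rabs_right; lra)).
  rewrite Hq0, Rplus_0_l, Rminus_0_r in Hd'. apply Rabs_def2 in Hd'.
  assert (Hqc : 0 < q c).
  { replace (q c) with (q c / c * c) by (field; lra). apply Rmult_lt_0_compat; lra. }
  specialize (HE c Hca). specialize (Hmax h ltac:(rewrite Rabs_right; lra)).
  assert (0 < E c * q c) by now apply Rmult_lt_0_compat.
  assert (0 < E c * q c * (h - 0)) by (apply Rmult_lt_0_compat; lra). lra.
Qed.

(** Arbitrary directions are allowed, and not only the coordinate ones of [pd], because the second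
    order test at a maximum needs the whole quadratic form of the Hessian. *)
Definition dird (f : pt -> R) (x p : pt) (l : R) : Prop :=
  derivable_pt_lim (fun h => f (fun j => x j + h * p j)) 0 l.

Lemma line_zero (x p : pt) : (fun j => x j + 0 * p j) = x.
Proof. apply functional_extensionality. intros; ring. Qed.

Lemma upd_kdelta (x : pt) (k : nat) (h : R) : upd x k h = fun j => x j + h * kdelta k j.
Proof.
  apply functional_extensionality. intros j. unfold upd, kdelta.
  destruct (Nat.eq_dec j k), (Nat.eq_dec k j); subst; try congruence; ring.
Qed.

Lemma pd_dird (f : pt -> R) (x : pt) (k : nat) (l : R) : pd f x k l <-> dird f x (kdelta k) l.
Proof.
  unfold pd, dird.
  replace (fun h => f (fun j => x j + h * kdelta k j)) with (fun h => f (upd x k h)); [tauto|].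
  apply functional_extensionality. intros h. now rewrite upd_kdelta.
Qed.

Lemma is_pt_kdelta (n k : nat) : (k < n)%nat -> is_pt n (kdelta k).
Proof. intros Hk j Hj. unfold kdelta. destruct (Nat.eq_dec k j); [lia|reflexivity]. Qed.

Lemma dird_eq (f : pt -> R) (x p : pt) (a b : R) : dird f x p a -> a = b -> dird f x p b.
Proof. now intros H <-. Qed.

Lemma dird_unique (f : pt -> R) (x p : pt) (a b : R) : dird f x p a -> dird f x p b -> a = b.
Proof. apply uniqueness_limite. Qed.

Lemma dird_const (c : R) (x p : pt) : dird (fun _ => c) x p 0.
Proof. exact (dpl_const c 0). Qed.

Lemma dird_plus (f g : pt -> R) (x p : pt) (a b : R) :
  dird f x p a -> dird g x p b -> dird (fun y => f y + g y) x p (a + b).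
Proof.
  apply (dpl_plus (fun h => f (fun j => x j + h * p j)) (fun h => g (fun j => x j + h * p j))).
Qed.

Lemma dird_mult (f g : pt -> R) (x p : pt) (a b : R) :
  dird f x p a -> dird g x p b -> dird (fun y => f y * g y) x p (a * g x + f x * b).
Proof.
  intros Hf Hg. eapply dpl_eq; [exact (dpl_mult _ _ 0 a b Hf Hg)|].
  cbv beta. now rewrite line_zero.
Qed.

Lemma dird_scal (c : R) (f : pt -> R) (x p : pt) (a : R) :
  dird f x p a -> dird (fun y => c * f y) x p (c * a).
Proof.
  intros Hf. eapply dird_eq; [exact (dird_mult _ _ _ _ _ _ (dird_const c x p) Hf)|]. simpl; ring.
Qed.

Lemma dird_fsum (n : nat) (f : nat -> pt -> R) (x p : pt) (l : nat -> R) :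
  (forall k, (k < n)%nat -> dird (f k) x p (l k)) ->
  dird (fun y => fsum n (fun k => f k y)) x p (fsum n l).
Proof. intros H. apply (dpl_fsum n (fun k h => f k (fun j => x j + h * p j))). exact H. Qed.

Lemma dird_coord (x p : pt) (k : nat) : dird (fun y => y k) x p (p k).
Proof.
  apply (dpl_eq (fun h => x k + h * p k) 0 (0 + (1 * p k + id 0 * 0))); [|unfold id; ring].
  apply dpl_plus; [apply dpl_const|].
  exact (dpl_mult _ _ 0 1 0 (derivable_pt_lim_id 0) (dpl_const (p k) 0)).
Qed.

Lemma line_in_open (n : nat) (U : pt -> Prop) (x p : pt) :
  Rn_open n U -> U x -> is_pt n p ->
  exists d, 0 < d /\ forall h, Rabs h < d -> U (fun j => x j + h * p j).
Proof.
  intros HU Hx Hp. destruct (HU x Hx) as (Hpt & e & He & Hball).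
  pose proof (vnorm_nonneg n p) as Hv.
  exists (e / (vnorm n p + 1)). split; [apply Rdiv_lt_0_compat; lra|].
  intros h Hh. apply Hball.
  - intros k Hk. rewrite Hpt, Hp by assumption. ring.
  - apply Rle_lt_trans with (Rabs h * vnorm n p).
    + apply vnorm_le; [apply Rmult_le_pos; [apply Rabs_pos|assumption]|].
      rewrite Rpow_mult_distr, pow2_abs, vnorm_sqr, <- fsum_scal.
      right. apply fsum_ext; intros; ring.
    + apply Rlt_div_r in Hh; [|lra]. pose proof (Rabs_pos h). nra.
Qed.

Lemma dird_ext_open (n : nat) (U : pt -> Prop) (f g : pt -> R) (x p : pt) (l : R) :
  Rn_open n U -> U x -> is_pt n p -> (forall y, U y -> f y = g y) ->
  dird f x p l -> dird g x p l.
Proof.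
  intros HU Hx Hp H Hf. destruct (line_in_open n U x p HU Hx Hp) as (d & Hd & Hin).
  apply (dpl_ext_loc (fun h => f (fun j => x j + h * p j)) _ 0 l d Hd); [|exact Hf].
  intros h Hh. rewrite Rminus_0_r in Hh. apply H, Hin, Hh.
Qed.

Lemma dird_at (f : pt -> R) (x p : pt) (h l : R) :
  dird f (fun j => x j + h * p j) p l ->
  derivable_pt_lim (fun s => f (fun j => x j + s * p j)) h l.
Proof.
  intros H. apply dpl_shift. unfold dird in H.
  replace (fun s => f (fun j => x j + (h + s) * p j))
    with (fun s => f (fun j => x j + h * p j + s * p j)); [exact H|].
  apply functional_extensionality. intros s. f_equal.
  apply functional_extensionality. intros; ring.
Qed.

Lemma dird_vnorm (n : nat) (x p : pt) :
  0 < vnorm n x -> dird (vnorm n) x p (fsum n (fun k => x k * p k) / vnorm n x).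
Proof.
  intros Hx. unfold dird, vnorm at 1. eapply dpl_eq.
  - apply (dpl_comp (fun h => fsum n (fun k => (x k + h * p k) ^ 2)) sqrt).
    + apply (dpl_fsum n (fun k h => (x k + h * p k) ^ 2) 0 (fun k => 2 * (x k * p k))).
      intros k _. apply is_derive_Reals. auto_derive; [trivial|ring].
    + apply derivable_pt_lim_sqrt.
      rewrite (fsum_ext n _ (fun k => x k ^ 2)) by (intros; ring).
      rewrite <- vnorm_sqr. now apply pow_lt.
  - cbv beta. rewrite (fsum_ext n (fun k => (x k + 0 * p k) ^ 2) (fun k => x k ^ 2)) by (intros; ring).
    fold (vnorm n x). rewrite fsum_scal. field. lra.
Qed.

Lemma dird_radial (n : nat) (a : R -> R) (x p : pt) (a' : R) :
  0 < vnorm n x -> derivable_pt_lim a (vnorm n x) a' ->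
  dird (fun y => a (vnorm n y)) x p (a' * (fsum n (fun k => x k * p k) / vnorm n x)).
Proof.
  intros Hx Ha. unfold dird.
  apply (dpl_comp (fun h => vnorm n (fun j => x j + h * p j)) a).
  - now apply dird_vnorm.
  - cbv beta. now rewrite line_zero.
Qed.

(** Continuity of the partial derivatives gives differentiability: x + h p is reached by moving one
    coordinate at a time, and the mean value theorem handles each move. *)
Lemma dird_C1 (n : nat) (U : pt -> Prop) (f : pt -> R) (f1 : nat -> pt -> R) (x p : pt) :
  Rn_open n U -> U x -> is_pt n p ->
  (forall k, (k < n)%nat -> cont_on_sp n U (f1 k)) ->
  (forall k y, (k < n)%nat -> U y -> pd f y k (f1 k y)) ->
  dird f x p (fsum n (fun k => f1 k x * p k)).
Proof.
  intros HU Hx Hp Hc Hpd.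
  destruct (HU x Hx) as (Hpt & e & He & Hball).
  pose proof (pos_INR n) as Hn. pose proof (vnorm_nonneg n p) as Hv.
  set (P := vnorm n p + 1) in *.
  (* Intermediate points of the path: the first j coordinates have been moved. *)
  set (Z := fun (j : nat) (h : R) (i : nat) => if (i <? j)%nat then x i + h * p i else x i).
  assert (HZ0 : forall h, Z O h = x).
  { intros h. apply functional_extensionality. reflexivity. }
  assert (HZn : forall h, Z n h = fun i => x i + h * p i).
  { intros h. apply functional_extensionality. intros i. unfold Z.
    destruct (i <? n)%nat eqn:E; [reflexivity|]. apply Nat.ltb_ge in E.
    rewrite (Hp i E). ring. }
  assert (HZS : forall j h, Z (S j) h = upd (Z j h) j (h * p j)).
  { intros j h. apply functional_extensionality. intros i. unfold Z, upd.
    destruct (Nat.eq_dec i j) as [->|Hij].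
    - rewrite (proj2 (Nat.ltb_lt j (S j))), (proj2 (Nat.ltb_ge j j)) by lia. reflexivity.
    - destruct (i <? j)%nat eqn:E.
      + apply Nat.ltb_lt in E. now rewrite (proj2 (Nat.ltb_lt i (S j))) by lia.
      + apply Nat.ltb_ge in E. now rewrite (proj2 (Nat.ltb_ge i (S j))) by lia. }
  assert (Hnear : forall j h s, (j < n)%nat -> Rabs s <= Rabs (h * p j) ->
     is_pt n (upd (Z j h) j s) /\ vdist n x (upd (Z j h) j s) <= INR n * (Rabs h * P)).
  { intros j h s Hj Hs. split.
    - intros i Hi. unfold upd, Z. destruct (Nat.eq_dec i j); [lia|].
      rewrite (Hpt i Hi), (Hp i Hi). destruct (i <? j)%nat; ring.
    - apply vnorm_le_sum; [|apply Rmult_le_pos; [apply Rabs_pos|unfold P; lra]].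
      assert (Hq : forall i, (i < n)%nat -> Rabs (h * p i) <= Rabs h * P).
      { intros i Hi. rewrite Rabs_mult. apply Rmult_le_compat_l; [apply Rabs_pos|].
        pose proof (coord_le_vnorm n p i Hi). unfold P. lra. }
      intros i Hi. unfold upd, Z. destruct (Nat.eq_dec i j) as [->|Hij].
      + rewrite (proj2 (Nat.ltb_ge j j)) by lia.
        replace (x j - (x j + s)) with (- s) by ring. rewrite Rabs_Ropp.
        eapply Rle_trans; [exact Hs|]. now apply Hq.
      + destruct (i <? j)%nat.
        * replace (x i - (x i + h * p i)) with (- (h * p i)) by ring.
          rewrite Rabs_Ropp. now apply Hq.
        * replace (x i - x i) with 0 by ring. rewrite Rabs_R0.
          apply Rmult_le_pos; [apply Rabs_pos|unfold P; lra]. }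
  (* The error after j moves is o(h), by induction on j; half of the tolerance goes to the earlier
     moves, half to the current one. *)
  assert (Hclaim : forall j, (j <= n)%nat -> forall eps, 0 < eps -> exists d, 0 < d /\
     forall h, Rabs h < d ->
       Rabs (f (Z j h) - f x - h * fsum j (fun k => f1 k x * p k)) <= eps * Rabs h).
  { induction j as [|j IH]; intros Hj eps Heps.
    - exists 1. split; [lra|]. intros h _. rewrite HZ0. simpl.
      replace (f x - f x - h * 0) with 0 by ring. rewrite Rabs_R0.
      apply Rmult_le_pos; [lra|apply Rabs_pos].
    - destruct (IH ltac:(lia) (eps / 2) ltac:(lra)) as (d1 & Hd1 & IHd).
      assert (Hpj : 0 < Rabs (p j) + 1) by (pose proof (Rabs_pos (p j)); lra).
      destruct (Hc j ltac:(lia) x Hx (eps / 2 / (Rabs (p j) + 1))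
                 ltac:(apply Rdiv_lt_0_compat; lra)) as (d2 & Hd2 & Hcont).
      set (m := Rmin e d2).
      assert (Hm : 0 < m) by (apply Rmin_pos; assumption).
      assert (HP : 0 < INR n * P + 1).
      { assert (0 <= INR n * P) by (apply Rmult_le_pos; unfold P; lra). lra. }
      (* This radius keeps all points of the move inside the ball contained in U and inside the
         continuity radius of [f1 j]. *)
      exists (Rmin d1 (m / (INR n * P + 1))).
      split; [apply Rmin_pos; [assumption|apply Rdiv_lt_0_compat; lra]|].
      intros h Hh.
      assert (Hh1 : Rabs h < d1) by (eapply Rlt_le_trans; [exact Hh|apply Rmin_l]).
      assert (Hh2 : INR n * (Rabs h * P) < m).
      { assert (Hh2 : Rabs h < m / (INR n * P + 1)) by (eapply Rlt_le_trans; [exact Hh|apply Rmin_r]).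
        apply Rlt_div_r in Hh2; [|lra]. pose proof (Rabs_pos h). nra. }
      assert (Hme : m <= e) by apply Rmin_l. assert (Hmd : m <= d2) by apply Rmin_r.
      specialize (IHd h Hh1).
      destruct (MVT_cor4 (fun s => f (upd (Z j h) j s)) (fun s => f1 j (upd (Z j h) j s))
                  0 (Rabs (h * p j))) with (b := h * p j) as (c & Hmv & Hcl).
      { intros s Hs. rewrite Rminus_0_r in Hs.
        destruct (Hnear j h s ltac:(lia) Hs) as [Hpt' Hdist].
        apply is_derive_Reals, dpl_shift.
        replace (fun u => f (upd (Z j h) j (s + u))) with (fun u => f (upd (upd (Z j h) j s) j u)).
        - apply Hpd; [lia|]. apply Hball; [assumption|lra].
        - apply functional_extensionality. intros u. f_equal.
          apply functional_extensionality. intros i. unfold upd.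
          destruct (Nat.eq_dec i j); ring. }
      { rewrite Rminus_0_r. lra. }
      rewrite <- HZS in Hmv.
      replace (upd (Z j h) j 0) with (Z j h) in Hmv
        by (apply functional_extensionality; intros i; unfold upd; destruct (Nat.eq_dec i j); ring).
      rewrite !Rminus_0_r in *.
      destruct (Hnear j h c ltac:(lia) Hcl) as [Hpt' Hdist].
      assert (HinU : U (upd (Z j h) j c)) by (apply Hball; [assumption|lra]).
      specialize (Hcont _ HinU ltac:(lra)).
      cbn [fsum].
      replace (f (Z (S j) h) - f x - h * (fsum j (fun k => f1 k x * p k) + f1 j x * p j))
        with ((f (Z j h) - f x - h * fsum j (fun k => f1 k x * p k))
              + (f1 j (upd (Z j h) j c) - f1 j x) * (h * p j)) by (rewrite Rmult_plus_distr_l; lra).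
      eapply Rle_trans; [apply Rabs_triang|].
      rewrite Rabs_mult, (Rabs_mult h).
      assert (Rabs (f1 j (upd (Z j h) j c) - f1 j x) * Rabs (p j) <= eps / 2).
      { apply Rle_trans with (eps / 2 / (Rabs (p j) + 1) * Rabs (p j)).
        - apply Rmult_le_compat_r; [apply Rabs_pos|lra].
        - replace (eps / 2) with (eps / 2 / (Rabs (p j) + 1) * (Rabs (p j) + 1)) at 2 by (field; lra).
          apply Rmult_le_compat_l; [|lra]. apply Rlt_le, Rdiv_lt_0_compat; lra. }
      pose proof (Rabs_pos h). nra. }
  intros eps Heps. destruct (Hclaim n (le_n n) (eps / 2) ltac:(lra)) as (d & Hd & Hest).
  exists (mkposreal d Hd). simpl. intros h Hh0 Hh. specialize (Hest h Hh).
  rewrite HZn in Hest. rewrite Rplus_0_l, line_zero.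
  assert (Hah : 0 < Rabs h) by now apply Rabs_pos_lt.
  replace ((f (fun j => x j + h * p j) - f x) / h - fsum n (fun k => f1 k x * p k))
    with ((f (fun j => x j + h * p j) - f x - h * fsum n (fun k => f1 k x * p k)) * / h)
    by (field; assumption).
  rewrite Rabs_mult, Rabs_inv.
  apply Rle_lt_trans with (eps / 2); [|lra].
  apply Rmult_le_reg_r with (Rabs h); [assumption|].
  rewrite Rmult_assoc, Rinv_l, Rmult_1_r by lra. exact Hest.
Qed.

(** * The elliptic inequality at a maximum *)

(** With e = x / |x| this is aT (I - e e^T) + aR e e^T: eigenvalue [aR] along x and [aT] on its
    orthogonal complement. *)
Definition radmat (n : nat) (aT aR : R -> R) (x : pt) (k l : nat) : R :=
  aT (vnorm n x) * kdelta k l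
  + (aR (vnorm n x) - aT (vnorm n x)) * / vnorm n x ^ 2 * (x k * x l).

Lemma radmat_radial (n : nat) (aT aR : R -> R) (x : pt) (k : nat) :
  (k < n)%nat -> 0 < vnorm n x ->
  fsum n (fun l => radmat n aT aR x k l * x l) = aR (vnorm n x) * x k.
Proof.
  intros Hk Hx. unfold radmat.
  rewrite (fsum_ext n _ (fun l => aT (vnorm n x) * (kdelta k l * x l)
     + (aR (vnorm n x) - aT (vnorm n x)) * / vnorm n x ^ 2 * x k * (x l * x l))) by (intros; ring).
  rewrite fsum_plus, !fsum_scal, (fsum_kdelta n k x Hk), vnorm_sqr_mul. field. lra.
Qed.

(* With [P = I - e e^T] one has [P = P P^T], so [tr (P H)] is the sum of the values of the
   quadratic form of [H] at the rows of [P]. *)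
Lemma trace_radmat_nonpos (n : nat) (aT aR : R -> R) (x : pt) (H : nat -> nat -> R) :
  is_pt n x -> 0 < vnorm n x -> 0 <= aT (vnorm n x) -> 0 <= aR (vnorm n x) ->
  (forall p, is_pt n p -> fsum n (fun k => fsum n (fun l => p k * p l * H l k)) <= 0) ->
  fsum n (fun k => fsum n (fun l => radmat n aT aR x k l * H l k)) <= 0.
Proof.
  intros Hpt Hr HT HR Hq. set (r := vnorm n x) in *.
  set (e := fun k => x k / r).
  assert (He : fsum n (fun m => e m * e m) = 1).
  { rewrite (fsum_ext n _ (fun m => / r ^ 2 * (x m * x m))) by (intros; unfold e; field; lra).
    rewrite fsum_scal, vnorm_sqr_mul. fold r. field. lra. }
  set (P := fun m k => kdelta m k - e m * e k).
  assert (HP : forall k l, (k < n)%nat -> (l < n)%nat -> fsum n (fun m => P m k * P m l) = P k l).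
  { intros k l Hk Hl. unfold P.
    rewrite (fsum_ext n _ (fun m => (kdelta k m * kdelta l m + (- e l) * (kdelta k m * e m))
       + ((- e k) * (kdelta l m * e m) + e k * e l * (e m * e m)))).
    - rewrite !fsum_plus, !fsum_scal, (fsum_kdelta n k (kdelta l)), !fsum_kdelta, He by assumption.
      rewrite (kdelta_sym l k). ring.
    - intros m _. rewrite (kdelta_sym m k), (kdelta_sym m l). ring. }
  assert (Hsum : fsum n (fun k => fsum n (fun l => P k l * H l k))
     = fsum n (fun m => fsum n (fun k => fsum n (fun l => P m k * P m l * H l k)))).
  { symmetry. rewrite fsum_exchange. apply fsum_ext. intros k Hk. rewrite fsum_exchange.
    apply fsum_ext. intros l Hl. rewrite <- HP by assumption.
    rewrite (Rmult_comm _ (H l k)), <- fsum_scal. apply fsum_ext. intros; ring. }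
  assert (HPn : fsum n (fun k => fsum n (fun l => P k l * H l k)) <= 0).
  { rewrite Hsum. rewrite <- (Rmult_0_l (fsum n (fun _ => 1))), <- fsum_scal.
    apply fsum_le. intros m Hm. rewrite Rmult_0_l. apply Hq. intros k Hk. unfold P, e.
    rewrite (is_pt_kdelta n m Hm k Hk), (Hpt k Hk). field. lra. }
  assert (Hen : fsum n (fun k => fsum n (fun l => e k * e l * H l k)) <= 0).
  { apply Hq. intros k Hk. unfold e. rewrite (Hpt k Hk). field. lra. }
  replace (fsum n (fun k => fsum n (fun l => radmat n aT aR x k l * H l k)))
    with (aT r * fsum n (fun k => fsum n (fun l => P k l * H l k))
          + aR r * fsum n (fun k => fsum n (fun l => e k * e l * H l k))); [nra|].
  rewrite <- !fsum_scal, <- fsum_plus. apply fsum_ext. intros k _.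
  rewrite <- !fsum_scal, <- fsum_plus. apply fsum_ext. intros l _.
  unfold radmat, P, e. fold r. field. lra.
Qed.

(* At an interior maximum of [s exp(-Lam) u - tau phi] the vector [h = s (grad u - u b) + tau kap x]
   vanishes, and [exp(-Lam) h] is the gradient of the function maximised.  The flux of [phi] is
   chosen so that its divergence needs no derivative of the matrix. *)
Lemma elliptic_max (n : nat) (U : pt -> Prop) (r0 RR lam : R)
  (aT aR beta Lam phi psi aT' aR' beta' psi' : R -> R)
  (u : pt -> R) (u1 : nat -> pt -> R) (u2 : nat -> nat -> pt -> R) (dJ : nat -> R)
  (s tau : R) (x : pt) :
  Rn_open n U -> (forall y, U y -> r0 < vnorm n y < RR) -> 0 < r0 ->
  (forall r, r0 < r < RR -> derivable_pt_lim aT r (aT' r) /\ 0 < aT r) ->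
  (forall r, r0 < r < RR -> derivable_pt_lim aR r (aR' r) /\ 0 < aR r) ->
  (forall r, r0 < r < RR -> derivable_pt_lim beta r (beta' r)) ->
  (forall r, r0 < r < RR -> derivable_pt_lim Lam r (r * beta r)) ->
  (forall r, r0 < r < RR -> derivable_pt_lim phi r (- psi r / aR r)) ->
  (forall r, r0 < r < RR -> derivable_pt_lim psi r (psi' r) /\
     lam <= psi' r + (INR n - 1) * psi r / r + r * beta r * psi r) ->
  (forall k, (k < n)%nat -> cont_on_sp n U (u1 k)) ->
  (forall k l, (k < n)%nat -> (l < n)%nat -> cont_on_sp n U (u2 k l)) ->
  (forall k y, (k < n)%nat -> U y -> pd u y k (u1 k y)) ->
  (forall k l y, (k < n)%nat -> (l < n)%nat -> U y -> pd (u1 k) y l (u2 k l y)) ->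
  (forall k, (k < n)%nat ->
     pd (fun y => fsum n (fun l => radmat n aT aR y k l * (u1 l y - u y * (beta (vnorm n y) * y l))))
       x k (dJ k)) ->
  0 <= tau -> U x ->
  (forall y, U y -> s * (exp (- Lam (vnorm n y)) * u y) - tau * phi (vnorm n y)
                    <= s * (exp (- Lam (vnorm n x)) * u x) - tau * phi (vnorm n x)) ->
  s * fsum n dJ <= - (tau * lam * exp (Lam (vnorm n x))).
Proof.
  intros HU Hsub Hr0 HaT HaR Hbeta HLam Hphi Hpsi Hc1 Hc2 Hu1 Hu2 HdJ Htau Hx Hmax.
  (* Chosen so that tau kap x = - tau exp(Lam) grad phi; hence exp(-Lam) h is the gradient of
     [v]. *)
  set (kap := fun r => exp (Lam r) * (psi r * (/ aR r * / r))).
  set (h := fun l y => s * (u1 l y + - 1 * (u y * (beta (vnorm n y) * y l)))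
                       + tau * (kap (vnorm n y) * y l)).
  set (v := fun y => s * (exp (- Lam (vnorm n y)) * u y) + - tau * phi (vnorm n y)).
  assert (Hpos : forall y, U y -> 0 < vnorm n y) by (intros y Hy; specialize (Hsub y Hy); lra).
  assert (Hdu : forall y p, U y -> is_pt n p -> dird u y p (fsum n (fun k => u1 k y * p k))).
  { intros y p Hy Hp. apply dird_C1 with U; auto. }
  assert (Hdv : forall y p, U y -> is_pt n p ->
     dird v y p (exp (- Lam (vnorm n y)) * fsum n (fun k => p k * h k y))).
  { intros y p Hy Hp. pose proof (Hpos y Hy) as Hr. pose proof (Hsub y Hy) as Hry.
    set (r := vnorm n y) in *. set (xp := fsum n (fun k => y k * p k)).
    assert (He : derivable_pt_lim (fun r => exp (- Lam r)) r (exp (- Lam r) * - (r * beta r))).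
    { apply (dpl_comp (fun r => - Lam r) exp); [|apply derivable_pt_lim_exp].
      exact (derivable_pt_lim_opp _ _ _ (HLam r Hry)). }
    eapply dird_eq.
    - apply dird_plus; apply dird_scal.
      + apply dird_mult; [|apply Hdu; assumption].
        apply (dird_radial n (fun r => exp (- Lam r)) y p _ Hr He).
      + apply (dird_radial n phi y p _ Hr (Hphi r Hry)).
    - fold r xp. pose proof (proj2 (HaR r Hry)) as HaRr.
      unfold h. fold r.
      rewrite (fsum_ext n (fun k => p k * _) (fun k => s * (u1 k y * p k)
         + (- s * u y * beta r + tau * kap r) * (y k * p k))) by (intros; ring).
      rewrite fsum_plus, !fsum_scal. fold xp. unfold kap. rewrite exp_Ropp.
      pose proof (exp_pos (Lam r)). field. repeat split; lra. }
  set (r := vnorm n x). pose proof (Hpos x Hx) as Hr. pose proof (Hsub x Hx) as Hrx. fold r in Hr, Hrx.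
  pose proof (proj2 (HaR r Hrx)) as HaRr.
  (* Existence suffices: the value enters only [H], whose contraction with A has a sign at the
     maximum. *)
  assert (Hkap : exists kap', derivable_pt_lim kap r kap').
  { eexists. unfold kap. apply (dpl_mult (fun r => exp (Lam r))).
    - apply (dpl_comp Lam exp); [now apply HLam|apply derivable_pt_lim_exp].
    - apply (dpl_mult psi); [now apply Hpsi|]. apply (dpl_mult (fun r => / aR r)).
      + apply dpl_inv; [now apply HaR|lra].
      + apply (dpl_inv (fun r => r)); [apply derivable_pt_lim_id|lra]. }
  destruct Hkap as [kap' Hkap'].
  (* Jacobian of h at x: [H l k] is the derivative of [h l] in the direction k. *)
  set (H := fun l k => s * (u2 l k x + - 1 * (u1 k x * (beta r * x l)
               + u x * (beta' r * (x k / r) * x l + beta r * kdelta l k)))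
             + tau * (kap' * (x k / r) * x l + kap r * kdelta l k)).
  assert (Hdh : forall l p, (l < n)%nat -> is_pt n p -> dird (h l) x p (fsum n (fun k => H l k * p k))).
  { intros l p Hl Hp.
    pose proof (dird_C1 n U (u1 l) (u2 l) x p HU Hx Hp (fun k => Hc2 l k Hl)
                  (fun k y Hk => Hu2 l k y Hl Hk)) as D1.
    pose proof (dird_mult _ _ x p _ _ (dird_radial n beta x p _ Hr (Hbeta r Hrx))
                  (dird_coord x p l)) as D2.
    pose proof (dird_mult _ _ x p _ _ (Hdu x p Hx Hp) D2) as D3.
    pose proof (dird_mult _ _ x p _ _ (dird_radial n kap x p _ Hr Hkap')
                  (dird_coord x p l)) as D4.
    eapply dird_eq.
    - exact (dird_plus _ _ x p _ _
               (dird_scal s _ x p _ (dird_plus _ _ x p _ _ D1 (dird_scal (- 1) _ x p _ D3)))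
               (dird_scal tau _ x p _ D4)).
    - fold r. unfold H.
      set (xp := fsum n (fun k => x k * p k)).
      rewrite (fsum_ext n (fun k => (_ + _) * p k) (fun k =>
        (s * (u2 l k x * p k) + (- s * beta r * x l) * (u1 k x * p k))
        + ((- s * u x * beta' r / r * x l + tau * kap' / r * x l) * (x k * p k)
           + (- s * u x * beta r + tau * kap r) * (kdelta l k * p k))))
        by (intros; field; lra).
      rewrite !fsum_plus, !fsum_scal, (fsum_kdelta n l p Hl). fold xp. change (vnorm n x) with r. field. lra. }
  assert (Hh0 : forall l, (l < n)%nat -> h l x = 0).
  { intros l Hl. pose proof (is_pt_kdelta n l Hl) as Hp.
    destruct (line_in_open n U x _ HU Hx Hp) as (d & Hd & Hin).
    pose proof (Hdv x (kdelta l) Hx Hp) as Hv.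
    rewrite (fsum_kdelta n l (fun k => h k x) Hl) in Hv.
    assert (E : exp (- Lam (vnorm n x)) * h l x = 0).
    { apply (dpl_max (fun t => v (fun j => x j + t * kdelta l j)) 0 _ d Hd Hv).
      intros t Ht. rewrite Rminus_0_r in Ht. rewrite line_zero.
      specialize (Hmax _ (Hin t Ht)). unfold v. lra. }
    apply Rmult_integral in E. destruct E as [E|E]; [|exact E].
    pose proof (exp_pos (- Lam (vnorm n x))). lra. }
  assert (Hquad : forall p, is_pt n p -> fsum n (fun k => fsum n (fun l => p k * p l * H l k)) <= 0).
  { intros p Hp. destruct (line_in_open n U x p HU Hx Hp) as (d & Hd & Hin).
    rewrite fsum_exchange.
    (* Along the line the derivative of [v] is E q with E = exp(-Lam) > 0 and q = p . h, and q
       vanishes at the maximum. *)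
    apply (dpl_max_second (fun t => v (fun j => x j + t * p j))
             (fun t => exp (- Lam (vnorm n (fun j => x j + t * p j))))
             (fun t => fsum n (fun k => p k * h k (fun j => x j + t * p j))) d).
    - exact Hd.
    - intros t Ht. apply dird_at. apply Hdv; auto.
    - intros; apply exp_pos.
    - rewrite line_zero. rewrite (fsum_ext n _ (fun k => 0 * 0)).
      + rewrite fsum_scal. ring.
      + intros k Hk. rewrite Hh0 by assumption. ring.
    - apply (dird_fsum n (fun k y => p k * h k y) x p
               (fun l => fsum n (fun k => p k * p l * H l k))).
      intros l Hl. eapply dird_eq; [apply dird_scal, Hdh; assumption|].
      rewrite <- fsum_scal. apply fsum_ext. intros; ring.
    - intros t Ht. rewrite line_zero. specialize (Hmax _ (Hin t Ht)). unfold v. lra. }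
  (* Since A x = aR x, the flux A (kap x) is [om] x: the eigenvalue has cancelled. *)
  set (om := fun r => exp (Lam r) * (psi r * / r)).
  set (om' := exp (Lam r) * (r * beta r * psi r / r + psi' r / r - psi r / r ^ 2)).
  assert (Hom : derivable_pt_lim om r om').
  { unfold om. eapply dpl_eq.
    - apply (dpl_mult (fun r => exp (Lam r))).
      + apply (dpl_comp Lam exp); [now apply HLam|apply derivable_pt_lim_exp].
      + apply (dpl_mult psi); [now apply Hpsi|].
        apply (dpl_inv (fun r => r)); [apply derivable_pt_lim_id|lra].
    - unfold om'. field. lra. }
  (* The scaled flux is A h - tau om x, and h vanishes at x, so the product rule leaves only A times
     the Jacobian of h; the derivatives of A need only exist. *)
  assert (HsJ : forall k, (k < n)%nat ->
     s * dJ k = fsum n (fun l => radmat n aT aR x k l * H l k) + - tau * (om' * (x k / r) * x k + om r)).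
  { intros k Hk. pose proof (is_pt_kdelta n k Hk) as Hp.
    assert (HD : exists D', derivable_pt_lim (fun r => (aR r - aT r) * / r ^ 2) r D').
    { eexists. apply (dpl_mult (fun r => aR r - aT r)).
      - apply (derivable_pt_lim_minus aR aT); [now apply HaR|now apply HaT].
      - apply (dpl_inv (fun r => r ^ 2)); [apply derivable_pt_lim_pow|].
        apply pow_nonzero. lra. }
    destruct HD as [D' HD].
    assert (HA : forall l, exists a, dird (fun y => radmat n aT aR y k l) x (kdelta k) a).
    { intros l. eexists.
      exact (dird_plus _ _ x _ _ _
        (dird_mult _ _ x _ _ _ (dird_radial n aT x (kdelta k) _ Hr (proj1 (HaT r Hrx)))
           (dird_const (kdelta k l) x (kdelta k)))
        (dird_mult _ _ x _ _ _ (dird_radial n _ x (kdelta k) _ Hr HD)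
           (dird_mult _ _ x _ _ _ (dird_coord x _ k) (dird_coord x _ l)))). }
    apply choice in HA. destruct HA as [A' HA].
    apply (dird_unique (fun y => s * fsum n (fun l => radmat n aT aR y k l
              * (u1 l y - u y * (beta (vnorm n y) * y l)))) x (kdelta k)).
    - apply dird_scal. apply pd_dird. now apply HdJ.
    - apply (dird_ext_open n U (fun y => fsum n (fun l => radmat n aT aR y k l * h l y)
               + - tau * (om (vnorm n y) * y k))); auto.
      + intros y Hy. pose proof (Hpos y Hy) as Hy0. pose proof (proj2 (HaR _ (Hsub y Hy))) as HaRy.
        unfold h.
        rewrite (fsum_ext n _ (fun l => s * (radmat n aT aR y k l * (u1 l y - u y * (beta (vnorm n y) * y l)))
           + tau * kap (vnorm n y) * (radmat n aT aR y k l * y l))) by (intros; ring).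
        rewrite fsum_plus, !fsum_scal, (radmat_radial n aT aR y k Hk Hy0).
        unfold kap, om. field. split; lra.
      + apply dird_plus; [|apply dird_scal].
        * eapply dird_eq.
          -- apply (dird_fsum n (fun l y => radmat n aT aR y k l * h l y) x (kdelta k)).
             intros l Hl. apply dird_mult; [apply HA|now apply Hdh].
          -- apply fsum_ext. intros l Hl. rewrite (Hh0 l Hl).
             rewrite (fsum_ext n (fun k0 => H l k0 * kdelta k k0) (fun j => kdelta k j * H l j))
               by (intros; ring).
             rewrite fsum_kdelta by assumption. ring.
        * eapply dird_eq.
          -- apply (dird_mult (fun y => om (vnorm n y)) (fun y => y k)); [|apply dird_coord].
             apply (dird_radial n om x _ _ Hr Hom).
          -- fold r. rewrite (fsum_ext n (fun j => x j * kdelta k j) (fun j => kdelta k j * x j))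
               by (intros; ring).
             rewrite fsum_kdelta by assumption. unfold kdelta.
             destruct (Nat.eq_dec k k); [ring|congruence]. }
  rewrite <- fsum_scal, (fsum_ext n _ _ HsJ), fsum_plus, fsum_scal.
  assert (Htr : fsum n (fun k => fsum n (fun l => radmat n aT aR x k l * H l k)) <= 0).
  { apply trace_radmat_nonpos; auto.
    - apply (HU x Hx).
    - fold r. pose proof (proj2 (HaT r Hrx)). lra.
    - fold r. lra. }
  (* Divergence of om x, which is r om' + n om; the dimension appears as a sum of ones. *)
  assert (Hdiv : fsum n (fun k => om' * (x k / r) * x k + om r)
     = exp (Lam r) * (psi' r + (INR n - 1) * psi r / r + r * beta r * psi r)).
  { rewrite (fsum_ext n _ (fun k => om' / r * (x k * x k) + om r * 1)) by (intros; field; lra).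
    rewrite fsum_plus, !fsum_scal, vnorm_sqr_mul. fold r.
    replace (fsum n (fun _ => 1)) with (INR n).
    - unfold om, om'. field. lra.
    - clear. induction n as [|n IH]; [reflexivity|]. cbn [fsum]. rewrite S_INR, IH. ring. }
  rewrite Hdiv. fold r. destruct (Hpsi r Hrx) as [_ Hlam]. pose proof (exp_pos (Lam r)) as HeL.
  assert (tau * (exp (Lam r) * lam)
     <= tau * (exp (Lam r) * (psi' r + (INR n - 1) * psi r / r + r * beta r * psi r))).
  { apply Rmult_le_compat_l; [assumption|]. apply Rmult_le_compat_l; lra. }
  lra.
Qed.

(** * Comparison for the parabolic problem *)

Lemma exp_monotone (x y : R) : x <= y -> exp x <= exp y.
Proof.
  intros [H| ->]; [|lra]. apply Rlt_le. now apply exp_increasing.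
Qed.

Lemma st_dist_space (d t : R) : 0 <= d -> d <= sqrt (d ^ 2 + t ^ 2).
Proof.
  intros Hd. rewrite <- (sqrt_pow2 d Hd) at 1. apply sqrt_le_1_alt.
  pose proof (pow2_ge_0 t). lra.
Qed.

Lemma st_dist_time (d t : R) : Rabs t <= sqrt (d ^ 2 + t ^ 2).
Proof.
  rewrite <- (sqrt_pow2 (Rabs t)), pow2_abs by apply Rabs_pos. apply sqrt_le_1_alt.
  pose proof (pow2_ge_0 d). lra.
Qed.

Lemma cont_st_subset (n : nat) (S S' : pt -> R -> Prop) (f : pt -> R -> R) :
  (forall x t, S x t -> S' x t) -> cont_on_st n S' f -> cont_on_st n S f.
Proof.
  intros HS Hf x t Hx e He. destruct (Hf x t (HS x t Hx) e He) as (d & Hd & H).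
  exists d. split; [assumption|]. intros y s Hy. apply H. now apply HS.
Qed.

Lemma cont_st_slice (n : nat) (S : pt -> R -> Prop) (f : pt -> R -> R) (t : R) :
  cont_on_st n S f -> cont_on_sp n (fun x => S x t) (fun x => f x t).
Proof.
  intros Hf x Hx e He. destruct (Hf x t Hx e He) as (d & Hd & H).
  exists d. split; [assumption|]. intros y Hy Hyd. apply H; [assumption|].
  replace (vdist n x y ^ 2 + (t - t) ^ 2) with (vdist n x y ^ 2) by ring.
  rewrite sqrt_pow2 by apply vnorm_nonneg. assumption.
Qed.

Lemma cont_st_comp (n : nat) (S : pt -> R -> Prop) (a : R -> R) (w : pt -> R -> R) :
  (forall r, continuity_pt a r) -> cont_on_st n S w -> cont_on_st n S (fun x t => a (w x t)).
Proof.
  intros Ha Hw x t Hx e He.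
  destruct (Ha (w x t) e He) as (d & Hd & H).
  destruct (Hw x t Hx d Hd) as (d' & Hd' & H'). exists d'. split; [assumption|].
  intros y s Hy Hys. specialize (H' y s Hy Hys).
  destruct (Req_dec (w y s) (w x t)) as [E|E].
  - rewrite E, Rminus_diag, Rabs_R0. assumption.
  - apply (H (w y s)). split; [|exact H']. split; [exact I|]. congruence.
Qed.

Lemma cont_st_vnorm (n : nat) (S : pt -> R -> Prop) : cont_on_st n S (fun x _ => vnorm n x).
Proof.
  intros x t _ e He. exists e. split; [assumption|]. intros y s _ Hys.
  eapply Rle_lt_trans; [apply vnorm_vdist|]. rewrite vdist_sym.
  eapply Rle_lt_trans; [apply st_dist_space, vnorm_nonneg|exact Hys].
Qed.

Lemma cont_st_time (n : nat) (S : pt -> R -> Prop) : cont_on_st n S (fun _ t => t).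
Proof.
  intros x t _ e He. exists e. split; [assumption|]. intros y s _ Hys.
  rewrite Rabs_minus_sym. eapply Rle_lt_trans; [apply (st_dist_time (vdist n x y))|exact Hys].
Qed.

Lemma cont_st_const (n : nat) (S : pt -> R -> Prop) (c : R) : cont_on_st n S (fun _ _ => c).
Proof.
  intros x t _ e He. exists 1. split; [lra|]. intros. rewrite Rminus_diag, Rabs_R0. assumption.
Qed.

Lemma cont_st_plus (n : nat) (S : pt -> R -> Prop) (f g : pt -> R -> R) :
  cont_on_st n S f -> cont_on_st n S g -> cont_on_st n S (fun x t => f x t + g x t).
Proof.
  intros Hf Hg x t Hx e He.
  destruct (Hf x t Hx (e / 2) ltac:(lra)) as (d1 & Hd1 & H1).
  destruct (Hg x t Hx (e / 2) ltac:(lra)) as (d2 & Hd2 & H2).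
  exists (Rmin d1 d2). split; [now apply Rmin_pos|]. intros y s Hy Hys.
  specialize (H1 y s Hy (Rlt_le_trans _ _ _ Hys (Rmin_l d1 d2))).
  specialize (H2 y s Hy (Rlt_le_trans _ _ _ Hys (Rmin_r d1 d2))).
  replace (f y s + g y s - (f x t + g x t)) with ((f y s - f x t) + (g y s - g x t)) by ring.
  eapply Rle_lt_trans; [apply Rabs_triang|]. lra.
Qed.

Lemma cont_st_mult (n : nat) (S : pt -> R -> Prop) (f g : pt -> R -> R) :
  cont_on_st n S f -> cont_on_st n S g -> cont_on_st n S (fun x t => f x t * g x t).
Proof.
  intros Hf Hg x t Hx e He.
  set (A := Rabs (f x t) + 1). set (B := Rabs (g x t) + 1).
  assert (HA : 0 < A) by (pose proof (Rabs_pos (f x t)); unfold A; lra).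
  assert (HB : 0 < B) by (pose proof (Rabs_pos (g x t)); unfold B; lra).
  assert (HeA : 0 < e / 2 / A) by (apply Rdiv_lt_0_compat; lra).
  assert (HeB : 0 < e / 2 / B) by (apply Rdiv_lt_0_compat; lra).
  destruct (Hf x t Hx (e / 2 / B) HeB) as (d1 & Hd1 & H1).
  destruct (Hg x t Hx (Rmin 1 (e / 2 / A)) ltac:(apply Rmin_pos; lra)) as (d2 & Hd2 & H2).
  exists (Rmin d1 d2). split; [now apply Rmin_pos|]. intros y s Hy Hys.
  specialize (H1 y s Hy (Rlt_le_trans _ _ _ Hys (Rmin_l d1 d2))).
  specialize (H2 y s Hy (Rlt_le_trans _ _ _ Hys (Rmin_r d1 d2))).
  assert (H3 : Rabs (g y s - g x t) < 1) by (eapply Rlt_le_trans; [exact H2|apply Rmin_l]).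
  assert (H4 : Rabs (g y s - g x t) < e / 2 / A) by (eapply Rlt_le_trans; [exact H2|apply Rmin_r]).
  assert (H5 : Rabs (g y s) <= B).
  { replace (g y s) with (g x t + (g y s - g x t)) by ring.
    eapply Rle_trans; [apply Rabs_triang|]. unfold B. lra. }
  replace (f y s * g y s - f x t * g x t)
    with ((f y s - f x t) * g y s + f x t * (g y s - g x t)) by ring.
  eapply Rle_lt_trans; [apply Rabs_triang|]. rewrite !Rabs_mult.
  assert (E1 : e / 2 / B * B = e / 2) by (field; lra).
  assert (E2 : e / 2 / A * A = e / 2) by (field; lra).
  pose proof (Rabs_pos (f y s - f x t)). pose proof (Rabs_pos (g y s - g x t)).
  pose proof (Rabs_pos (f x t)). pose proof (Rabs_pos (g y s)).
  assert (Rabs (f y s - f x t) * Rabs (g y s) <= e / 2) by nra.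
  assert (Rabs (f x t) * Rabs (g y s - g x t) < e / 2); [|lra].
  apply Rle_lt_trans with (Rabs (f x t) * (e / 2 / A)); [nra|]. unfold A in *. nra.
Qed.

Lemma closure_vnorm (n : nat) (U : pt -> Prop) (a b : R) (x : pt) :
  (forall y, U y -> a < vnorm n y < b) -> Rn_closure n U x -> a <= vnorm n x <= b.
Proof.
  intros HU [_ Hx].
  assert (H : forall e, 0 < e -> a - e <= vnorm n x <= b + e).
  { intros e He. destruct (Hx e He) as (y & Hy & Hxy). specialize (HU y Hy).
    pose proof (vnorm_vdist n x y) as Hv. apply Rabs_le_between in Hv. lra. }
  split; apply le_epsilon; intros e He; specialize (H e He); lra.
Qed.

Lemma closure_bound (n : nat) (U : pt -> Prop) (f : pt -> R) (H : R) (x : pt) :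
  cont_on_sp n (Rn_closure n U) f -> Rn_open n U -> (forall y, U y -> Rabs (f y) <= H) ->
  Rn_closure n U x -> Rabs (f x) <= H.
Proof.
  intros Hf HU Hb Hx. apply le_epsilon. intros e He.
  destruct (Hf x Hx e He) as (d & Hd & Hc). destruct Hx as [Hpt Hx].
  destruct (Hx d Hd) as (y & Hy & Hxy). specialize (Hb y Hy).
  assert (Hyc : Rn_closure n U y).
  { split; [apply (HU y Hy)|]. intros e' He'. exists y. split; [assumption|].
    rewrite vdist_refl. assumption. }
  specialize (Hc y Hyc Hxy).
  replace (f x) with (f y - (f y - f x)) by ring.
  eapply Rle_trans; [apply Rabs_triang|]. rewrite Rabs_Ropp. lra.
Qed.

Lemma open_sub_closure (n : nat) (U : pt -> Prop) (x : pt) : Rn_open n U -> U x -> Rn_closure n U x.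
Proof.
  intros HU Hx. split; [apply (HU x Hx)|]. intros e He. exists x. split; [assumption|].
  rewrite vdist_refl. assumption.
Qed.

Lemma dpl_exp_decay (A B lam T0 t : R) :
  derivable_pt_lim (fun t => A * exp (- lam * (t - T0)) + B) t
    (- (lam * A * exp (- lam * (t - T0)))).
Proof.
  assert (HE : derivable_pt_lim (fun t => exp (- lam * (t - T0))) t
                 (exp (- lam * (t - T0)) * - lam)).
  { apply (dpl_comp (fun t => - lam * (t - T0)) exp); [|apply derivable_pt_lim_exp].
    apply is_derive_Reals. auto_derive; [trivial|ring]. }
  eapply dpl_eq.
  - exact (dpl_plus _ _ t _ _ (dpl_mult _ _ t _ _ (dpl_const A t) HE) (dpl_const B t)).
  - simpl. ring.
Qed.

(** The function s exp(-Lam) sig - T(t) phi, with s = 1 or -1, cannot have a positive maximum on the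
    closure of U times [T0, t0]. In T, the coefficient H exp(LM) / phimin covers the initial values,
    E exp(LM) / phimin the lateral boundary and exp(LM) N / lam the source. Returning from exp(-Lam)
    sig to sig costs the outer factor exp(LM). *)
Lemma parabolic_comparison (n : nat) (U : pt -> Prop) (r0 RR lam LM phimin : R)
  (aT aR beta Lam phi psi aT' aR' beta' psi' : R -> R)
  (sig St W : pt -> R -> R) (S1 dI : nat -> pt -> R -> R) (S2 : nat -> nat -> pt -> R -> R)
  (T0 H E N : R) :
  Rn_open n U -> Rn_bounded n U -> (forall y, U y -> r0 < vnorm n y < RR) -> 0 < r0 ->
  (forall r, r0 < r < RR -> derivable_pt_lim aT r (aT' r) /\ 0 < aT r) ->
  (forall r, r0 < r < RR -> derivable_pt_lim aR r (aR' r) /\ 0 < aR r) ->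
  (forall r, r0 < r < RR -> derivable_pt_lim beta r (beta' r)) ->
  (forall r, r0 < r < RR -> derivable_pt_lim Lam r (r * beta r)) ->
  (forall r, r0 < r < RR -> derivable_pt_lim phi r (- psi r / aR r)) ->
  (forall r, r0 < r < RR -> derivable_pt_lim psi r (psi' r) /\
     lam <= psi' r + (INR n - 1) * psi r / r + r * beta r * psi r) ->
  (forall r, continuity_pt Lam r) -> (forall r, continuity_pt phi r) ->
  (forall r, r0 <= r <= RR -> Rabs (Lam r) <= LM) ->
  (forall r, r0 <= r <= RR -> phimin <= phi r <= 1) ->
  0 < phimin -> 0 < lam -> 0 <= T0 -> 0 <= E -> 0 <= N ->
  cont_on_st n (fun x t => Rn_closure n U x /\ 0 <= t) sig ->
  (forall k, (k < n)%nat -> cont_on_st n (fun x t => U x /\ 0 < t) (S1 k)) ->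
  (forall k l, (k < n)%nat -> (l < n)%nat -> cont_on_st n (fun x t => U x /\ 0 < t) (S2 k l)) ->
  (forall x t, U x -> 0 < t -> derivable_pt_lim (fun s => sig x s) t (St x t)) ->
  (forall k x t, (k < n)%nat -> U x -> 0 < t -> pd (fun y => sig y t) x k (S1 k x t)) ->
  (forall k l x t, (k < n)%nat -> (l < n)%nat -> U x -> 0 < t ->
     pd (fun y => S1 k y t) x l (S2 k l x t)) ->
  (forall k x t, (k < n)%nat -> U x -> 0 < t ->
     pd (fun y => fsum n (fun l => radmat n aT aR y k l
           * (S1 l y t - sig y t * (beta (vnorm n y) * y l)))) x k (dI k x t)) ->
  (forall x t, U x -> 0 < t -> St x t = fsum n (fun k => dI k x t) + W x t) ->
  (forall x t, U x -> T0 < t -> Rabs (W x t) <= N) ->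
  (forall x t, Rn_boundary n U x -> T0 < t -> Rabs (sig x t) <= E) ->
  (forall x, U x -> Rabs (sig x T0) <= H) ->
  forall x t, U x -> T0 <= t ->
    Rabs (sig x t) <= exp LM * (exp LM / phimin * H * exp (- lam * (t - T0))
                                + exp LM / phimin * E + exp LM * N / lam).
Proof.
  intros HU HUb Hsub Hr0 HaT HaR Hbeta HLam Hphi Hpsi HLamc Hphic HLM Hphib Hpm Hlam HT0 HE HN
    Hsc HS1c HS2c HSt HS1 HS2 HdI Heq HW Hbd Hini x0 t0 Hx0 Ht0.
  set (Q := exp LM). assert (HQ : 0 < Q) by apply exp_pos.
  assert (HH : 0 <= H) by (eapply Rle_trans; [apply Rabs_pos|apply (Hini x0 Hx0)]).
  assert (HQp : 0 < Q / phimin) by now apply Rdiv_lt_0_compat.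
  set (H' := Q / phimin * H). assert (HH' : 0 <= H') by (apply Rmult_le_pos; lra).
  assert (HeL : forall r, r0 <= r <= RR -> exp (- Lam r) <= Q /\ exp (Lam r) <= Q).
  { intros r Hr. specialize (HLM r Hr). apply Rabs_le_between in HLM.
    split; apply exp_monotone; lra. }
  assert (Hsphi : forall r y K, r0 <= r <= RR -> 0 <= K -> Rabs y <= K ->
     forall s, Rabs s = 1 -> s * (exp (- Lam r) * y) <= Q / phimin * K * phi r).
  { intros r y K Hr HK Hy s Hs.
    apply Rle_trans with (exp (- Lam r) * K).
    - apply Rle_trans with (Rabs (s * (exp (- Lam r) * y))); [apply Rle_abs|].
      rewrite !Rabs_mult, Hs, (Rabs_right (exp _)) by (apply Rle_ge, Rlt_le, exp_pos).
      rewrite Rmult_1_l. apply Rmult_le_compat_l; [apply Rlt_le, exp_pos|assumption].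
    - apply Rle_trans with (Q * K).
      + apply Rmult_le_compat_r; [assumption|now apply HeL].
      + replace (Q * K) with (Q / phimin * K * phimin) by (field; lra).
        apply Rmult_le_compat_l; [apply Rmult_le_pos; lra|now apply Hphib]. }
  (* The summand eps makes the inequality at an interior maximum strict; it is removed at the end.
     The two signs s give the two-sided bound. *)
  assert (Hone : forall s, Rabs s = 1 -> forall eps, 0 < eps ->
     s * (exp (- Lam (vnorm n x0)) * sig x0 t0)
     <= (H' * exp (- lam * (t0 - T0)) + (Q / phimin * E + Q * N / lam + eps)) * phi (vnorm n x0)).
  { intros s Hs eps Heps.
    set (M' := Q / phimin * E + Q * N / lam + eps).
    assert (HQE : 0 <= Q / phimin * E) by (apply Rmult_le_pos; lra).
    assert (HQN : 0 <= Q * N / lam).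
    { apply Rmult_le_pos; [apply Rmult_le_pos; lra|]. apply Rlt_le, Rinv_0_lt_compat. lra. }
    assert (HM' : 0 <= M') by (unfold M'; lra).
    set (T := fun t => H' * exp (- lam * (t - T0)) + M').
    set (v := fun x t => s * (exp (- Lam (vnorm n x)) * sig x t) + - 1 * (T t * phi (vnorm n x))).
    fold (T t0). cut (v x0 t0 <= 0); [unfold v; lra|]. apply Rnot_lt_le. intros Hpos.
    destruct (extreme_value n U T0 t0 v) as (x1 & t1 & Hx1 & Ht1 & Hmax).
    - assumption.
    - exists x0. now apply open_sub_closure.
    - assumption.
    - unfold v. apply cont_st_plus; (apply cont_st_mult; [apply cont_st_const|]); apply cont_st_mult.
      + apply (cont_st_comp n _ (fun r => exp (- Lam r)) (fun x _ => vnorm n x)); [|apply cont_st_vnorm].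
        intros r. apply (continuity_pt_comp (fun r => - Lam r) exp).
        * apply (continuity_pt_opp Lam). apply HLamc.
        * apply derivable_continuous_pt, derivable_pt_exp.
      + apply cont_st_subset with (2 := Hsc). intros x t [Hx Ht]. split; [assumption|lra].
      + apply (cont_st_comp n _ T (fun _ t => t)); [|apply cont_st_time].
        intros t. exact (dpl_continuous _ _ _ (dpl_exp_decay H' M' lam T0 t)).
      + apply (cont_st_comp n _ phi (fun x _ => vnorm n x)); [apply Hphic|apply cont_st_vnorm].
    - assert (Hv1 : 0 < v x1 t1).
      { eapply Rlt_le_trans; [exact Hpos|]. apply Hmax; [now apply open_sub_closure|lra]. }
      pose proof (closure_vnorm n U r0 RR x1 Hsub Hx1) as Hr1.
      pose proof (Hphib _ Hr1) as Hphi1. set (r := vnorm n x1) in *.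
      destruct (Req_dec t1 T0) as [E1|E1].
      { subst t1.
        (* The initial bound is given on U only; it reaches boundary points by continuity. *)
        assert (Hb : Rabs (sig x1 T0) <= H).
        { apply (closure_bound n U (fun x => sig x T0)); auto.
          intros x Hx e He. destruct (Hsc x T0 (conj Hx HT0) e He) as (d & Hd & Hc).
          exists d. split; [assumption|]. intros y Hy Hxy. apply Hc; [split; assumption|].
          replace (vdist n x y ^ 2 + (T0 - T0) ^ 2) with (vdist n x y ^ 2) by ring.
          rewrite sqrt_pow2 by apply vnorm_nonneg. assumption. }
        pose proof (Hsphi r _ H Hr1 HH Hb s Hs) as Hle. fold H' in Hle.
        unfold v, T in Hv1. fold r in Hv1.
        replace (- lam * (T0 - T0)) with 0 in Hv1 by ring. rewrite exp_0 in Hv1.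
        assert (0 <= M' * phi r) by (apply Rmult_le_pos; lra). lra. }
      assert (Ht1' : T0 < t1) by lra.
      pose proof (exp_pos (- lam * (t1 - T0))) as Hex.
      destruct (classic (U x1)) as [HUx|HUx].
      + assert (HT : 0 <= T t1).
        { unfold T. assert (0 <= H' * exp (- lam * (t1 - T0))) by (apply Rmult_le_pos; lra). lra. }
        assert (Hell : s * fsum n (fun k => dI k x1 t1) <= - (T t1 * lam * exp (Lam r))).
        { apply (elliptic_max n U r0 RR lam aT aR beta Lam phi psi aT' aR' beta' psi'
            (fun y => sig y t1) (fun k y => S1 k y t1) (fun k l y => S2 k l y t1)
            (fun k => dI k x1 t1) s (T t1) x1); auto.
          - intros k Hk x Hx e He.
            destruct (cont_st_slice n _ (S1 k) t1 (HS1c k Hk) x ltac:(split; [assumption|lra]) e He)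
              as (d & Hd & Hc).
            exists d. split; [assumption|]. intros y Hy. apply Hc. split; [assumption|lra].
          - intros k l Hk Hl x Hx e He.
            destruct (cont_st_slice n _ (S2 k l) t1 (HS2c k l Hk Hl) x ltac:(split; [assumption|lra]) e He)
              as (d & Hd & Hc).
            exists d. split; [assumption|]. intros y Hy. apply Hc. split; [assumption|lra].
          - intros k y Hk Hy. apply HS1; auto. lra.
          - intros k l y Hk Hl Hy. apply HS2; auto. lra.
          - intros k Hk. apply HdI; auto. lra.
          - intros y Hy. specialize (Hmax y t1 (open_sub_closure n U y HU Hy) Ht1).
            unfold v in Hmax. lra. }
        (* Only a one-sided condition, since t1 may equal t0. *)
        assert (Htime : 0 <= s * (exp (- Lam r) * St x1 t1)
                          + lam * H' * exp (- lam * (t1 - T0)) * phi r).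
        { apply (dpl_max_left (fun t => v x1 t) T0 t1); [assumption| |].
          - unfold v. fold r.
            pose proof (dpl_exp_decay H' M' lam T0 t1 : derivable_pt_lim T t1 _) as HTd.
            eapply dpl_eq.
            + exact (dpl_plus _ _ t1 _ _
                (dpl_mult _ _ t1 _ _ (dpl_const s t1)
                  (dpl_mult _ _ t1 _ _ (dpl_const (exp (- Lam r)) t1) (HSt x1 t1 HUx ltac:(lra))))
                (dpl_mult _ _ t1 _ _ (dpl_const (- 1) t1)
                  (dpl_mult _ _ t1 _ _ HTd (dpl_const (phi r) t1)))).
            + cbv beta. ring.
          - intros y Hy. apply Hmax; [assumption|lra]. }
        rewrite (Heq x1 t1 HUx ltac:(lra)) in Htime.
        specialize (HW x1 t1 HUx Ht1').
        assert (HsW : s * W x1 t1 <= N).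
        { eapply Rle_trans; [apply Rle_abs|]. rewrite Rabs_mult, Hs. lra. }
        set (ex := exp (- lam * (t1 - T0))) in *.
        pose proof (exp_pos (- Lam r)) as Hem.
        assert (Hee : exp (- Lam r) * exp (Lam r) = 1).
        { rewrite <- exp_plus, Rplus_opp_l. apply exp_0. }
        destruct (HeL r Hr1) as [HeQ _].
        assert (K1 : exp (- Lam r) * (s * fsum n (fun k => dI k x1 t1)) <= - (T t1 * lam)).
        { replace (- (T t1 * lam)) with (exp (- Lam r) * - (T t1 * lam * exp (Lam r))).
          - apply Rmult_le_compat_l; lra.
          - transitivity (- (T t1 * lam) * (exp (- Lam r) * exp (Lam r))); [ring|].
            rewrite Hee. ring. }
        assert (K2 : exp (- Lam r) * (s * W x1 t1) <= Q * N).
        { apply Rle_trans with (exp (- Lam r) * N); [apply Rmult_le_compat_l; lra|].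
          apply Rmult_le_compat_r; lra. }
        (* Here phi <= 1 enters: T phi decreases in time no faster than T. *)
        assert (K3 : lam * H' * ex * phi r <= lam * H' * ex).
        { rewrite <- (Rmult_1_r (lam * H' * ex)) at 2. apply Rmult_le_compat_l; [|lra].
          apply Rmult_le_pos; [apply Rmult_le_pos; lra|lra]. }
        (* The elliptic gain lam T contains both the loss lam H' ex in time and the source bound Q
           N; the surplus lam eps > 0 is the contradiction. *)
        assert (K4 : T t1 * lam = lam * H' * ex + lam * (Q / phimin * E) + Q * N + lam * eps).
        { unfold T, M'. fold ex. field. lra. }
        assert (0 <= lam * (Q / phimin * E)) by (apply Rmult_le_pos; lra).
        assert (0 < lam * eps) by (apply Rmult_lt_0_compat; lra). lra.
      + specialize (Hbd x1 t1 (conj Hx1 HUx) Ht1').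
        pose proof (Hsphi r _ E Hr1 HE Hbd s Hs) as Hle.
        unfold v in Hv1. fold r in Hv1.
        assert (Q / phimin * E * phi r <= T t1 * phi r); [|lra].
        apply Rmult_le_compat_r; [lra|]. unfold T, M'.
        assert (0 <= H' * exp (- lam * (t1 - T0))) by (apply Rmult_le_pos; lra). lra. }
  set (B := H' * exp (- lam * (t0 - T0)) + Q / phimin * E + Q * N / lam).
  assert (Hr : r0 <= vnorm n x0 <= RR) by (specialize (Hsub x0 Hx0); lra).
  pose proof (Hphib _ Hr) as Hp0. destruct (HeL _ Hr) as [_ HeQ].
  assert (HB : 0 <= B).
  { unfold B. pose proof (exp_pos (- lam * (t0 - T0))).
    assert (0 <= Q * N / lam).
    { apply Rmult_le_pos; [apply Rmult_le_pos; lra|]. apply Rlt_le, Rinv_0_lt_compat. lra. }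
    assert (0 <= Q / phimin * E) by (apply Rmult_le_pos; lra).
    assert (0 <= H' * exp (- lam * (t0 - T0))) by (apply Rmult_le_pos; lra). lra. }
  assert (Hfin : forall s, Rabs s = 1 -> s * sig x0 t0 <= Q * B).
  { intros s Hs.
    assert (Hle : s * (exp (- Lam (vnorm n x0)) * sig x0 t0) <= B).
    { apply le_epsilon. intros eps Heps. eapply Rle_trans; [apply (Hone s Hs eps Heps)|].
      replace (H' * exp (- lam * (t0 - T0)) + (Q / phimin * E + Q * N / lam + eps))
        with (B + eps) by (unfold B; ring).
      rewrite <- (Rmult_1_r (B + eps)) at 2. apply Rmult_le_compat_l; lra. }
    pose proof (exp_pos (Lam (vnorm n x0))) as Hp.
    assert (Hee : exp (Lam (vnorm n x0)) * exp (- Lam (vnorm n x0)) = 1).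
    { rewrite <- exp_plus, Rplus_opp_r. apply exp_0. }
    replace (s * sig x0 t0)
      with (exp (Lam (vnorm n x0)) * (s * (exp (- Lam (vnorm n x0)) * sig x0 t0))).
    - apply Rle_trans with (exp (Lam (vnorm n x0)) * B).
      + apply Rmult_le_compat_l; lra.
      + apply Rmult_le_compat_r; lra.
    - transitivity (exp (Lam (vnorm n x0)) * exp (- Lam (vnorm n x0)) * (s * sig x0 t0)); [ring|].
      rewrite Hee. ring. }
  apply Rabs_le. split.
  - specialize (Hfin (- 1) ltac:(rewrite Rabs_left; lra)). fold H' B. lra.
  - specialize (Hfin 1 Rabs_R1). fold H' B. lra.
Qed.

(** * Smoothness of the radial coefficients *)

(** The interval is open because the ODE for [Shat] is given inside (r0, R) only; the bound is
    uniform because U may reach both bounding spheres and the source estimate must hold on all of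
    U. *)
Definition C1b (a b : R) (f : R -> R) : Prop :=
  exists K, forall r, a < r < b ->
    Rabs (f r) <= K /\ exists l, derivable_pt_lim f r l /\ Rabs l <= K.

Lemma C1b_ext (a b : R) (f g : R -> R) :
  (forall r, a < r < b -> f r = g r) -> C1b a b f -> C1b a b g.
Proof.
  intros Hfg [K HK]. exists K. intros r Hr. destruct (HK r Hr) as (H1 & l & H2 & H3).
  rewrite <- Hfg by assumption. split; [assumption|]. exists l. split; [|assumption].
  apply (dpl_ext_loc f g r l (Rmin (r - a) (b - r))); [apply Rmin_pos; lra| |assumption].
  intros y Hy. apply Hfg.
  pose proof (Rmin_l (r - a) (b - r)). pose proof (Rmin_r (r - a) (b - r)).
  apply Rabs_def2 in Hy. lra.
Qed.

Lemma C1b_const (a b c : R) : C1b a b (fun _ => c).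
Proof.
  exists (Rabs c). intros r _. split; [lra|]. exists 0. split; [apply dpl_const|].
  rewrite Rabs_R0. apply Rabs_pos.
Qed.

Lemma C1b_plus (a b : R) (f g : R -> R) :
  C1b a b f -> C1b a b g -> C1b a b (fun r => f r + g r).
Proof.
  intros [K HK] [L HL]. exists (K + L). intros r Hr.
  destruct (HK r Hr) as (H1 & l & H2 & H3). destruct (HL r Hr) as (H4 & m & H5 & H6).
  split; [eapply Rle_trans; [apply Rabs_triang|lra]|].
  exists (l + m). split; [now apply dpl_plus|]. eapply Rle_trans; [apply Rabs_triang|lra].
Qed.

Lemma Rabs_mult_le (x y K L : R) : Rabs x <= K -> Rabs y <= L -> Rabs (x * y) <= K * L.
Proof.
  intros H1 H2. rewrite Rabs_mult. apply Rmult_le_compat; auto using Rabs_pos.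
Qed.

Lemma C1b_mult (a b : R) (f g : R -> R) :
  C1b a b f -> C1b a b g -> C1b a b (fun r => f r * g r).
Proof.
  intros [K HK] [L HL]. exists (K * L + K * L). intros r Hr.
  destruct (HK r Hr) as (H1 & l & H2 & H3). destruct (HL r Hr) as (H4 & m & H5 & H6).
  pose proof (Rabs_mult_le _ _ _ _ H1 H4). pose proof (Rabs_mult_le _ _ _ _ H3 H4).
  pose proof (Rabs_mult_le _ _ _ _ H1 H6). pose proof (Rabs_pos (f r * g r)).
  split; [lra|]. exists (l * g r + f r * m). split; [now apply dpl_mult|].
  eapply Rle_trans; [apply Rabs_triang|lra].
Qed.

Lemma C1b_inv (a b m : R) (f : R -> R) :
  0 < m -> (forall r, a < r < b -> m <= f r) -> C1b a b f -> C1b a b (fun r => / f r).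
Proof.
  intros Hm Hf [K HK]. exists (/ m + K * / m ^ 2). intros r Hr.
  destruct (HK r Hr) as (H1 & l & H2 & H3). specialize (Hf r Hr).
  assert (Hi : / f r <= / m) by (apply Rinv_le_contravar; lra).
  assert (Hi0 : 0 < / f r) by (apply Rinv_0_lt_compat; lra).
  assert (Hm0 : 0 < / m) by (apply Rinv_0_lt_compat; lra).
  assert (HK0 : 0 <= K) by (pose proof (Rabs_pos l); lra).
  assert (Hmm : 0 <= / m ^ 2) by (apply Rlt_le, Rinv_0_lt_compat, pow_lt; lra).
  assert (0 <= K * / m ^ 2) by (apply Rmult_le_pos; assumption).
  split; [rewrite Rabs_right; lra|].
  exists (- l / f r ^ 2). split; [apply dpl_inv; [assumption|lra]|].
  unfold Rdiv. rewrite Rabs_mult, Rabs_Ropp.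
  assert (Hp : 0 < f r ^ 2) by (apply pow_lt; lra).
  assert (Hq : 0 < / f r ^ 2) by now apply Rinv_0_lt_compat.
  rewrite (Rabs_right (/ f r ^ 2)) by lra.
  assert (/ f r ^ 2 <= / m ^ 2).
  { apply Rinv_le_contravar; [apply pow_lt; lra|]. apply pow_incr. lra. }
  pose proof (Rabs_pos l). assert (Rabs l * / f r ^ 2 <= K * / m ^ 2) by (apply Rmult_le_compat; lra).
  lra.
Qed.

Lemma C1b_fsum (a b : R) (n : nat) (f : nat -> R -> R) :
  (forall k, (k < n)%nat -> C1b a b (f k)) -> C1b a b (fun r => fsum n (fun k => f k r)).
Proof.
  induction n as [|n IH]; intros H; [exact (C1b_const a b 0)|].
  apply (C1b_plus a b (fun r => fsum n (fun k => f k r)) (f n)); [apply IH; intros|]; apply H; lia.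
Qed.

Lemma C1b_Rpower (a b e : R) : 0 < a -> C1b a b (fun r => Rpower r e).
Proof.
  intros Ha. set (m := Rabs (ln a) + Rabs (ln b)).
  set (B := fun e => exp (Rabs e * m)).
  assert (HB : forall e r, a < r < b -> Rabs (Rpower r e) <= B e).
  { intros e' r Hr. unfold Rpower, B. rewrite Rabs_right by (apply Rle_ge, Rlt_le, exp_pos).
    apply exp_monotone. eapply Rle_trans; [apply Rle_abs|]. rewrite Rabs_mult.
    apply Rmult_le_compat_l; [apply Rabs_pos|].
    assert (ln a < ln r) by (apply ln_increasing; lra).
    assert (ln r < ln b) by (apply ln_increasing; lra).
    unfold m. pose proof (Rle_abs (ln b)). pose proof (Rle_abs (- ln a)) as H2.
    rewrite Rabs_Ropp in H2. pose proof (Rabs_pos (ln a)). pose proof (Rabs_pos (ln b)).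
    apply Rabs_le. lra. }
  exists (B e + Rabs e * B (e - 1)). intros r Hr.
  assert (0 < B e) by apply exp_pos. assert (0 < B (e - 1)) by apply exp_pos.
  pose proof (Rabs_pos e).
  assert (0 <= Rabs e * B (e - 1)) by (apply Rmult_le_pos; lra).
  split; [specialize (HB e r Hr); lra|].
  exists (e * Rpower r (e - 1)). split; [apply derivable_pt_lim_power; lra|].
  pose proof (Rabs_mult_le e (Rpower r (e - 1)) _ _ (Rle_refl _) (HB (e - 1) r Hr)). lra.
Qed.

(** Counterpart of [C1b] in x, tailored to the product rule for the source div(A c). *)
Definition C1bx (n : nat) (U : pt -> Prop) (f : pt -> R) : Prop :=
  exists K, forall x, U x ->
    Rabs (f x) <= K /\
    forall i, (i < n)%nat -> exists l, dird f x (kdelta i) l /\ Rabs l <= K.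

Lemma C1bx_const (n : nat) (U : pt -> Prop) (c : R) : C1bx n U (fun _ => c).
Proof.
  exists (Rabs c). intros x _. split; [lra|]. intros i _. exists 0.
  split; [apply dird_const|]. rewrite Rabs_R0. apply Rabs_pos.
Qed.

Lemma C1bx_plus (n : nat) (U : pt -> Prop) (f g : pt -> R) :
  C1bx n U f -> C1bx n U g -> C1bx n U (fun x => f x + g x).
Proof.
  intros [K HK] [L HL]. exists (K + L). intros x Hx.
  destruct (HK x Hx) as [H1 H2]. destruct (HL x Hx) as [H3 H4].
  split; [eapply Rle_trans; [apply Rabs_triang|lra]|]. intros i Hi.
  destruct (H2 i Hi) as (l & H5 & H6). destruct (H4 i Hi) as (m & H7 & H8).
  exists (l + m). split; [now apply dird_plus|]. eapply Rle_trans; [apply Rabs_triang|lra].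
Qed.

Lemma C1bx_mult (n : nat) (U : pt -> Prop) (f g : pt -> R) :
  C1bx n U f -> C1bx n U g -> C1bx n U (fun x => f x * g x).
Proof.
  intros [K HK] [L HL]. exists (K * L + K * L). intros x Hx.
  destruct (HK x Hx) as [H1 H2]. destruct (HL x Hx) as [H3 H4].
  pose proof (Rabs_mult_le _ _ _ _ H1 H3). pose proof (Rabs_pos (f x * g x)).
  split; [lra|]. intros i Hi.
  destruct (H2 i Hi) as (l & H5 & H6). destruct (H4 i Hi) as (m & H7 & H8).
  pose proof (Rabs_mult_le _ _ _ _ H6 H3). pose proof (Rabs_mult_le _ _ _ _ H1 H8).
  exists (l * g x + f x * m). split; [now apply dird_mult|].
  eapply Rle_trans; [apply Rabs_triang|lra].
Qed.

Lemma C1bx_fsum (n m : nat) (U : pt -> Prop) (f : nat -> pt -> R) :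
  (forall k, (k < m)%nat -> C1bx n U (f k)) -> C1bx n U (fun x => fsum m (fun k => f k x)).
Proof.
  induction m as [|m IH]; intros H; [exact (C1bx_const n U 0)|].
  apply (C1bx_plus n U (fun x => fsum m (fun k => f k x)) (f m)); [apply IH; intros|]; apply H; lia.
Qed.

Lemma C1bx_radial (n : nat) (U : pt -> Prop) (a b : R) (f : R -> R) :
  0 < a -> (forall x, U x -> a < vnorm n x < b) -> C1b a b f ->
  C1bx n U (fun x => f (vnorm n x)).
Proof.
  intros Ha HU [K HK]. exists K. intros x Hx. pose proof (HU x Hx) as Hr.
  destruct (HK _ Hr) as (H1 & l & H2 & H3). split; [assumption|]. intros i Hi.
  eexists. split; [apply (dird_radial n f x (kdelta i) l); [lra|assumption]|].
  assert (Hq : Rabs (fsum n (fun k => x k * kdelta i k) / vnorm n x) <= 1).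
  { rewrite (fsum_ext n _ (fun k => kdelta i k * x k)) by (intros; ring).
    rewrite fsum_kdelta by assumption. pose proof (coord_le_vnorm n x i Hi).
    unfold Rdiv. rewrite Rabs_mult, (Rabs_right (/ _)) by (apply Rle_ge, Rlt_le, Rinv_0_lt_compat; lra).
    apply Rmult_le_reg_r with (vnorm n x); [lra|]. rewrite Rmult_assoc, Rinv_l; lra. }
  pose proof (Rabs_mult_le _ _ _ _ H3 Hq). lra.
Qed.

Lemma C1bx_coord (n : nat) (U : pt -> Prop) (M : R) (k : nat) :
  (k < n)%nat -> (forall x, U x -> vnorm n x <= M) -> C1bx n U (fun x => x k).
Proof.
  intros Hk HM. exists (M + 1). intros x Hx. specialize (HM x Hx).
  pose proof (coord_le_vnorm n x k Hk). pose proof (vnorm_nonneg n x).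
  split; [lra|]. intros i Hi. exists (kdelta i k). split; [apply dird_coord|].
  unfold kdelta. destruct (Nat.eq_dec i k); [rewrite Rabs_R1|rewrite Rabs_R0]; lra.
Qed.

Lemma C1bx_radmat (n : nat) (U : pt -> Prop) (a b : R) (aT aR : R -> R) (k l : nat) :
  0 < a -> (forall x, U x -> a < vnorm n x < b) -> C1b a b aT -> C1b a b aR ->
  (k < n)%nat -> (l < n)%nat -> C1bx n U (fun x => radmat n aT aR x k l).
Proof.
  intros Ha HU HT HR Hk Hl. unfold radmat.
  assert (HM : forall x, U x -> vnorm n x <= b) by (intros x Hx; specialize (HU x Hx); lra).
  apply C1bx_plus; apply C1bx_mult.
  - now apply C1bx_radial with a b.
  - apply C1bx_const.
  - apply (C1bx_radial n U a b (fun r => (aR r - aT r) * / r ^ 2)); [assumption|assumption|].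
    apply C1b_mult.
    + apply C1b_ext with (fun r => aR r + - 1 * aT r); [intros; ring|].
      apply C1b_plus; [assumption|]. apply C1b_mult; [apply C1b_const|assumption].
    + apply C1b_inv with (a ^ 2); [now apply pow_lt| |].
      * intros r Hr. apply pow_incr. lra.
      * apply C1b_ext with (fun r => Rpower r 2); [|now apply C1b_Rpower].
        intros r Hr. replace 2 with (INR 2) by (simpl; lra). apply Rpower_pow. lra.
  - apply C1bx_mult; apply C1bx_coord with b; assumption.
Qed.

(** Both factors have the spectral projections e e^T and I - e e^T, with e = x / |x|, so the
    eigenvalues multiply. *)
Lemma radmat_mul (n : nat) (a b c d : R -> R) (x : pt) (k l : nat) :
  (k < n)%nat -> (l < n)%nat -> 0 < vnorm n x ->
  fsum n (fun m => radmat n a b x k m * radmat n c d x m l)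
  = radmat n (fun r => a r * c r) (fun r => b r * d r) x k l.
Proof.
  intros Hk Hl Hr. unfold radmat. set (r := vnorm n x) in *.
  set (p := (b r - a r) * / r ^ 2). set (q := (d r - c r) * / r ^ 2).
  rewrite (fsum_ext n _ (fun m => (a r * c r * (kdelta k m * kdelta l m)
     + a r * q * x l * (kdelta k m * x m)) + (p * x k * c r * (kdelta l m * x m)
     + p * q * x k * x l * (x m * x m)))).
  - rewrite !fsum_plus, !fsum_scal, vnorm_sqr_mul, (fsum_kdelta n k (kdelta l)), !fsum_kdelta
      by assumption.
    fold r. rewrite (kdelta_sym l k). unfold p, q. field. lra.
  - intros m _. rewrite (kdelta_sym m l). ring.
Qed.

Lemma radmat_one (n : nat) (a b : R -> R) (x : pt) (k l : nat) :
  a (vnorm n x) = 1 -> b (vnorm n x) = 1 -> radmat n a b x k l = kdelta k l.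
Proof. intros Ha Hb. unfold radmat. rewrite Ha, Hb. ring. Qed.

(** Uniqueness of the inverse: with A' the radial matrix of the reciprocal eigenvalues, A = A (B A')
    = (A B) A' = A'. *)
Lemma left_inverse_radmat (n : nat) (A B : nat -> nat -> R) (bT bR : R -> R) (x : pt) (k l : nat) :
  (forall k l, (k < n)%nat -> (l < n)%nat -> fsum n (fun m => A k m * B m l) = kdelta k l) ->
  (forall k l, (k < n)%nat -> (l < n)%nat -> B k l = radmat n bT bR x k l) ->
  0 < vnorm n x -> bT (vnorm n x) <> 0 -> bR (vnorm n x) <> 0 ->
  (k < n)%nat -> (l < n)%nat ->
  A k l = radmat n (fun r => / bT r) (fun r => / bR r) x k l.
Proof.
  intros HA HB Hr HT HR Hk Hl. set (A' := radmat n (fun r => / bT r) (fun r => / bR r) x).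
  assert (HBA : forall m, (m < n)%nat -> fsum n (fun j => B m j * A' j l) = kdelta m l).
  { intros m Hm. rewrite (fsum_ext n _ (fun j => radmat n bT bR x m j * A' j l)).
    - unfold A'. rewrite radmat_mul by assumption.
      apply radmat_one; now apply Rinv_r.
    - intros j Hj. rewrite HB by assumption. reflexivity. }
  rewrite <- (fsum_kdelta n l (A k)) by assumption.
  rewrite (fsum_ext n _ (fun m => fsum n (fun j => A k m * B m j * A' j l))).
  - rewrite fsum_exchange.
    rewrite (fsum_ext n _ (fun j => kdelta k j * A' j l)); [now apply fsum_kdelta with (f := fun j => A' j l)|].
    intros j Hj. rewrite <- HA by assumption. rewrite (Rmult_comm (fsum _ _)), <- fsum_scal.
    apply fsum_ext; intros; ring.
  - intros m Hm. rewrite kdelta_sym, <- HBA by assumption. rewrite Rmult_comm, <- fsum_scal.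
    apply fsum_ext; intros; ring.
Qed.

(** * Real powers, the functions g_i and the speed of the steady flow *)

Lemma rpow_pos (s a : R) : 0 < s -> rpow s a = Rpower s a.
Proof. intros Hs. unfold rpow. destruct (Rle_dec s 0); [lra|reflexivity]. Qed.

Lemma rpow_0 (a : R) : rpow 0 a = 0.
Proof. unfold rpow. destruct (Rle_dec 0 0); [reflexivity|lra]. Qed.

Lemma rpow_nonneg (s a : R) : 0 <= rpow s a.
Proof. unfold rpow. destruct (Rle_dec s 0); [lra|]. apply Rlt_le, exp_pos. Qed.

Lemma rpow_le (s t a : R) : 0 < a -> s <= t -> rpow s a <= rpow t a.
Proof.
  intros Ha Hst. unfold rpow at 1. destruct (Rle_dec s 0); [apply rpow_nonneg|].
  rewrite rpow_pos by lra. apply Rle_Rpower_l; lra.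
Qed.

Lemma gvalid_alpha (d : gdata) (j : nat) : gvalid d -> (1 <= j <= gN d)%nat -> 0 < galpha d j.
Proof.
  intros (_ & _ & H1 & Hinc) [Hj1 HjN]. induction j as [|j IH]; [lia|].
  destruct (Nat.eq_dec j 0) as [->|Hj]; [apply H1; lia|].
  specialize (IH ltac:(lia) ltac:(lia)). specialize (Hinc j ltac:(lia) ltac:(lia)). lra.
Qed.

Lemma gfun_0 (d : gdata) : gfun d 0 = ga0 d.
Proof.
  unfold gfun. rewrite (fsum_ext _ _ (fun _ => 0 * 0)).
  - rewrite fsum_scal. ring.
  - intros. rewrite rpow_0. ring.
Qed.

Lemma gfun_le (d : gdata) (s t : R) : gvalid d -> s <= t -> gfun d s <= gfun d t.
Proof.
  intros Hd Hst. apply Rplus_le_compat_l, fsum_le. intros k Hk.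
  apply Rmult_le_compat_l; [apply Hd; lia|]. apply rpow_le; [|assumption].
  apply gvalid_alpha; [assumption|lia].
Qed.

Lemma gfun_pos (d : gdata) (s : R) : gvalid d -> 0 <= s -> ga0 d <= gfun d s /\ 0 < gfun d s.
Proof.
  intros Hd Hs. pose proof (gfun_le d 0 s Hd Hs) as H. rewrite gfun_0 in H.
  destruct Hd as [H0 _]. lra.
Qed.

(* [s g'(s)], with the value 0 at [s = 0] also when [g'] is singular there. *)
Definition sgder (d : gdata) (s : R) : R :=
  fsum (gN d) (fun j => ga d (S j) * galpha d (S j) * rpow s (galpha d (S j))).

Lemma sgder_coef (d : gdata) (k : nat) :
  gvalid d -> (k < gN d)%nat -> 0 <= ga d (S k) * galpha d (S k).
Proof.
  intros Hd Hk. apply Rmult_le_pos; [apply Hd; lia|].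
  apply Rlt_le, gvalid_alpha; [assumption|lia].
Qed.

Lemma sgder_le (d : gdata) (s t : R) : gvalid d -> s <= t -> sgder d s <= sgder d t.
Proof.
  intros Hd Hst. apply fsum_le. intros k Hk.
  apply Rmult_le_compat_l; [now apply sgder_coef|]. apply rpow_le; [|assumption].
  apply gvalid_alpha; [assumption|lia].
Qed.

Lemma sgder_nonneg (d : gdata) (s : R) : gvalid d -> 0 <= sgder d s.
Proof.
  intros Hd. apply fsum_nonneg. intros k Hk.
  apply Rmult_le_pos; [now apply sgder_coef|apply rpow_nonneg].
Qed.

Lemma sgder_0 (d : gdata) : sgder d 0 = 0.
Proof.
  unfold sgder. rewrite (fsum_ext _ _ (fun _ => 0 * 0)).
  - rewrite fsum_scal. ring.
  - intros. rewrite rpow_0. ring.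
Qed.

Lemma gder_sgder (d : gdata) (s : R) : 0 < s -> gder d s * s = sgder d s.
Proof.
  intros Hs. unfold gder, sgder. rewrite Rmult_comm, <- fsum_scal. apply fsum_ext. intros k _.
  rewrite !rpow_pos by assumption.
  replace (Rpower s (galpha d (S k))) with (Rpower s (galpha d (S k) - 1) * s); [ring|].
  rewrite <- (Rpower_1 s Hs) at 2. rewrite <- Rpower_plus. f_equal. ring.
Qed.

(** The convention that d_3 drops the terms with c = 0 agrees with [sgder] vanishing at 0, so one
    formula covers both cases. *)
Lemma d3term_sgder (n : nat) (d : gdata) (c r0 : R) :
  0 < r0 -> d3term n d c r0 = sgder d (Rabs c * rr0 n r0).
Proof.
  intros Hr. unfold d3term, rr0. rewrite rpow_pos by assumption. destruct (Req_EM_T c 0) as [->|Hc].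
  - rewrite Rabs_R0, Rmult_0_l, sgder_0. reflexivity.
  - apply gder_sgder. apply Rmult_lt_0_compat; [now apply Rabs_pos_lt|apply exp_pos].
Qed.

(** Euclidean norm of [ustar n c x] on the sphere |x| = r. *)
Definition speed (n : nat) (c r : R) : R := Rabs c * rpow r (1 - INR n).

Lemma speed_nonneg (n : nat) (c r : R) : 0 <= speed n c r.
Proof. apply Rmult_le_pos; [apply Rabs_pos|apply rpow_nonneg]. Qed.

Lemma speed_le (n : nat) (c r0 r : R) : (1 <= n)%nat -> 0 < r0 <= r -> speed n c r <= speed n c r0.
Proof.
  intros Hn Hr. apply Rmult_le_compat_l; [apply Rabs_pos|]. rewrite !rpow_pos by lra.
  assert (1 <= INR n) by (change 1 with (INR 1); now apply le_INR).
  assert (ln r0 <= ln r) by (apply ln_le; lra).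
  unfold Rpower. apply exp_monotone. nra.
Qed.

Lemma rpow_pow (n : nat) (r : R) : 0 < r -> rpow r (1 - INR n) = / r ^ n * r.
Proof.
  intros Hr. rewrite rpow_pos by assumption. unfold Rminus.
  rewrite Rpower_plus, Rpower_1, Rpower_Ropp, Rpower_pow by assumption. ring.
Qed.

Lemma vnorm_ustar (n : nat) (c : R) (x : pt) :
  0 < vnorm n x -> vnorm n (ustar n c x) = speed n c (vnorm n x).
Proof.
  intros Hr. unfold speed. rewrite rpow_pow by assumption. set (r := vnorm n x) in *.
  assert (Hp : 0 < / r ^ n) by (apply Rinv_0_lt_compat, pow_lt; assumption).
  assert (Hs : 0 <= Rabs c * (/ r ^ n * r)).
  { apply Rmult_le_pos; [apply Rabs_pos|]. apply Rmult_le_pos; lra. }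
  rewrite <- (sqrt_pow2 _ Hs). unfold vnorm, ustar. f_equal.
  rewrite (fsum_ext n _ (fun k => (c * / r ^ n) ^ 2 * x k ^ 2)) by (intros; fold r; ring).
  rewrite fsum_scal, <- vnorm_sqr. fold r. rewrite !Rpow_mult_distr, pow2_abs. ring.
Qed.

(** The steady velocity u is parallel to x, so g'(|u|) u u^T / |u| acts along x only, with
    eigenvalue |u| g'(|u|), which is [sgder]; its value 0 at u = 0 matches the separate case of the
    Jacobian. *)
Lemma Gjac_radmat (n : nat) (d : gdata) (c : R) (x : pt) (k l : nat) :
  0 < vnorm n x ->
  Gjac n d (ustar n c x) k l
  = radmat n (fun r => gfun d (speed n c r))
      (fun r => gfun d (speed n c r) + sgder d (speed n c r)) x k l.
Proof.
  intros Hr. unfold Gjac, radmat. rewrite (vnorm_ustar n c x Hr).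
  destruct (Req_EM_T (speed n c (vnorm n x)) 0) as [E|E].
  - rewrite E, sgder_0. ring.
  - pose proof (speed_nonneg n c (vnorm n x)) as Hs.
    rewrite <- gder_sgder by lra.
    assert (Hsq : speed n c (vnorm n x) ^ 2 = (c * / vnorm n x ^ n * vnorm n x) ^ 2).
    { unfold speed. rewrite rpow_pow by assumption. rewrite !Rpow_mult_distr, pow2_abs. ring. }
    unfold ustar. set (u := speed n c (vnorm n x)) in *. set (r := vnorm n x) in *.
    transitivity (gfun d u * kdelta k l
      + gder d u * ((c * / r ^ n * r) ^ 2 / u) * (/ r ^ 2 * (x k * x l))).
    + assert (0 < r ^ n) by now apply pow_lt. field. repeat split; lra.
    + rewrite <- Hsq. field. split; lra.
Qed.

Lemma Gv_ustar (n : nat) (d : gdata) (c : R) (x : pt) (k : nat) :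
  0 < vnorm n x ->
  Gv n d (ustar n c x) k
  = gfun d (speed n c (vnorm n x)) * (c * / vnorm n x ^ n) * x k.
Proof. intros Hr. unfold Gv. rewrite vnorm_ustar by assumption. unfold ustar. ring. Qed.

(** A power s^a may fail to be differentiable at s = 0, but the speed enters as a function of r: the
    factor |c| splits off and a power of r > 0 remains, also for c = 0. *)
Lemma rpow_speed (n : nat) (c r a : R) :
  0 < r -> rpow (speed n c r) a = rpow (Rabs c) a * Rpower r ((1 - INR n) * a).
Proof.
  intros Hr. unfold speed. rewrite (rpow_pos r) by assumption.
  destruct (Req_dec c 0) as [->|Hc].
  - rewrite Rabs_R0, Rmult_0_l, !rpow_0. ring.
  - pose proof (Rabs_pos_lt c Hc). assert (0 < Rpower r (1 - INR n)) by apply exp_pos.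
    rewrite !rpow_pos by (try apply Rmult_lt_0_compat; assumption).
    rewrite <- Rpower_mult_distr by assumption. now rewrite Rpower_mult.
Qed.

Lemma C1b_power_sum (n N : nat) (c a b : R) (w alpha : nat -> R) :
  0 < a -> C1b a b (fun r => fsum N (fun j => w j * rpow (speed n c r) (alpha j))).
Proof.
  intros Ha. apply C1b_fsum. intros k _. apply C1b_mult; [apply C1b_const|].
  apply C1b_ext with (fun r => rpow (Rabs c) (alpha k) * Rpower r ((1 - INR n) * alpha k)).
  - intros r Hr. symmetry. apply rpow_speed. lra.
  - apply C1b_mult; [apply C1b_const|now apply C1b_Rpower].
Qed.

Lemma C1b_gfun (n : nat) (d : gdata) (c a b : R) :
  0 < a -> C1b a b (fun r => gfun d (speed n c r)).
Proof.
  intros Ha. unfold gfun. apply C1b_plus; [apply C1b_const|].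
  apply (C1b_power_sum n (gN d) c a b (fun j => ga d (S j)) (fun j => galpha d (S j)) Ha).
Qed.

Lemma C1b_sgder (n : nat) (d : gdata) (c a b : R) :
  0 < a -> C1b a b (fun r => sgder d (speed n c r)).
Proof.
  intros Ha. apply (C1b_power_sum n (gN d) c a b (fun j => ga d (S j) * galpha d (S j))
                      (fun j => galpha d (S j)) Ha).
Qed.

Lemma C1b_continuous (f : R -> R) (r : R) :
  0 < r -> (forall a b, 0 < a -> C1b a b f) -> continuity_pt f r.
Proof.
  intros Hr Hf. destruct (Hf (r / 2) (2 * r) ltac:(lra)) as [K HK].
  destruct (HK r ltac:(lra)) as (_ & l & Hl & _). now apply dpl_continuous with l.
Qed.

(** * The barrier and its rate *)

Lemma dpl_increasing (f f' : R -> R) (a b : R) :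
  a <= b -> (forall c, a <= c <= b -> derivable_pt_lim f c (f' c)) ->
  (forall c, a < c < b -> 0 <= f' c) -> f a <= f b.
Proof.
  intros [Hab| ->] Hf Hpos; [|lra].
  destruct (MVT_cor2 f f' a b Hab Hf) as (c & Hc & Hc1). specialize (Hpos c Hc1). nra.
Qed.

(** The function - ln(1 - y) - y - y^2 / 2 has derivative y^2 / (1 - y) >= 0. The quadratic term is
    what remains in [rate_bound] after the linear one is spent on exp(C2 R d). *)
Lemma ln_one_minus (d : R) : 0 <= d < 1 -> ln (1 - d) <= - d - d ^ 2 / 2.
Proof.
  intros Hd.
  assert (H : 0 - ln (1 - 0) - 0 ^ 2 / 2 - 0 <= 0 - ln (1 - d) - d ^ 2 / 2 - d).
  { apply (dpl_increasing (fun y => 0 - ln (1 - y) - y ^ 2 / 2 - y) (fun y => y ^ 2 / (1 - y))).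
    - lra.
    - intros c Hc. apply is_derive_Reals. auto_derive; [lra|field; lra].
    - intros c Hc. apply Rmult_le_pos; [apply pow2_ge_0|].
      apply Rlt_le, Rinv_0_lt_compat. lra. }
  rewrite (Rminus_0_r 1), ln_1 in H. lra.
Qed.

(** From exp(y / 2) = exp(y / 4)^2 and exp(y / 4) > 1 + y / 4 for y > 0, with (1 + y / 4)^2 = y + (1
    - y / 4)^2. *)
Lemma mul_exp_neg_half_lt_1 (y : R) : 0 <= y -> y * exp (- (y / 2)) < 1.
Proof.
  intros Hy.
  assert (H : y < exp (y / 2)).
  { destruct (Req_dec y 0) as [->|Hy0]; [apply exp_pos|].
    replace (y / 2) with (y / 4 + y / 4) by field. rewrite exp_plus.
    pose proof (exp_ineq1 (y / 4) ltac:(lra)). pose proof (pow2_ge_0 (1 - y / 4)). nra. }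
  rewrite exp_Ropp. pose proof (exp_pos (y / 2)).
  apply Rmult_lt_reg_r with (exp (y / 2)); [assumption|].
  rewrite Rmult_assoc, Rinv_l; lra.
Qed.

Lemma ln_1p_le (x : R) : 0 < x -> 0 < ln (1 + x) <= x.
Proof.
  intros Hx. split.
  - rewrite <- ln_1. apply ln_increasing; lra.
  - rewrite <- (ln_exp x) at 2. apply ln_le; [lra|]. apply Rlt_le, exp_ineq1. lra.
Qed.

(* With [d = 1 - r0/R] and [Y = nn + C2 R] the product is at most
   [Y d^2 (1 - d)^Y exp (C2 R d)], and [ln (1 - d) <= - d - d^2/2] reduces this to
   [Y d^2 exp (- Y d^2 / 2)]. *)
Lemma rate_bound (C0 C1 C2 nn r0 RR : R) :
  0 < C1 -> C1 <= C0 -> 0 <= C2 -> 1 <= nn -> 0 < r0 < RR ->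
  let kappa0 := C0 / (2 * C1) in
  let sR := kappa0 * (nn + C2 * RR) in
  let q := kappa0 * C0 / (2 * sR) in
  let eta0 := Rpower (r0 / RR) (2 * sR) in
  let lam := ln (1 + eta0) / (q * RR ^ 2) in
  0 < lam /\ C0 * lam * exp (C2 * (RR - r0)) * (RR - r0) ^ 2 / 2 < 1.
Proof.
  intros HC1 HC0 HC2 Hnn Hr kappa0 sR q eta0 lam.
  set (d := 1 - r0 / RR). set (Y := nn + C2 * RR).
  assert (HCR : 0 <= C2 * RR) by (apply Rmult_le_pos; lra).
  assert (HY : 0 < Y) by (unfold Y; lra).
  assert (Hrho : 0 < r0 / RR < 1).
  { split; [apply Rdiv_lt_0_compat; lra|]. apply Rlt_div_l; lra. }
  (* The factor kappa0 cancels in q, which equals C0 / (2 Y). *)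
  assert (Hlam : lam = 2 * Y / (C0 * RR ^ 2) * ln (1 + eta0)).
  { unfold lam, q, sR, kappa0. fold Y. field. repeat split; lra. }
  assert (Heta : 0 < eta0) by apply exp_pos.
  destruct (ln_1p_le eta0 Heta) as [Hln0 Hln].
  assert (HcR : 0 < C0 * RR ^ 2) by (apply Rmult_lt_0_compat; [lra|apply pow_lt; lra]).
  split.
  { rewrite Hlam. apply Rmult_lt_0_compat; [apply Rdiv_lt_0_compat; lra|assumption]. }
  assert (E : C0 * lam * exp (C2 * (RR - r0)) * (RR - r0) ^ 2 / 2
              = Y * d ^ 2 * exp (C2 * RR * d) * ln (1 + eta0)).
  { rewrite Hlam. unfold d. replace (C2 * RR * (1 - r0 / RR)) with (C2 * (RR - r0)) by (field; lra).
    field. split; lra. }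
  rewrite E.
  assert (Hd : 0 < d < 1) by (unfold d; lra).
  assert (Hd2 : 0 < d ^ 2) by (apply pow_lt; lra).
  assert (Heta2 : eta0 <= exp (- (Y * d) - Y * d ^ 2 / 2)).
  { unfold eta0, Rpower. apply exp_monotone.
    pose proof (ln_one_minus d ltac:(lra)) as Hlnd.
    replace (1 - d) with (r0 / RR) in Hlnd by (unfold d; ring).
    (* C1 <= C0 enters here: 2 s_R = (C0 / C1) Y, and a larger exponent only decreases eta0 because
       r0 / R < 1. *)
    assert (HsR : Y <= 2 * sR).
    { unfold sR, kappa0. fold Y. replace (2 * (C0 / (2 * C1) * Y)) with (C0 / C1 * Y) by (field; lra).
      rewrite <- (Rmult_1_l Y) at 1. apply Rmult_le_compat_r; [lra|].
      apply Rle_div_r; lra. }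
    apply Rle_trans with (Y * ln (r0 / RR)); [nra|]. nra. }
  assert (HYd : 0 < Y * d ^ 2) by (apply Rmult_lt_0_compat; lra).
  apply Rle_lt_trans with (Y * d ^ 2 * exp (- (Y * d ^ 2 / 2))).
  - rewrite Rmult_assoc. apply Rmult_le_compat_l; [lra|].
    apply Rle_trans with (exp (C2 * RR * d) * exp (- (Y * d) - Y * d ^ 2 / 2)).
    + apply Rmult_le_compat_l; [apply Rlt_le, exp_pos|lra].
    + rewrite <- exp_plus. apply exp_monotone.
      assert (0 <= nn * d) by (apply Rmult_le_pos; lra).
      replace (C2 * RR * d + (- (Y * d) - Y * d ^ 2 / 2))
        with (- (nn * d) - Y * d ^ 2 / 2) by (unfold Y; ring). lra.
  - apply mul_exp_neg_half_lt_1. lra.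
Qed.

(** Composition with [clamp] extends a function continuous on [a, b] continuously to the whole line,
    so that it can be integrated without endpoint conditions. *)
Definition clamp (a b r : R) : R := Rmax a (Rmin r b).

Lemma clamp_in (a b r : R) : a <= b -> a <= clamp a b r <= b.
Proof.
  intros Hab. unfold clamp. split; [apply Rmax_l|]. apply Rmax_lub; [assumption|apply Rmin_r].
Qed.

Lemma clamp_id (a b r : R) : a <= r <= b -> clamp a b r = r.
Proof. intros H. unfold clamp. rewrite Rmin_left, Rmax_right; lra. Qed.

Lemma clamp_lipschitz (a b r s : R) : a <= b -> Rabs (clamp a b r - clamp a b s) <= Rabs (r - s).
Proof.
  intros Hab. unfold clamp, Rmin, Rmax.
  destruct (Rle_dec r b), (Rle_dec s b);
  repeat match goal with |- context [Rle_dec ?x ?y] => destruct (Rle_dec x y) end;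
  unfold Rabs; repeat destruct Rcase_abs; lra.
Qed.

Lemma clamp_continuous (a b r : R) : a <= b -> continuity_pt (clamp a b) r.
Proof.
  intros Hab e He. exists e. split; [assumption|]. intros s [_ Hs].
  simpl. unfold Rdist. eapply Rle_lt_trans; [now apply clamp_lipschitz|exact Hs].
Qed.

Lemma clamp_comp_continuous (f : R -> R) (a b : R) :
  a <= b -> (forall r, a <= r <= b -> continuity_pt f r) ->
  forall r, continuity_pt (fun s => f (clamp a b s)) r.
Proof.
  intros Hab Hf r. apply (continuity_pt_comp (clamp a b) f); [now apply clamp_continuous|].
  apply Hf. now apply clamp_in.
Qed.

Lemma cont_closed_clamp (f : R -> R) (a b : R) :
  a <= b -> cont_closed f a b -> forall r, continuity_pt (fun s => f (clamp a b s)) r.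
Proof.
  intros Hab Hf r e He.
  destruct (Hf (clamp a b r) (clamp_in a b r Hab) e He) as (d & Hd & H).
  exists d. split; [assumption|]. intros s [_ Hs]. apply H. split; [now apply clamp_in|].
  simpl in *. unfold Rdist in *. eapply Rle_lt_trans; [now apply clamp_lipschitz|exact Hs].
Qed.

Lemma antiderivative (f : R -> R) (a v : R) :
  (forall r, continuity_pt f r) ->
  exists P, P a = v /\ forall r, derivable_pt_lim P r (f r).
Proof.
  intros Hf. exists (fun r => v + RInt f a r). split.
  - rewrite RInt_point. apply Rplus_0_r.
  - intros r. eapply dpl_eq.
    + apply (dpl_plus (fun _ => v) (fun r => RInt f a r)); [apply dpl_const|].
      apply is_derive_Reals. apply (is_derive_RInt f (fun r => RInt f a r) a r).
      * apply filter_forall. intros s. apply (RInt_correct (V := R_CompleteNormedModule)), ex_RInt_continuous.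
        intros z _. apply continuity_pt_filterlim, Hf.
      * apply continuity_pt_filterlim, Hf.
    + ring.
Qed.

Lemma radial_barrier (r0 RR C0 C2 lam nn : R) (BR rb : R -> R) :
  0 < r0 < RR -> 0 < lam -> 0 <= C2 -> 1 <= nn ->
  (forall r, continuity_pt (fun s => BR (clamp r0 RR s)) r) ->
  (forall r, continuity_pt (fun s => rb (clamp r0 RR s)) r) ->
  (forall r, r0 <= r <= RR -> 0 <= BR r <= C0) ->
  (forall r, r0 <= r <= RR -> Rabs (rb r) <= C2) ->
  C0 * lam * exp (C2 * (RR - r0)) * (RR - r0) ^ 2 / 2 < 1 ->
  exists (Lam phi psi psi' : R -> R) (phimin : R),
    0 < phimin /\
    (forall r, continuity_pt Lam r) /\ (forall r, continuity_pt phi r) /\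
    (forall r, r0 < r < RR -> derivable_pt_lim Lam r (rb r)) /\
    (forall r, r0 < r < RR -> derivable_pt_lim phi r (- (psi r * BR r))) /\
    (forall r, r0 < r < RR -> derivable_pt_lim psi r (psi' r) /\
       lam <= psi' r + (nn - 1) * psi r / r + rb r * psi r) /\
    (forall r, r0 <= r <= RR -> Rabs (Lam r) <= C2 * (RR - r0)) /\
    (forall r, r0 <= r <= RR -> phimin <= phi r <= 1).
Proof.
  intros Hr Hlam HC2 Hnn HBRc Hrbc HBR Hrb Hth.
  (* The growth factor contributes C2 psi to psi', which absorbs rb psi because |rb| <= C2; the
     remaining part of psi' is at least lam, and (nn - 1) psi / r >= 0. *)
  set (psi := fun r => lam * (r - r0) * exp (C2 * (r - r0))).
  set (psi' := fun r => lam * exp (C2 * (r - r0)) + C2 * psi r).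
  set (K := C0 * lam * exp (C2 * (RR - r0))) in *.
  assert (Hpsi : forall r, derivable_pt_lim psi r (psi' r)).
  { intros r. apply is_derive_Reals. unfold psi', psi. auto_derive; [trivial|]. unfold Rminus. ring. }
  destruct (antiderivative (fun s => rb (clamp r0 RR s)) r0 0 Hrbc) as (Lam & HLam0 & HLam).
  destruct (antiderivative (fun s => - (psi s * BR (clamp r0 RR s))) r0 1) as (phi & Hphi0 & Hphi).
  { intros r. apply (continuity_pt_opp (fun s => psi s * BR (clamp r0 RR s))).
    apply (continuity_pt_mult psi); [|apply HBRc]. now apply dpl_continuous with (psi' r). }
  assert (Hpsib : forall r, r0 <= r <= RR -> 0 <= psi r <= lam * (r - r0) * exp (C2 * (RR - r0))).
  { intros r Hrr. assert (0 <= lam * (r - r0)) by (apply Rmult_le_pos; lra).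
    pose proof (exp_pos (C2 * (r - r0))). split.
    - apply Rmult_le_pos; lra.
    - apply Rmult_le_compat_l; [assumption|]. apply exp_monotone.
      apply Rmult_le_compat_l; lra. }
  assert (HC0 : 0 <= C0) by (destruct (HBR r0 ltac:(lra)); lra).
  assert (HK : 0 <= K).
  { unfold K. pose proof (exp_pos (C2 * (RR - r0))).
    apply Rmult_le_pos; [apply Rmult_le_pos; lra|lra]. }
  (* The lower bound comes from psi BR <= K (r - r0), integrated from r0 to RR with phi r0 = 1. *)
  exists Lam, phi, psi, psi', (1 - K * (RR - r0) ^ 2 / 2).
  repeat match goal with |- _ /\ _ => split end.
  - lra.
  - intros r. exact (dpl_continuous _ _ _ (HLam r)).
  - intros r. exact (dpl_continuous _ _ _ (Hphi r)).
  - intros r Hrr. eapply dpl_eq; [apply HLam|]. cbv beta. rewrite clamp_id by lra. reflexivity.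
  - intros r Hrr. eapply dpl_eq; [apply Hphi|]. cbv beta. rewrite clamp_id by lra. reflexivity.
  - intros r Hrr. split; [apply Hpsi|]. destruct (Hpsib r ltac:(lra)) as [Hp _].
    assert (H1 : 1 <= exp (C2 * (r - r0))).
    { rewrite <- exp_0 at 1. apply exp_monotone. apply Rmult_le_pos; lra. }
    assert (H2 : 0 <= (nn - 1) * psi r / r).
    { apply Rmult_le_pos; [apply Rmult_le_pos; lra|]. apply Rlt_le, Rinv_0_lt_compat. lra. }
    assert (H3 : 0 <= (C2 + rb r) * psi r).
    { apply Rmult_le_pos; [|assumption]. specialize (Hrb r ltac:(lra)).
      apply Rabs_le_between in Hrb. lra. }
    unfold psi'. nra.
  - intros r Hrr. destruct (Rle_lt_or_eq_dec r0 r ltac:(lra)) as [Hlt|<-].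
    + destruct (MVT_cor2 Lam (fun s => rb (clamp r0 RR s)) r0 r Hlt (fun c _ => HLam c))
        as (c & Hc & _).
      rewrite HLam0, Rminus_0_r in Hc. rewrite Hc, Rabs_mult, (Rabs_right (r - r0)) by lra.
      apply Rmult_le_compat; [apply Rabs_pos|lra| |lra]. apply Hrb, clamp_in. lra.
    + rewrite HLam0, Rabs_R0. apply Rmult_le_pos; lra.
  - intros r Hrr. split.
    + assert (H : phi r0 + K * (r0 - r0) ^ 2 / 2 <= phi r + K * (r - r0) ^ 2 / 2).
      { apply (dpl_increasing (fun s => phi s + K * (s - r0) ^ 2 / 2)
                 (fun s => - (psi s * BR (clamp r0 RR s)) + K * (s - r0))); [lra| |].
        - intros c Hc. apply (dpl_plus phi (fun s => K * (s - r0) ^ 2 / 2)); [apply Hphi|].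
          apply is_derive_Reals. auto_derive; [trivial|field].
        - intros c Hc. rewrite clamp_id by lra. destruct (Hpsib c ltac:(lra)) as [Hp1 Hp2].
          destruct (HBR c ltac:(lra)) as [HB1 HB2].
          assert (psi c * BR c <= lam * (c - r0) * exp (C2 * (RR - r0)) * C0)
            by (apply Rmult_le_compat; assumption).
          unfold K. lra. }
      assert (K * (r - r0) ^ 2 <= K * (RR - r0) ^ 2).
      { apply Rmult_le_compat_l; [assumption|]. apply pow_incr. lra. }
      rewrite Hphi0 in H. replace (r0 - r0) with 0 in H by ring. lra.
    + assert (H : - phi r0 <= - phi r).
      { apply (dpl_increasing (fun s => - phi s) (fun s => psi s * BR (clamp r0 RR s))); [lra| |].
        - intros c Hc. eapply dpl_eq; [exact (derivable_pt_lim_opp _ _ _ (Hphi c))|].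
          cbv beta. ring.
        - intros c Hc. rewrite clamp_id by lra. destruct (Hpsib c ltac:(lra)) as [Hp1 _].
          destruct (HBR c ltac:(lra)) as [HB1 _]. now apply Rmult_le_pos. }
      rewrite Hphi0 in H. lra.
Qed.

(** The derivative is known on the open interval only. Strict monotonicity there and the limit 0 at
    the left end give f (s / 2) >= 0, and the step from s / 2 to s makes it strict. *)
Lemma pos_of_derive_pos (f f' : R -> R) :
  limit1_in f (fun y => 0 <= y <= 1) 0 0 ->
  (forall s, 0 < s < 1 -> derivable_pt_lim f s (f' s) /\ 0 < f' s) ->
  forall s, 0 < s < 1 -> 0 < f s.
Proof.
  intros Hlim Hf s Hs.
  assert (Hinc : forall a b, 0 < a -> a < b -> b < 1 -> f a < f b).
  { intros a b Ha Hab Hb.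
    destruct (MVT_cor2 f f' a b Hab (fun c Hc => proj1 (Hf c ltac:(lra)))) as (c & Hc & Hc1).
    destruct (Hf c ltac:(lra)) as [_ Hp]. nra. }
  apply Rle_lt_trans with (f (s / 2)); [|apply Hinc; lra].
  apply Rnot_lt_le. intros Hneg.
  destruct (Hlim (- f (s / 2)) ltac:(lra)) as (d & Hd & H).
  set (y := Rmin (d / 2) (s / 4)).
  assert (Hy : 0 < y /\ y <= d / 2 /\ y <= s / 4).
  { unfold y. split; [apply Rmin_pos; lra|]. split; [apply Rmin_l|apply Rmin_r]. }
  specialize (Hinc y (s / 2) ltac:(lra) ltac:(lra) ltac:(lra)).
  assert (Hfy : Rabs (f y - 0) < - f (s / 2)).
  { apply H. split; [lra|]. simpl. unfold Rdist. rewrite Rminus_0_r, Rabs_right; lra. }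
  apply Rabs_def2 in Hfy. lra.
Qed.

(** The given derivative and the first one in the C^7 chain agree near s by uniqueness, so F''
    exists; this makes the drift differentiable. *)
Lemma Ck_second_derivative (F dF : R -> R) (a b s : R) :
  Ck_open 7 F a b -> (forall s, a < s < b -> derivable_pt_lim F s (dF s)) -> a < s < b ->
  exists l, derivable_pt_lim dF s l.
Proof.
  intros (Df & H0 & HD & _) HdF Hs. exists (Df 2%nat s).
  apply (dpl_ext_loc (Df 1%nat) dF s _ (Rmin (s - a) (b - s))).
  - apply Rmin_pos; lra.
  - intros y Hy. pose proof (Rmin_l (s - a) (b - s)). pose proof (Rmin_r (s - a) (b - s)).
    apply Rabs_def2 in Hy. apply (uniqueness_limite F y).
    + rewrite <- H0. apply HD; [lia|lra].
    + apply HdF. lra.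
  - apply HD; [lia|assumption].
Qed.

(** * The coefficients of the linearized system *)

Lemma C1b_derivative (a b : R) (f : R -> R) :
  C1b a b f -> exists f', forall r, a < r < b -> derivable_pt_lim f r (f' r).
Proof.
  intros [K HK]. apply (choice (fun r l => a < r < b -> derivable_pt_lim f r l)).
  intros r. destruct (classic (a < r < b)) as [Hr|Hr].
  - destruct (HK r Hr) as (_ & l & Hl & _). exists l. auto.
  - exists 0. tauto.
Qed.

Lemma C1b_comp (a b K : R) (F dF S : R -> R) :
  (forall r, a < r < b -> derivable_pt_lim F (S r) (dF (S r)) /\
     Rabs (F (S r)) <= K /\ Rabs (dF (S r)) <= K) ->
  C1b a b S -> C1b a b (fun r => F (S r)).
Proof.
  intros HF [L HL]. exists (K + K * L). intros r Hr.
  destruct (HF r Hr) as (H1 & H2 & H3). destruct (HL r Hr) as (_ & l & H4 & H5).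
  pose proof (Rabs_mult_le _ _ _ _ H3 H5). pose proof (Rabs_pos (dF (S r) * l)).
  pose proof (Rabs_pos (F (S r))). split; [lra|].
  exists (dF (S r) * l). split; [now apply dpl_comp|lra].
Qed.

(* Eigenvalues of the matrix [B] in the directions orthogonal to [x] and along [x], and the
   factor of [x] in the drift [b]. *)
Definition eigT (n : nat) (gd1 gd2 : gdata) (F1 F2 Shat : R -> R) (c1 c2 r : R) : R :=
  F1 (Shat r) * gfun gd1 (speed n c1 r) + F2 (Shat r) * gfun gd2 (speed n c2 r).

Definition eigR (n : nat) (gd1 gd2 : gdata) (F1 F2 Shat : R -> R) (c1 c2 r : R) : R :=
  F1 (Shat r) * (gfun gd1 (speed n c1 r) + sgder gd1 (speed n c1 r))
  + F2 (Shat r) * (gfun gd2 (speed n c2 r) + sgder gd2 (speed n c2 r)).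

Definition drift (n : nat) (gd1 gd2 : gdata) (dF1 dF2 Shat : R -> R) (c1 c2 r : R) : R :=
  dF2 (Shat r) * (gfun gd2 (speed n c2 r) * (c2 * / r ^ n))
  - dF1 (Shat r) * (gfun gd1 (speed n c1 r) * (c1 * / r ^ n)).

Lemma Bmat_radmat (n : nat) (gd1 gd2 : gdata) (F1 F2 Shat : R -> R) (c1 c2 : R) (x : pt) (k l : nat) :
  0 < vnorm n x ->
  Bmat n gd1 gd2 F1 F2 Shat c1 c2 x k l
  = radmat n (eigT n gd1 gd2 F1 F2 Shat c1 c2) (eigR n gd1 gd2 F1 F2 Shat c1 c2) x k l.
Proof.
  intros Hr. unfold Bmat. rewrite !Gjac_radmat by assumption. unfold radmat, eigT, eigR. ring.
Qed.

Lemma bvec_drift (n : nat) (gd1 gd2 : gdata) (dF1 dF2 Shat : R -> R) (c1 c2 : R) (x : pt) (k : nat) :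
  0 < vnorm n x ->
  bvec n gd1 gd2 dF1 dF2 Shat c1 c2 x k = drift n gd1 gd2 dF1 dF2 Shat c1 c2 (vnorm n x) * x k.
Proof. intros Hr. unfold bvec, drift. rewrite !Gv_ustar by assumption. ring. Qed.

(** The upper bounds for the flow factors are taken at r0: the speeds |c_i| r^(1 - n) decrease with
    r, while g_i(s) and s g_i'(s) increase with s. The factors F_i and F_i' are controlled by their
    extrema on [slo, shi]. C0 and C2 are products of sums, so they exceed the actual bounds by
    nonnegative cross terms. *)
Lemma radial_coefficients (n : nat) (gd1 gd2 : gdata) (F1 F2 dF1 dF2 Shat : R -> R)
  (c1 c2 r0 RR slo shi mx1 mx2 mn1 mn2 md1 md2 : R) :
  (2 <= n)%nat -> gvalid gd1 -> gvalid gd2 -> 0 < r0 < RR -> 0 < slo -> shi < 1 ->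
  (forall s, 0 < s < 1 -> 0 < F1 s /\ derivable_pt_lim F1 s (dF1 s) /\
     exists l, derivable_pt_lim dF1 s l) ->
  (forall s, 0 < s < 1 -> 0 < F2 s /\ derivable_pt_lim F2 s (dF2 s) /\
     exists l, derivable_pt_lim dF2 s l) ->
  cont_closed Shat r0 RR ->
  (forall r, r0 < r < RR ->
     derivable_pt_lim Shat r
       (Gs gd2 (c2 * rpow r (1 - INR n)) * F2 (Shat r)
        - Gs gd1 (c1 * rpow r (1 - INR n)) * F1 (Shat r))) ->
  (forall r, r0 <= r <= RR -> slo <= Shat r <= shi) ->
  is_max_on F1 slo shi mx1 -> is_max_on F2 slo shi mx2 ->
  is_min_on F1 slo shi mn1 -> is_min_on F2 slo shi mn2 ->
  is_max_on (fun s => Rabs (dF1 s)) slo shi md1 -> is_max_on (fun s => Rabs (dF2 s)) slo shi md2 ->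
  let bT := eigT n gd1 gd2 F1 F2 Shat c1 c2 in
  let bR := eigR n gd1 gd2 F1 F2 Shat c1 c2 in
  let b := drift n gd1 gd2 dF1 dF2 Shat c1 c2 in
  let C0 := d4c n gd1 gd2 c1 c2 r0 * (mx1 + mx2) in
  let C1 := d0c gd1 gd2 * (mn1 + mn2) in
  let C2 := d2c n gd1 gd2 c1 c2 r0 * (md1 + md2) in
  0 < C1 /\ C1 <= C0 /\ 0 <= C2 /\
  (exists m, 0 < m /\ forall r, r0 <= r <= RR -> m <= bT r /\ m <= bR r <= C0) /\
  C1b r0 RR bT /\ C1b r0 RR bR /\ C1b r0 RR (fun r => F1 (Shat r)) /\
  (exists b', forall r, r0 < r < RR -> derivable_pt_lim b r (b' r)) /\
  (forall r, continuity_pt (fun s => bR (clamp r0 RR s)) r) /\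
  (forall r, continuity_pt (fun s => clamp r0 RR s * b (clamp r0 RR s)) r) /\
  (forall r, r0 <= r <= RR -> Rabs (r * b r) <= C2).
Proof.
  intros Hn Hg1 Hg2 Hr Hslo Hshi HF1 HF2 HSc HSode HSb Hmx1 Hmx2 Hmn1 Hmn2 Hmd1 Hmd2 bT bR b C0 C1 C2.
  assert (HSr0 : slo <= Shat r0 <= shi) by (apply HSb; lra).
  set (A := speed n c1 r0). set (B := speed n c2 r0).
  assert (HA : 0 <= A) by apply speed_nonneg. assert (HB : 0 <= B) by apply speed_nonneg.
  set (g1 := gfun gd1 A). set (g2 := gfun gd2 B).
  set (e1 := sgder gd1 A). set (e2 := sgder gd2 B).
  assert (HC0 : C0 = (g1 + g2 + (e1 + e2)) * (mx1 + mx2)).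
  { unfold C0, d4c, d3c. rewrite !d3term_sgder by lra. reflexivity. }
  assert (HC2 : C2 = (g1 * A + g2 * B) * (md1 + md2)) by reflexivity.
  destruct (gfun_pos gd1 A Hg1 HA) as [Hg1a Hg1p]. destruct (gfun_pos gd2 B Hg2 HB) as [Hg2a Hg2p].
  fold g1 in Hg1a, Hg1p. fold g2 in Hg2a, Hg2p.
  pose proof (sgder_nonneg gd1 A Hg1) as He1. pose proof (sgder_nonneg gd2 B Hg2) as He2.
  fold e1 in He1. fold e2 in He2.
  assert (Hmn1p : 0 < mn1).
  { destruct Hmn1 as [(s & Hs & <-) _]. apply HF1. lra. }
  assert (Hmn2p : 0 < mn2).
  { destruct Hmn2 as [(s & Hs & <-) _]. apply HF2. lra. }
  assert (HFb : forall s, slo <= s <= shi ->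
     mn1 <= F1 s <= mx1 /\ mn2 <= F2 s <= mx2 /\ Rabs (dF1 s) <= md1 /\ Rabs (dF2 s) <= md2).
  { intros s Hs. repeat split; [apply Hmn1|apply Hmx1|apply Hmn2|apply Hmx2|apply Hmd1|apply Hmd2];
      assumption. }
  destruct (HFb _ HSr0) as (Hm1 & Hm2 & Hm3 & Hm4).
  assert (Hmd1p : 0 <= md1) by (pose proof (Rabs_pos (dF1 (Shat r0))); lra).
  assert (Hmd2p : 0 <= md2) by (pose proof (Rabs_pos (dF2 (Shat r0))); lra).
  assert (Hsp : forall r, r0 <= r <= RR ->
     ga0 gd1 <= gfun gd1 (speed n c1 r) <= g1 /\ ga0 gd2 <= gfun gd2 (speed n c2 r) <= g2 /\
     0 <= sgder gd1 (speed n c1 r) <= e1 /\ 0 <= sgder gd2 (speed n c2 r) <= e2 /\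
     0 <= speed n c1 r <= A /\ 0 <= speed n c2 r <= B).
  { intros r Hrr.
    pose proof (speed_le n c1 r0 r ltac:(lia) ltac:(lra)) as H1.
    pose proof (speed_le n c2 r0 r ltac:(lia) ltac:(lra)) as H2.
    pose proof (speed_nonneg n c1 r). pose proof (speed_nonneg n c2 r).
    repeat split; try assumption;
      try (now apply gfun_pos); try (now apply gfun_le); try (now apply sgder_nonneg);
      now apply sgder_le. }
  assert (Hga1 : 0 < ga0 gd1) by apply Hg1. assert (Hga2 : 0 < ga0 gd2) by apply Hg2.
  assert (Hd0 : 0 < d0c gd1 gd2 <= g1).
  { unfold d0c. rewrite !gfun_0. split; [now apply Rmin_pos|].
    eapply Rle_trans; [apply Rmin_l|assumption]. }
  assert (Hc1 : C1b r0 RR (fun r => gfun gd1 (speed n c1 r))) by (apply C1b_gfun; lra).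
  assert (Hc2 : C1b r0 RR (fun r => gfun gd2 (speed n c2 r))) by (apply C1b_gfun; lra).
  assert (Hs1 : C1b r0 RR (fun r => sgder gd1 (speed n c1 r))) by (apply C1b_sgder; lra).
  assert (Hs2 : C1b r0 RR (fun r => sgder gd2 (speed n c2 r))) by (apply C1b_sgder; lra).
  assert (HGs : forall d c r, r0 <= r -> Rabs (Gs d (c * rpow r (1 - INR n)))
            = Rabs (gfun d (speed n c r)) * speed n c r).
  { intros d c r Hrr. unfold Gs. rewrite Rabs_mult.
    assert (E : Rabs (c * rpow r (1 - INR n)) = speed n c r).
    { rewrite Rabs_mult, (Rabs_right (rpow _ _)) by (apply Rle_ge, rpow_nonneg). reflexivity. }
    now rewrite E. }
  (* The right-hand side of the ODE bounds the derivative of [Shat]. *)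
  assert (HCS : C1b r0 RR Shat).
  { exists (1 + (g2 * B * mx2 + g1 * A * mx1)). intros r Hrr.
    specialize (HSb r ltac:(lra)).
    destruct (HFb _ HSb) as (K1 & K2 & _). destruct (Hsp r ltac:(lra)) as (P1 & P2 & _ & _ & P5 & P6).
    assert (0 <= g2 * B * mx2) by (apply Rmult_le_pos; [apply Rmult_le_pos|]; lra).
    assert (0 <= g1 * A * mx1) by (apply Rmult_le_pos; [apply Rmult_le_pos|]; lra).
    split; [rewrite Rabs_right; lra|]. eexists. split; [now apply HSode|].
    unfold Rminus. eapply Rle_trans; [apply Rabs_triang|]. rewrite Rabs_Ropp, !Rabs_mult.
    fold (Rminus 1 (INR n)). rewrite !HGs by lra.
    rewrite !Rabs_right by lra.
    assert (gfun gd2 (speed n c2 r) * speed n c2 r * F2 (Shat r) <= g2 * B * mx2).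
    { apply Rmult_le_compat; [apply Rmult_le_pos; lra|lra| |lra]. apply Rmult_le_compat; lra. }
    assert (gfun gd1 (speed n c1 r) * speed n c1 r * F1 (Shat r) <= g1 * A * mx1).
    { apply Rmult_le_compat; [apply Rmult_le_pos; lra|lra| |lra]. apply Rmult_le_compat; lra. }
    lra. }
  assert (HCF1 : C1b r0 RR (fun r => F1 (Shat r))).
  { apply (C1b_comp r0 RR (mx1 + md1) F1 dF1); [|assumption]. intros r Hrr.
    specialize (HSb r ltac:(lra)). destruct (HFb _ HSb) as (K1 & _ & K3 & _).
    split; [apply HF1; lra|]. rewrite Rabs_right; lra. }
  assert (HCF2 : C1b r0 RR (fun r => F2 (Shat r))).
  { apply (C1b_comp r0 RR (mx2 + md2) F2 dF2); [|assumption]. intros r Hrr.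
    specialize (HSb r ltac:(lra)). destruct (HFb _ HSb) as (_ & K2 & _ & K4).
    split; [apply HF2; lra|]. rewrite Rabs_right; lra. }
  assert (Hpowd : forall r, 0 < r -> exists l, derivable_pt_lim (fun r => / r ^ n) r l).
  { intros r Hr0. eexists. apply dpl_inv; [apply derivable_pt_lim_pow|].
    apply pow_nonzero. lra. }
  assert (HSx : forall r, continuity_pt (fun s => Shat (clamp r0 RR s)) r)
    by (apply cont_closed_clamp; [lra|assumption]).
  assert (Hcomp : forall F, (forall s, 0 < s < 1 -> continuity_pt F s) ->
     forall r, continuity_pt (fun s => F (Shat (clamp r0 RR s))) r).
  { intros F HF r. apply (continuity_pt_comp (fun s => Shat (clamp r0 RR s)) F); [apply HSx|].
    apply HF. specialize (HSb _ (clamp_in r0 RR r ltac:(lra))). lra. }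
  assert (Hgc : forall d c r, continuity_pt (fun s => gfun d (speed n c (clamp r0 RR s))) r).
  { intros d c. apply (clamp_comp_continuous (fun s => gfun d (speed n c s))); [lra|].
    intros r Hrr. apply C1b_continuous; [lra|]. intros. now apply C1b_gfun. }
  assert (Hsc : forall d c r, continuity_pt (fun s => sgder d (speed n c (clamp r0 RR s))) r).
  { intros d c. apply (clamp_comp_continuous (fun s => sgder d (speed n c s))); [lra|].
    intros r Hrr. apply C1b_continuous; [lra|]. intros. now apply C1b_sgder. }
  assert (Hpc : forall c r, continuity_pt (fun s => c * / clamp r0 RR s ^ n) r).
  { intros c. apply (clamp_comp_continuous (fun s => c * / s ^ n)); [lra|].
    intros r Hrr. destruct (Hpowd r ltac:(lra)) as [l Hl].
    exact (dpl_continuous _ _ _ (dpl_mult _ _ r _ _ (dpl_const c r) Hl)). }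
  split; [|split; [|split; [|split; [|split; [|split; [|split; [|split; [|split; [|split]]]]]]]]].
  - unfold C1. apply Rmult_lt_0_compat; lra.
  - rewrite HC0. unfold C1. apply Rmult_le_compat; lra.
  - rewrite HC2. apply Rmult_le_pos; [|lra].
    apply Rplus_le_le_0_compat; apply Rmult_le_pos; lra.
  (* Any positive lower bound will do here, so only the first of the two summands of each eigenvalue
     is kept. *)
  - exists (mn1 * ga0 gd1). split; [now apply Rmult_lt_0_compat|]. intros r Hrr.
    specialize (HSb r Hrr). destruct (HFb _ HSb) as (K1 & K2 & _).
    destruct (Hsp r Hrr) as (P1 & P2 & P3 & P4 & _).
    unfold bT, bR, eigT, eigR.
    assert (L1 : mn1 * ga0 gd1 <= F1 (Shat r) * gfun gd1 (speed n c1 r)) by (apply Rmult_le_compat; lra).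
    assert (L2 : 0 <= F2 (Shat r) * gfun gd2 (speed n c2 r)) by (apply Rmult_le_pos; lra).
    assert (L3 : 0 <= F1 (Shat r) * sgder gd1 (speed n c1 r)) by (apply Rmult_le_pos; lra).
    assert (L4 : 0 <= F2 (Shat r) * sgder gd2 (speed n c2 r)) by (apply Rmult_le_pos; lra).
    split; [lra|]. split; [rewrite !Rmult_plus_distr_l; lra|].
    rewrite HC0.
    assert (U1 : F1 (Shat r) * (gfun gd1 (speed n c1 r) + sgder gd1 (speed n c1 r))
                 <= mx1 * (g1 + e1)) by (apply Rmult_le_compat; lra).
    assert (U2 : F2 (Shat r) * (gfun gd2 (speed n c2 r) + sgder gd2 (speed n c2 r))
                 <= mx2 * (g2 + e2)) by (apply Rmult_le_compat; lra).
    assert (0 <= mx1 * (g2 + e2)) by (apply Rmult_le_pos; lra).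
    assert (0 <= mx2 * (g1 + e1)) by (apply Rmult_le_pos; lra). lra.
  - apply C1b_plus; now apply C1b_mult.
  - apply C1b_plus; (apply C1b_mult; [assumption|]); now apply C1b_plus.
  - assumption.
  - apply (choice (fun r l => r0 < r < RR -> derivable_pt_lim b r l)).
    intros r. destruct (classic (r0 < r < RR)) as [Hrr|Hrr]; [|exists 0; tauto].
    destruct HCS as [KS HKS]. destruct (HKS r Hrr) as (_ & lS & HlS & _).
    destruct Hc1 as [K1 HK1]. destruct (HK1 r Hrr) as (_ & l1 & Hl1 & _).
    destruct Hc2 as [K2 HK2]. destruct (HK2 r Hrr) as (_ & l2 & Hl2 & _).
    destruct (Hpowd r ltac:(lra)) as [lp Hlp].
    specialize (HSb r ltac:(lra)).
    destruct (HF1 (Shat r) ltac:(lra)) as (_ & _ & m1 & Hdd1).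
    destruct (HF2 (Shat r) ltac:(lra)) as (_ & _ & m2 & Hdd2).
    eexists. intros _.
    exact (derivable_pt_lim_minus _ _ r _ _
      (dpl_mult _ _ r _ _ (dpl_comp Shat dF2 r _ _ HlS Hdd2)
        (dpl_mult _ _ r _ _ Hl2 (dpl_mult _ _ r _ _ (dpl_const c2 r) Hlp)))
      (dpl_mult _ _ r _ _ (dpl_comp Shat dF1 r _ _ HlS Hdd1)
        (dpl_mult _ _ r _ _ Hl1 (dpl_mult _ _ r _ _ (dpl_const c1 r) Hlp)))).
  - intros r.
    assert (HcF1 := Hcomp F1 (fun s Hs => dpl_continuous _ _ _ (proj1 (proj2 (HF1 s Hs)))) r).
    assert (HcF2 := Hcomp F2 (fun s Hs => dpl_continuous _ _ _ (proj1 (proj2 (HF2 s Hs)))) r).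
    exact (continuity_pt_plus _ _ r
      (continuity_pt_mult _ _ r HcF1 (continuity_pt_plus _ _ r (Hgc gd1 c1 r) (Hsc gd1 c1 r)))
      (continuity_pt_mult _ _ r HcF2 (continuity_pt_plus _ _ r (Hgc gd2 c2 r) (Hsc gd2 c2 r)))).
  - intros r.
    assert (HcF1 : continuity_pt (fun s => dF1 (Shat (clamp r0 RR s))) r).
    { apply Hcomp. intros s Hs. destruct (HF1 s Hs) as (_ & _ & l & Hl).
      now apply dpl_continuous with l. }
    assert (HcF2 : continuity_pt (fun s => dF2 (Shat (clamp r0 RR s))) r).
    { apply Hcomp. intros s Hs. destruct (HF2 s Hs) as (_ & _ & l & Hl).
      now apply dpl_continuous with l. }
    exact (continuity_pt_mult _ _ r (clamp_continuous r0 RR r ltac:(lra))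
      (continuity_pt_minus _ _ r
        (continuity_pt_mult _ _ r HcF2 (continuity_pt_mult _ _ r (Hgc gd2 c2 r) (Hpc c2 r)))
        (continuity_pt_mult _ _ r HcF1 (continuity_pt_mult _ _ r (Hgc gd1 c1 r) (Hpc c1 r))))).
  - intros r Hrr. specialize (HSb r Hrr). destruct (HFb _ HSb) as (_ & _ & K3 & K4).
    destruct (Hsp r Hrr) as (P1 & P2 & _ & _ & P5 & P6).
    (* This turns |r b(r)| into a quantity bounded by the terms |F_i'| g_i |u_i|, which is what d_2
       measures. *)
    assert (Hsr : forall c, Rabs (c * / r ^ n * r) = speed n c r).
    { intros c. unfold speed. rewrite rpow_pow by lra. rewrite Rmult_assoc, Rabs_mult.
      rewrite (Rabs_right (/ r ^ n * r)); [reflexivity|].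
      apply Rle_ge, Rmult_le_pos; [|lra]. apply Rlt_le, Rinv_0_lt_compat, pow_lt. lra. }
    replace (r * b r) with (dF2 (Shat r) * (gfun gd2 (speed n c2 r) * (c2 * / r ^ n * r))
      + - (dF1 (Shat r) * (gfun gd1 (speed n c1 r) * (c1 * / r ^ n * r))))
      by (unfold b, drift; ring).
    pose proof (Hsr c1) as HX1. pose proof (Hsr c2) as HX2.
    set (X1 := c1 * / r ^ n * r) in *. set (X2 := c2 * / r ^ n * r) in *.
    eapply Rle_trans; [apply Rabs_triang|]. rewrite Rabs_Ropp, !Rabs_mult, HX1, HX2.
    rewrite (Rabs_right (gfun gd1 _)), (Rabs_right (gfun gd2 _)) by lra.
    pose proof (Rabs_pos (dF1 (Shat r))). pose proof (Rabs_pos (dF2 (Shat r))).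
    assert (Rabs (dF2 (Shat r)) * (gfun gd2 (speed n c2 r) * speed n c2 r) <= md2 * (g2 * B)).
    { apply Rmult_le_compat; [lra|apply Rmult_le_pos; lra|lra|]. apply Rmult_le_compat; lra. }
    assert (Rabs (dF1 (Shat r)) * (gfun gd1 (speed n c1 r) * speed n c1 r) <= md1 * (g1 * A)).
    { apply Rmult_le_compat; [lra|apply Rmult_le_pos; lra|lra|]. apply Rmult_le_compat; lra. }
    assert (0 <= md2 * (g1 * A)) by (apply Rmult_le_pos; [|apply Rmult_le_pos]; lra).
    assert (0 <= md1 * (g2 * B)) by (apply Rmult_le_pos; [|apply Rmult_le_pos]; lra).
    rewrite HC2. lra.
Qed.

(** Product rule entry by entry. The constant sums, over all pairs of indices, a common bound for
    the entry of M and its derivative, so it does not depend on V; this is what makes the final C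
    independent of the data. *)
Lemma flux_divergence (n : nat) (U : pt -> Prop) (M : nat -> nat -> pt -> R) :
  (forall k m, (k < n)%nat -> (m < n)%nat -> C1bx n U (M k m)) ->
  exists N, 0 <= N /\
    forall (V : pt -> pt) (dV : nat -> nat -> R) (E : R) (x : pt), U x ->
      (forall k m, (k < n)%nat -> (m < n)%nat -> pd (fun y => V y m) x k (dV m k)) ->
      (forall k m, (k < n)%nat -> (m < n)%nat -> Rabs (V x m) + Rabs (dV m k) <= E) ->
      exists dW : nat -> R,
        (forall k, (k < n)%nat -> pd (fun y => fsum n (fun m => M k m y * V y m)) x k (dW k)) /\
        Rabs (fsum n dW) <= N * E.
Proof.
  intros HM.
  (* The bounds are made total in the indices, with value 0 out of range, so that choice yields a
     function. *)
  assert (HK : exists K : nat -> nat -> R, forall k m, 0 <= K k m /\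
     ((k < n)%nat -> (m < n)%nat -> forall x, U x -> Rabs (M k m x) <= K k m /\
       exists l, dird (M k m) x (kdelta k) l /\ Rabs l <= K k m)).
  { apply (choice (fun k (K : nat -> R) => forall m, 0 <= K m /\
      ((k < n)%nat -> (m < n)%nat -> forall x, U x -> Rabs (M k m x) <= K m /\
       exists l, dird (M k m) x (kdelta k) l /\ Rabs l <= K m))). intros k.
    apply (choice (fun m (K : R) => 0 <= K /\
      ((k < n)%nat -> (m < n)%nat -> forall x, U x -> Rabs (M k m x) <= K /\
       exists l, dird (M k m) x (kdelta k) l /\ Rabs l <= K))). intros m.
    destruct (classic ((k < n)%nat /\ (m < n)%nat)) as [[Hk Hm]|Hno].
    - destruct (HM k m Hk Hm) as [K HK]. exists (Rabs K). split; [apply Rabs_pos|].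
      intros _ _ x Hx. destruct (HK x Hx) as [H1 H2]. destruct (H2 k Hk) as (l & H3 & H4).
      pose proof (Rle_abs K). split; [lra|]. exists l. split; [assumption|lra].
    - exists 0. split; [lra|]. intros. tauto. }
  destruct HK as [K HK].
  exists (fsum n (fun k => fsum n (fun m => K k m))). split.
  { apply fsum_nonneg. intros. apply fsum_nonneg. intros. apply HK. }
  intros V dV E x Hx HV HE.
  assert (Hd : exists d : nat -> nat -> R, forall k m, (k < n)%nat -> (m < n)%nat ->
     dird (M k m) x (kdelta k) (d k m) /\ Rabs (d k m) <= K k m).
  { apply (choice (fun k (d : nat -> R) => forall m, (k < n)%nat -> (m < n)%nat ->
      dird (M k m) x (kdelta k) (d m) /\ Rabs (d m) <= K k m)). intros k.
    apply (choice (fun m d => (k < n)%nat -> (m < n)%nat ->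
      dird (M k m) x (kdelta k) d /\ Rabs d <= K k m)). intros m.
    destruct (classic ((k < n)%nat /\ (m < n)%nat)) as [[Hk Hm]|Hno].
    - destruct (HK k m) as [_ H]. destruct (H Hk Hm x Hx) as (_ & l & Hl). exists l. auto.
    - exists 0. intros. tauto. }
  destruct Hd as [d Hd].
  exists (fun k => fsum n (fun m => d k m * V x m + M k m x * dV m k)). split.
  - intros k Hk. apply pd_dird. apply (dird_fsum n (fun m y => M k m y * V y m)).
    intros m Hm. apply (dird_mult (M k m) (fun y => V y m)); [now apply Hd|].
    apply pd_dird. now apply HV.
  - eapply Rle_trans; [apply fsum_Rabs|].
    rewrite (Rmult_comm _ E), <- fsum_scal. apply fsum_le. intros k Hk.
    eapply Rle_trans; [apply fsum_Rabs|]. rewrite <- fsum_scal. apply fsum_le. intros m Hm.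
    destruct (Hd k m Hk Hm) as [_ H1]. destruct (HK k m) as [H0 H2].
    destruct (H2 Hk Hm x Hx) as [H3 _]. specialize (HE k m Hk Hm).
    eapply Rle_trans; [apply Rabs_triang|]. rewrite !Rabs_mult.
    pose proof (Rabs_pos (V x m)). pose proof (Rabs_pos (dV m k)).
    pose proof (Rabs_pos (d k m)). pose proof (Rabs_pos (M k m x)). nra.
Qed.

(** If m < 0, no element can lie between 0 and m, so P is empty and m - 1 is an upper bound too,
    contradicting minimality. *)
Lemma lub_nonneg (P : R -> Prop) (m : R) : is_lub P m -> (forall y, P y -> 0 <= y) -> 0 <= m.
Proof.
  intros [Hub Hl] HP. apply Rnot_lt_le. intros Hm.
  specialize (Hl (m - 1)). cut (m <= m - 1); [lra|]. apply Hl. intros y Hy.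
  specialize (Hub y Hy). specialize (HP y Hy). lra.
Qed.

(** * The decay estimate and the asymptotic bound *)

Theorem theorem4p8
  (* dimension *)
  (n : nat) (hn : (2 <= n)%nat)
  (* g_1, g_2 *)
  (gd1 gd2 : gdata) (hg1 : gvalid gd1) (hg2 : gvalid gd2)
  (* f_1, f_2 with their derivatives on (0,1) *)
  (f1 f2 df1 df2 : R -> R)
  (hf1c : cont_closed f1 0 1) (hf2c : cont_closed f2 0 1)
  (hf1d : forall s, 0 < s < 1 ->
     derivable_pt_lim f1 s (df1 s) /\ continuity_pt df1 s /\ 0 < df1 s)
  (hf2d : forall s, 0 < s < 1 ->
     derivable_pt_lim f2 s (df2 s) /\ continuity_pt df2 s /\ df2 s < 0)
  (hf10 : f1 0 = 0) (hf21 : f2 1 = 0)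
  (* p_c' in C^1((0,1)), positive *)
  (pc dpc : R -> R)
  (hpc : forall s, 0 < s < 1 ->
     derivable_pt_lim pc s (dpc s) /\ continuity_pt dpc s /\ 0 < pc s)
  (* condition (E1) on F_i = 1/(p_c' f_i) *)
  (hE1F1 : Ck_open 7 (Fcoef pc f1) 0 1) (hE1F2 : Ck_open 7 (Fcoef pc f2) 0 1)
  (* F_i' on (0,1) *)
  (dF1 dF2 : R -> R)
  (hdF1 : forall s, 0 < s < 1 -> derivable_pt_lim (Fcoef pc f1) s (dF1 s))
  (hdF2 : forall s, 0 < s < 1 -> derivable_pt_lim (Fcoef pc f2) s (dF2 s))
  (* r_0, c_1, c_2, s_0 *)
  (r0 c1 c2 s0 : R) (hr0 : 0 < r0) (hc : c1 ^ 2 + c2 ^ 2 > 0) (hs0 : 0 < s0 < 1)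
  (* hat S, solving the ODE on [r_0, R], with values in [s_low, s_high] *)
  (Shat : R -> R) (RR slo shi : R) (hRR : r0 < RR)
  (hS0 : Shat r0 = s0) (hScont : cont_closed Shat r0 RR)
  (hSode : forall r, r0 < r < RR ->
     derivable_pt_lim Shat r
       (Gs gd2 (c2 * rpow r (1 - INR n)) * Fcoef pc f2 (Shat r)
        - Gs gd1 (c1 * rpow r (1 - INR n)) * Fcoef pc f1 (Shat r)))
  (hslo : 0 < slo) (hshi : shi < 1)
  (hSbd : forall r, r0 <= r <= RR -> slo <= Shat r <= shi)
  (* max / min used in mu_1, mu_2, mu_3 *)
  (mx1 mx2 mn1 mn2 md1 md2 : R)
  (hmx1 : is_max_on (Fcoef pc f1) slo shi mx1) (hmx2 : is_max_on (Fcoef pc f2) slo shi mx2)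
  (hmn1 : is_min_on (Fcoef pc f1) slo shi mn1) (hmn2 : is_min_on (Fcoef pc f2) slo shi mn2)
  (hmd1 : is_max_on (fun s => Rabs (dF1 s)) slo shi md1)
  (hmd2 : is_max_on (fun s => Rabs (dF2 s)) slo shi md2)
  (* the domain U *)
  (U : pt -> Prop) (hUo : Rn_open n U) (hUb : Rn_bounded n U)
  (hUsub : forall x, U x -> r0 < vnorm n x < RR)
  (* A = B^{-1} *)
  (Amat : pt -> nat -> nat -> R)
  (hA : forall x, U x -> forall k l, (k < n)%nat -> (l < n)%nat ->
     fsum n (fun m => Amat x k m * Bmat n gd1 gd2 (Fcoef pc f1) (Fcoef pc f2) Shat c1 c2 x m l)
     = kdelta k l) :
  let Dset := fun (x : pt) (t : R) => U x /\ 0 < t in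
  let Dbar := fun (x : pt) (t : R) => Rn_closure n U x /\ 0 <= t in
  let eta1 := eta1c n gd1 gd2 c1 c2 r0 RR (mx1 + mx2) (mn1 + mn2) (md1 + md2) in
  exists C : R, 0 < C /\
  forall (sig0 : pt -> R) (g : pt -> R -> R) (V : pt -> R -> pt)
         (DV : nat -> list nat -> pt -> R -> R)
         (M1 M2 S0 Delta5 : R) (h1 h2 : R -> R) (sig : pt -> R -> R),
    (* data of (Sigma) *)
    cont_on_sp n (Rn_closure n U) sig0 ->
    cont_on_st n (fun x t => Rn_boundary n U x /\ 0 <= t) g ->
    (forall x, Rn_boundary n U x -> sig0 x = g x 0) ->
    (* (E1) for V: V in C^6_x(Dbar), V_t in C^3_x(Dbar) *)
    (forall j, (j < n)%nat -> Cmx n 6 Dset Dbar (fun x t => V x t j) (DV j)) ->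
    (exists (Vt : nat -> pt -> R -> R) (DVt : nat -> list nat -> pt -> R -> R),
       forall j, (j < n)%nat ->
         (forall x t, Dset x t -> derivable_pt_lim (fun s => V x s j) t (Vt j x t)) /\
         Cmx n 3 Dset Dbar (Vt j) (DVt j)) ->
    (* Delta_4 = M1 + M2 < oo *)
    is_lub (fun y => exists x t, Dset x t /\
       y = vnorm n (V x t)
           + sqrt (fsum n (fun j => fsum n (fun k => DV j (k :: nil) x t ^ 2)))) M1 ->
    is_lub (fun y => exists x t, Rn_boundary n U x /\ 0 <= t /\ y = Rabs (g x t)) M2 ->
    (* S0 = sup_U |sigma_0| *)
    is_lub (fun y => exists x, U x /\ y = Rabs (sig0 x)) S0 ->
    (* Delta_5 *)
    (forall t, 0 < t -> is_lub (fun y => exists x, U x /\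
       y = vnorm n (V x t)
           + sqrt (fsum n (fun j => fsum n (fun k => DV j (k :: nil) x t ^ 2)))) (h1 t)) ->
    (forall t, 0 <= t -> is_lub (fun y => exists x, Rn_boundary n U x /\ y = Rabs (g x t)) (h2 t)) ->
    is_limsup_infty (fun t => h1 t + h2 t) Delta5 ->
    (* sigma : classical solution of (Sigma), in C(Dbar) cap C^{2,1}_{x,t}(D) *)
    cont_on_st n Dbar sig ->
    (exists (S1 : nat -> pt -> R -> R) (S2 : nat -> nat -> pt -> R -> R)
            (St : pt -> R -> R) (dJ : nat -> pt -> R -> R),
       (forall k, (k < n)%nat -> cont_on_st n Dset (S1 k)) /\
       (forall k l, (k < n)%nat -> (l < n)%nat -> cont_on_st n Dset (S2 k l)) /\
       cont_on_st n Dset St /\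
       (forall x t, Dset x t ->
          derivable_pt_lim (fun s => sig x s) t (St x t) /\
          (forall k, (k < n)%nat ->
             pd (fun y => sig y t) x k (S1 k x t) /\
             (forall l, (l < n)%nat -> pd (fun y => S1 k y t) x l (S2 k l x t))) /\
          (* sigma_t = div [ A (grad sigma - sigma b) ] + div (A c) *)
          (forall k, (k < n)%nat ->
             pd (fun y => fsum n (fun l => Amat y k l *
                   (S1 l y t
                    - sig y t * bvec n gd1 gd2 dF1 dF2 Shat c1 c2 y l
                    + cvec n gd1 (Fcoef pc f1) Shat c1 V y t l))) x k (dJ k x t)) /\
          St x t = fsum n (fun k => dJ k x t))) ->
    (forall x t, Rn_boundary n U x -> 0 < t -> sig x t = g x t) ->
    (forall x, U x -> sig x 0 = sig0 x) ->
    (forall t x, 0 < t -> U x ->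
       Rabs (sig x t) <= C * (exp (- eta1 * t) * S0 + (M1 + M2))) /\
    (forall eps, 0 < eps -> exists T, forall t x, T <= t -> U x ->
       Rabs (sig x t) <= C * Delta5 + eps).
Proof.
  intros Dset Dbar eta1.
  set (F1 := Fcoef pc f1) in *. set (F2 := Fcoef pc f2) in *.
  assert (Hf1p : forall s, 0 < s < 1 -> 0 < f1 s).
  { apply (pos_of_derive_pos f1 df1).
    - rewrite <- hf10 at 1. apply hf1c. lra.
    - intros s Hs. split; now apply hf1d. }
  (* f_2 decreases to 0 at s = 1; the reflection s -> 1 - s brings it to the situation of f_1. *)
  assert (Hf2p : forall s, 0 < s < 1 -> 0 < f2 s).
  { intros s Hs. replace s with (1 - (1 - s)) by ring.
    apply (pos_of_derive_pos (fun y => f2 (1 - y)) (fun y => - df2 (1 - y))); [| |lra].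
    - intros e He. destruct (hf2c 1 ltac:(lra) e He) as (d & Hd & H). exists d.
      split; [assumption|]. intros y [Hy Hyd]. rewrite hf21 in H. apply H. split; [lra|].
      simpl in *. unfold Rdist in *. replace (1 - y - 1) with (- (y - 0)) by ring.
      now rewrite Rabs_Ropp.
    - intros y Hy. destruct (hf2d (1 - y) ltac:(lra)) as (Hd & _ & Hneg). split; [|lra].
      eapply dpl_eq.
      + apply (dpl_comp (fun y => 1 - y) f2); [|exact Hd].
        exact (derivable_pt_lim_minus _ _ y _ _ (dpl_const 1 y) (derivable_pt_lim_id y)).
      + ring. }
  assert (HF1 : forall s, 0 < s < 1 -> 0 < F1 s /\ derivable_pt_lim F1 s (dF1 s) /\
                  exists l, derivable_pt_lim dF1 s l).
  { intros s Hs. split; [|split; [now apply hdF1|]].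
    - apply Rinv_0_lt_compat, Rmult_lt_0_compat; [now apply hpc|now apply Hf1p].
    - now apply (Ck_second_derivative F1 dF1 0 1). }
  assert (HF2 : forall s, 0 < s < 1 -> 0 < F2 s /\ derivable_pt_lim F2 s (dF2 s) /\
                  exists l, derivable_pt_lim dF2 s l).
  { intros s Hs. split; [|split; [now apply hdF2|]].
    - apply Rinv_0_lt_compat, Rmult_lt_0_compat; [now apply hpc|now apply Hf2p].
    - now apply (Ck_second_derivative F2 dF2 0 1). }
  assert (Hr0R : 0 < r0 < RR) by lra.
  assert (Hnn : 1 <= INR n) by (change 1 with (INR 1); apply le_INR; lia).
  destruct (radial_coefficients n gd1 gd2 F1 F2 dF1 dF2 Shat c1 c2 r0 RR slo shi mx1 mx2 mn1 mn2
              md1 md2 hn hg1 hg2 Hr0R hslo hshi HF1 HF2 hScont hSode hSbd hmx1 hmx2 hmn1 hmn2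
              hmd1 hmd2)
    as (HC1 & HC10 & HC2 & (m & Hm & HbTR) & HcT & HcR & HcF1 & (b' & Hb') & HbRc & Hrbc & Hrb).
  set (bT := eigT n gd1 gd2 F1 F2 Shat c1 c2) in *.
  set (bR := eigR n gd1 gd2 F1 F2 Shat c1 c2) in *.
  set (b := drift n gd1 gd2 dF1 dF2 Shat c1 c2) in *.
  destruct (rate_bound _ _ _ (INR n) r0 RR HC1 HC10 HC2 Hnn Hr0R) as [Hlam Hth].
  change (0 < eta1) in Hlam.
  set (C2 := d2c n gd1 gd2 c1 c2 r0 * (md1 + md2)) in *.
  destruct (radial_barrier r0 RR (d4c n gd1 gd2 c1 c2 r0 * (mx1 + mx2)) C2 eta1 (INR n) bR
              (fun r => r * b r) Hr0R Hlam HC2 Hnn HbRc Hrbc)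
    as (Lam & phi & psi & psi' & phimin & Hpm & HLamc & Hphic & HLam & Hphi & Hpsi & HLamb & Hphib).
  { intros r Hr. destruct (HbTR r Hr). lra. }
  { exact Hrb. }
  { exact Hth. }
  (* The explicit form of eta1 has done its work; from here on only eta1 > 0 and the barrier
     inequalities matter. *)
  clear Hth. clearbody eta1.
  set (aT := fun r => / bT r). set (aR := fun r => / bR r).
  assert (HaT : C1b r0 RR aT).
  { apply (C1b_inv r0 RR m); [assumption| |assumption]. intros r Hr. apply HbTR. lra. }
  assert (HaR : C1b r0 RR aR).
  { apply (C1b_inv r0 RR m); [assumption| |assumption]. intros r Hr. apply HbTR. lra. }
  assert (Hbp : forall r, r0 < r < RR -> 0 < bT r /\ 0 < bR r).
  { intros r Hr. destruct (HbTR r ltac:(lra)) as [H1 [H2 _]]. lra. }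
  destruct (C1b_derivative _ _ _ HaT) as [aT' HaT']. destruct (C1b_derivative _ _ _ HaR) as [aR' HaR'].
  set (gT := fun r => gfun gd1 (speed n c1 r)).
  set (gR := fun r => gfun gd1 (speed n c1 r) + sgder gd1 (speed n c1 r)).
  (* A c = M V with M = F_1 A G_1'(u_1), a product of matrices radial in x whose entries have
     bounded derivatives; the data enter only through V. *)
  set (M := fun k j x => fsum n (fun l => radmat n aT aR x k l
                           * (F1 (Shat (vnorm n x)) * radmat n gT gR x l j))).
  destruct (flux_divergence n U M) as (N0 & HN0 & Hflux).
  { intros k j Hk Hj. apply (C1bx_fsum n n U (fun l x => radmat n aT aR x k l
      * (F1 (Shat (vnorm n x)) * radmat n gT gR x l j))). intros l Hl.
    apply C1bx_mult; [now apply C1bx_radmat with r0 RR|]. apply C1bx_mult.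
    - now apply (C1bx_radial n U r0 RR (fun r => F1 (Shat r))).
    - apply C1bx_radmat with r0 RR; auto.
      + now apply C1b_gfun.
      + apply C1b_plus; [now apply C1b_gfun|now apply C1b_sgder]. }
  assert (HAmat : forall x, U x -> forall k l, (k < n)%nat -> (l < n)%nat ->
            Amat x k l = radmat n aT aR x k l).
  { intros x Hx k l Hk Hl. pose proof (hUsub x Hx) as Hr. pose proof (Hbp _ Hr) as [HT HR].
    apply (left_inverse_radmat n (Amat x) (Bmat n gd1 gd2 F1 F2 Shat c1 c2 x) bT bR); auto; try lra.
    intros i j _ _. apply Bmat_radmat. lra. }
  set (Q := exp (C2 * (RR - r0))). assert (HQ : 0 < Q) by apply exp_pos.
  (* Read off from the comparison bound with source N0 E: Q bounds exp(Lam) and exp(-Lam), Q /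
     phimin multiplies the initial and boundary data, Q N0 / eta1 the source. *)
  set (C := Q * (Q / phimin + Q * N0 / eta1)).
  assert (HQp : 0 < Q / phimin) by now apply Rdiv_lt_0_compat.
  assert (HQN : 0 <= Q * N0 / eta1).
  { apply Rmult_le_pos; [apply Rmult_le_pos; lra|]. now apply Rlt_le, Rinv_0_lt_compat. }
  assert (HC : 0 < C) by (apply Rmult_lt_0_compat; lra).
  exists C. split; [exact HC|].
  intros sig0 g V DV M1 M2 S0 Delta5 h1 h2 sig _ _ _ HV _ HM1 HM2 HS0 Hh1 Hh2 HD5 Hsigc Hsol Hbd Hini.
  destruct Hsol as (S1 & S2 & St & dJ & HS1c & HS2c & _ & Hsol).
  set (w := fun x t => vnorm n (V x t)
              + sqrt (fsum n (fun j => fsum n (fun k => DV j (k :: nil) x t ^ 2)))).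
  assert (Hw0 : forall x t, 0 <= w x t).
  { intros x t. apply Rplus_le_le_0_compat; [apply vnorm_nonneg|apply sqrt_pos]. }
  assert (HdW : exists dW : pt * R -> nat -> R, forall p, U (fst p) -> 0 < snd p ->
     (forall k, (k < n)%nat ->
        pd (fun y => fsum n (fun j => M k j y * V y (snd p) j)) (fst p) k (dW p k)) /\
     Rabs (fsum n (dW p)) <= N0 * w (fst p) (snd p)).
  { apply (choice (fun (p : pt * R) (d : nat -> R) => U (fst p) -> 0 < snd p ->
     (forall k, (k < n)%nat ->
        pd (fun y => fsum n (fun j => M k j y * V y (snd p) j)) (fst p) k (d k)) /\
     Rabs (fsum n d) <= N0 * w (fst p) (snd p))).
    intros [x t]. simpl. destruct (classic (U x /\ 0 < t)) as [[Hx Ht]|Hno];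
      [|exists (fun _ => 0); tauto].
    destruct (Hflux (fun y => V y t) (fun j k => DV j (k :: nil) x t) (w x t) x Hx) as (d & Hd).
    - intros k j Hk Hj. destruct (HV j Hj) as (Hnil & Hder & _).
      specialize (Hder nil k x t ltac:(simpl; lia) Hk (conj Hx Ht)). rewrite Hnil in Hder. exact Hder.
    (* Each entry of the gradient is at most the Frobenius norm contained in [w]. *)
    - intros k j Hk Hj. apply Rplus_le_compat; [now apply coord_le_vnorm|].
      rewrite <- (sqrt_pow2 (Rabs (DV j (k :: nil) x t))), pow2_abs by apply Rabs_pos.
      apply sqrt_le_1_alt.
      eapply Rle_trans; [|apply (fsum_term_le n (fun j => fsum n (fun k => DV j (k :: nil) x t ^ 2)) j)];
        [|intros; apply fsum_sqr_nonneg|assumption].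
      apply (fsum_term_le n (fun k => DV j (k :: nil) x t ^ 2) k); [|assumption].
      intros; apply pow2_ge_0.
    - exists d. auto. }
  destruct HdW as [dW HdW].
  (* The estimate restarted at an arbitrary time T0, with E bounding V, its gradient and g at later
     times only. *)
  assert (Core : forall T0 H E, 0 <= T0 -> 0 <= E ->
     (forall x t, U x -> T0 < t -> w x t <= E) ->
     (forall x t, Rn_boundary n U x -> T0 < t -> Rabs (g x t) <= E) ->
     (forall x, U x -> Rabs (sig x T0) <= H) ->
     forall x t, U x -> T0 <= t -> Rabs (sig x t) <= C * (exp (- eta1 * (t - T0)) * H + E)).
  { intros T0 H E HT0 HE Hw Hg HH x t Hx Ht.
    assert (HH0 : 0 <= H) by (eapply Rle_trans; [apply Rabs_pos|apply (HH x Hx)]).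
    eapply Rle_trans.
    - apply (parabolic_comparison n U r0 RR eta1 (C2 * (RR - r0)) phimin aT aR b Lam phi psi
               aT' aR' b' psi' sig St (fun x t => fsum n (dW (x, t))) S1
               (fun k x t => dJ k x t - dW (x, t) k) S2 T0 H E (N0 * E)); auto.
      + intros r Hr. split; [now apply HaT'|]. apply Rinv_0_lt_compat. now apply Hbp.
      + intros r Hr. split; [now apply HaR'|]. apply Rinv_0_lt_compat. now apply Hbp.
      + intros r Hr. eapply dpl_eq; [now apply Hphi|]. unfold aR.
        destruct (Hbp r Hr) as [_ HR]. field. lra.
      + now apply Rmult_le_pos.
      + intros y s Hy Hs. apply (Hsol y s). split; assumption.
      + intros k y s Hk Hy Hs. apply (Hsol y s); [split|]; assumption.
      + intros k l y s Hk Hl Hy Hs. apply (Hsol y s); [split| |]; assumption.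
      + intros k y s Hk Hy Hs.
        destruct (Hsol y s (conj Hy Hs)) as (_ & _ & HJ & _). specialize (HJ k Hk).
        (* The given flux includes c; subtracting the derivatives of A c leaves the flux A (grad
           sigma - sigma b) and makes div(A c) the source of the comparison. *)
        destruct (HdW (y, s) Hy Hs) as [HWd _]. specialize (HWd k Hk). cbn [fst snd] in HWd.
        apply pd_dird. apply pd_dird in HJ. apply pd_dird in HWd.
        pose proof (dird_plus _ _ y _ _ _ HJ (dird_scal (- 1) _ y _ _ HWd)) as HD.
        apply dird_ext_open with (n := n) (U := U)
          (g := fun y => fsum n (fun l => radmat n aT aR y k l
                 * (S1 l y s - sig y s * (b (vnorm n y) * y l)))) in HD;
          [|assumption|assumption|now apply is_pt_kdelta|].
        * eapply dird_eq; [exact HD|]. ring.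
        * intros z Hz. cbv beta. pose proof (hUsub z Hz) as Hrz.
          assert (HMV : fsum n (fun j => M k j z * V z s j)
             = fsum n (fun l => radmat n aT aR z k l * cvec n gd1 F1 Shat c1 V z s l)).
          { rewrite (fsum_ext n _ (fun j => fsum n (fun l => radmat n aT aR z k l
              * (F1 (Shat (vnorm n z)) * (radmat n gT gR z l j * V z s j))))).
            - rewrite fsum_exchange. apply fsum_ext. intros l _. unfold cvec.
              rewrite !fsum_scal. f_equal. f_equal. apply fsum_ext. intros j _.
              rewrite Gjac_radmat by lra. reflexivity.
            - intros j _. unfold M. rewrite Rmult_comm, <- fsum_scal. apply fsum_ext; intros; ring. }
          rewrite HMV, <- fsum_scal, <- fsum_plus. apply fsum_ext. intros l Hl.
          rewrite HAmat, bvec_drift by (assumption || lra). fold b. ring.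
      + intros y s Hy Hs. destruct (Hsol y s (conj Hy Hs)) as (_ & _ & _ & Heq). rewrite Heq.
        rewrite <- fsum_plus. apply fsum_ext. intros; ring.
      + intros y s Hy Hs. destruct (HdW (y, s) Hy ltac:(simpl; lra)) as [_ HWb]. cbn [fst snd] in HWb.
        eapply Rle_trans; [exact HWb|]. apply Rmult_le_compat_l; auto.
      + intros y s Hy Hs. rewrite Hbd by (assumption || lra). auto.
    - fold Q. unfold C. pose proof (exp_pos (- eta1 * (t - T0))) as Hex.
      set (ex := exp (- eta1 * (t - T0))) in *.
      rewrite (Rmult_assoc Q (Q / phimin + Q * N0 / eta1)). apply Rmult_le_compat_l; [lra|].
      replace (Q * (N0 * E) / eta1) with (Q * N0 / eta1 * E) by (field; lra).
      assert (0 <= Q * N0 / eta1 * (ex * H)) by (apply Rmult_le_pos; [|apply Rmult_le_pos]; lra).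
      lra. }
  assert (HM1p : 0 <= M1).
  { apply (lub_nonneg _ _ HM1). intros y (x & t & _ & ->). apply Hw0. }
  assert (HM2p : 0 <= M2).
  { apply (lub_nonneg _ _ HM2). intros y (x & t & _ & _ & ->). apply Rabs_pos. }
  assert (HS0p : 0 <= S0).
  { apply (lub_nonneg _ _ HS0). intros y (x & _ & ->). apply Rabs_pos. }
  assert (Hfirst : forall t x, 0 < t -> U x -> Rabs (sig x t) <= C * (exp (- eta1 * t) * S0 + (M1 + M2))).
  { intros t x Ht Hx. rewrite <- (Rminus_0_r t) at 2.
    apply Core; auto; try lra.
    - intros y s Hy Hs. apply Rle_trans with M1; [|lra]. apply HM1. exists y, s. repeat split; auto.
    - intros y s Hy Hs. apply Rle_trans with M2; [|lra]. apply HM2. exists y, s.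
      repeat split; try apply Hy; lra.
    - intros y Hy. rewrite Hini by assumption. apply HS0. exists y. auto. }
  split; [exact Hfirst|].
  (* Half of eps covers the excess over Delta5 allowed by the limsup, the other half what remains of
     the values at T0. *)
  intros eps Heps. set (e := eps / (2 * C)).
  assert (He : 0 < e) by (apply Rdiv_lt_0_compat; lra).
  assert (HCe : C * e = eps / 2) by (unfold e; field; lra).
  destruct HD5 as [HD5 _]. destruct (HD5 e He) as [T1 HT1].
  (* At least 1, because [h1] and the first estimate are available for positive times only. *)
  set (T0 := Rmax T1 1).
  assert (HT0 : T1 <= T0 /\ 1 <= T0) by (split; [apply Rmax_l|apply Rmax_r]).
  assert (Hh1p : forall t, T0 <= t -> 0 <= h1 t).
  { intros t Ht. apply (lub_nonneg _ _ (Hh1 t ltac:(lra))). intros y (x & _ & ->). apply Hw0. }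
  assert (Hh2p : forall t, T0 <= t -> 0 <= h2 t).
  { intros t Ht. apply (lub_nonneg _ _ (Hh2 t ltac:(lra))). intros y (x & _ & ->). apply Rabs_pos. }
  assert (HE : 0 <= Delta5 + e).
  { pose proof (HT1 T0 ltac:(lra)). pose proof (Hh1p T0 ltac:(lra)). pose proof (Hh2p T0 ltac:(lra)). lra. }
  (* Bound for sig at time T0 from the first estimate, uniform in T0. *)
  set (H := C * (S0 + (M1 + M2))).
  assert (HH : 0 <= H) by (apply Rmult_le_pos; lra).
  (* Waiting time after which C H exp(-eta1 (t - T0)) <= eps / 2; it comes from y <= exp(y) with y =
     eta1 (t - T0). *)
  set (X := 2 * C * H / eps / eta1).
  assert (HX : 0 <= X).
  { unfold X. apply Rmult_le_pos; [|now apply Rlt_le, Rinv_0_lt_compat].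
    apply Rmult_le_pos; [|now apply Rlt_le, Rinv_0_lt_compat].
    apply Rmult_le_pos; lra. }
  exists (T0 + X). intros t x Ht Hx.
  eapply Rle_trans.
  - apply (Core T0 H (Delta5 + e)); auto; try lra.
    + intros y s Hy Hs. apply Rle_trans with (h1 s).
      * apply (Hh1 s ltac:(lra)). exists y. auto.
      * pose proof (HT1 s ltac:(lra)). pose proof (Hh2p s ltac:(lra)). lra.
    + intros y s Hy Hs. apply Rle_trans with (h2 s).
      * apply (Hh2 s ltac:(lra)). exists y. auto.
      * pose proof (HT1 s ltac:(lra)). pose proof (Hh1p s ltac:(lra)). lra.
    + intros y Hy. eapply Rle_trans; [apply Hfirst; [lra|assumption]|].
      unfold H. apply Rmult_le_compat_l; [lra|].
      assert (exp (- eta1 * T0) <= 1).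
      { rewrite <- exp_0. apply exp_monotone.
        assert (0 <= eta1 * T0) by (apply Rmult_le_pos; lra). lra. }
      assert (exp (- eta1 * T0) * S0 <= 1 * S0) by (apply Rmult_le_compat_r; lra). lra.
  - set (y := eta1 * (t - T0)).
    assert (Hy : 2 * C * H / eps <= y).
    { unfold y. replace (2 * C * H / eps) with (eta1 * X) by (unfold X; field; lra).
      apply Rmult_le_compat_l; lra. }
    assert (HCH : 0 <= C * H) by (apply Rmult_le_pos; lra).
    replace (- eta1 * (t - T0)) with (- y) by (unfold y; ring).
    assert (Hexp : exp (- y) * (C * H) <= eps / 2).
    { rewrite exp_Ropp. pose proof (exp_pos y) as Hp.
      assert (Hy1 : y <= exp y).
      { destruct (Req_dec y 0) as [->|Hy0]; [rewrite exp_0; lra|].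
        pose proof (exp_ineq1 y Hy0). lra. }
      apply Rmult_le_reg_l with (exp y); [assumption|].
      rewrite <- Rmult_assoc, Rinv_r, Rmult_1_l by lra.
      replace (C * H) with (2 * C * H / eps * (eps / 2)) by (field; lra).
      apply Rmult_le_compat_r; lra. }
    lra.
Qed.
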